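(* Let $\phi$ be a Sturmian coloring of the $d$-regular tree $T$. (1) Suppose that for every $n$ the graph $\mathcal G_n$ has no cycle. Then there exist $K\in[0,\infty]$ and a sequence of integers $(n_k)_{k\ge 0}$ with $n_k=k$ for $0\le k\le K$ such that, as edge-indexed graphs, - if $0\le n<K$: $\mathcal G^A_n\cong\mathcal G^A_{n-1}$ and $\mathcal G^B_n\cong \mathcal G^A_{n-1}\bowtie\mathcal G^B_{n-1}$; - if $n=K$: either ($\mathcal G^A_n\cong\mathcal G^A_{n-1}\bowtie\mathcal G^B_{n-1}$ and $\mathcal G^B_n\cong\mathcal G^A_{n-1}\bowtie\mathcal G^B_{n-1}$) or ($\mathcal G^A_n\cong\mathcal G^A_{n-1}\bowtie\mathcal G^B_{n-1}$ and $\mathcal G^B_n\cong\mathcal G^B_{n-1}$); - if $n>K$ and $n\ne n_k$ for all $k$: $\mathcal G^A_n\cong\mathcal G^A_{n-1}$ and $\mathcal G^B_n\cong\mathcal G^B_{n-1}$; - if $n>K$ and $n=n_k$ for some $k$: either ($\mathcal G^A_n\cong\mathcal G^A_{n-1}\bowtie\mathcal G^B_{n-1}$ and $\mathcal G^B_n\cong\mathcal G^B_{n-1}$) or ($\mathcal G^A_n\cong\mathcal G^A_{n-1}$ and $\mathcal G^B_n\cong\mathcal G^A_{n-1}\bowtie\mathcal G^B_{n-1}$). Here each occurrence of $\mathcal G^A_{n-1}\bowtie\mathcal G^B_{n-1}$ denotes some $(i)$-concatenation (if $C_{n-1}\ne S_{n-1}$) or some $(i,j)$-concatenation (if $C_{n-1}=S_{n-1}$)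 at $(C_{n-1},C_{n-1})$; different occurrences may have different indices. (2) If $\mathcal G_n$ has a cycle for some $n$, then $\phi$ is of bounded type. Moreover, $\phi$ is of bounded type if and only if either the sequence $(\mathcal G^A_n)_n$ or the sequence $(\mathcal G^B_n)_n$ eventually stabilizes (i.e. its members are isomorphic as edge-indexed graphs for all sufficiently large $n$).
   Context: Balls and Sturmian colorings. $T$ is a $d$-regular tree with vertex set $VT$ and path metric. For $\phi:VT\to\{a,b\}$, $\mathcal B_n(x)$ is the closed $n$-ball around the vertex $x$, colored by $\phi$. Two $n$-balls are equivalent if there is a color-preserving isomorphism of balls between them (center to center); $[\mathcal B_n(x)]$ is the equivalence class, $\mathbf B_n(\phi)$ the set of classes. $\phi$ is Sturmian if $|\mathbf B_n(\phi)|=n+2$ for all $n\ge0$. Then for each $n\ge 0$ there is a unique class $S_n\in\mathbf B_n(\phi)$ (the special $n$-ball) which is the restriction, to the concentric $n$-ball, of two distinct classes of $(n+1)$-balls, denoted $A_{n+1},B_{n+1}$; any other class $D$ of $n$-balls has a unique extension $\overline D$ to a class of $(n+1)$-balls. $C_n$ is the class of the central $n$-ball of $S_{n+1}$. The type set of a vertex $v$ is the set of $m\ge0$ with $[\mathcal B_m(v)]=S_m$; $\phi$ is of bounded type if the type set of each vertex is finite. Naming of $A_n,B_n$: colors are named so that $S_0=A_0=[a]$, $B_0=[b]$. A class $D$ is always adjacent to $E$ if for every ball in class $D$ with center $x$ there is a ball in class $E$ whose center is at distance 1 from $x$. Inductively, $A_{n+1}$ is always adjacent to $A_n$, $B_{n+1}$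 is always adjacent to $B_n$, and the number of neighbors of the center of $A_{n+1}$ whose $n$-ball is in class $A_n$ is larger than the corresponding number for $B_{n+1}$ (this determines the names). Convention: $S_{-1}=A_{-1}=C_{-1}$ is the empty ball. Graphs. $\mathcal G_n$ ($n\ge0$) has vertex set $\mathbf B_n(\phi)$; $D,E$ are joined by an edge if there are vertices $x,y$ of $T$ at distance 1 with $[\mathcal B_n(x)]=D$, $[\mathcal B_n(y)]=E$. Loops are cycles of length 1; ''cycle'' means a cycle of length $>1$. For $X\ne S_n$, $i_A(X,Y)=i_B(X,Y)=i(X,Y)$ is the number of $n$-balls of class $Y$ centered at neighbors of the center of a ball of class $X$; $i_A(S_n,Y)$ (resp. $i_B(S_n,Y)$) is the number of $n$-balls of class $Y$ centered at neighbors of the center of $A_{n+1}$ (resp. $B_{n+1}$). $\mathcal G^A_n$ is the edge-indexed graph whose vertices are the classes that can be reached from $S_n$ by a path of oriented edges with positive $i_A$, whose oriented edges (including loops) are those with positive $i_A$, indexed by $i_A$; $\mathcal G^B_n$ is defined likewise with $i_B$. $\mathcal G^A_{-1}=\mathcal G^B_{-1}$ is a single vertex (the empty ball) with one loop of index $d$. Concatenation. Let $\mathcal G_1,\mathcal G_2$ be edge-indexed graphs, $V$ (resp. $V'$) an end vertex of $\mathcal G_1$ (resp. $\mathcal G_2$), i.e. a vertex with at most one non-loop edge. Let $m_1,\ell_1$ (resp. $m_2,\ell_2$) be the index of the non-loop edge leaving $V$ (resp. $V'$) and the index of the loop at $V$ (resp. $V'$), with index $0$ meaning absence. (a) If $m_1=m_2=m$,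 $\ell_1=\ell_2=\ell$ and $1\le i<m$, the $(i)$-concatenation at $(V,V')$ is obtained from the disjoint union by identifying $V$ with $V'$ (and their loops); at the identified vertex the edge into $\mathcal G_1$ has index $i$, the edge into $\mathcal G_2$ has index $m-i$, the loop has index $\ell$; all other indices are unchanged. (b) For $1\le i\le\ell_1$, $1\le j\le\ell_2$, the $(i,j)$-concatenation at $(V,V')$ is the disjoint union together with a new edge between $V$ and $V'$, of index $i$ from $V$ to $V'$ and $j$ from $V'$ to $V$; the loops at $V,V'$ get indices $\ell_1-i$, $\ell_2-j$ (a loop of index 0 is deleted); all other indices are unchanged. *)

(* Defs.v *)
From mathcomp Require Import all_boot.
From mathcomp Require Import boolp classical_sets functions cardinality.

Set Implicit Arguments.
Unset Strict Implicit.
Unset Printing Implicit Defensive.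

Local Open Scope classical_set_scope.

(* A d-regular tree, presented by its neighbor lists.  The order of these
   lists is irrelevant to everything below. *)
Record regular_tree (d : nat) := RegularTree {
  tree_vertex :> eqType;
  nbr : tree_vertex -> seq tree_vertex;
  nbr_uniq : forall x, uniq (nbr x);
  nbr_size : forall x, size (nbr x) = d;
  nbr_sym : forall x y, (y \in nbr x) = (x \in nbr y);
  nbr_irr : forall x, x \notin nbr x;
  tree_connected : forall x y, exists2 p, path (grel nbr) x p & last x p = y;
  tree_acyclic : forall c : seq tree_vertex, ucycle (grel nbr) c -> size c <= 2
}.

Section Balls.
Context {d : nat} {T : regular_tree d} (phi : T -> bool).

(* The vertices at distance at most n from x. *)
Definition ball (n : nat) (x : T) : set T :=
  [set y | exists p, [/\ path (grel (@nbr d T)) x p, last x p = y & size p <= n]].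

Definition ball_iso (n : nat) (x y : T) (f : T -> T) : Prop :=
  [/\ set_bij (ball n x) (ball n y) f,
      f x = y,
      forall u v, ball n x u -> ball n x v -> (f v \in nbr (f u)) = (v \in nbr u)
    & forall u, ball n x u -> phi (f u) = phi u].

Definition ball_eqv (n : nat) (x y : T) : Prop := exists f, ball_iso n x y f.

(* A class of n-balls is encoded as the set of the centers of its members, so
   that "x is the center of a ball of class D" is D x.  Since a class and its
   unique extension may then be the same set of vertices, classes are only to
   be compared at the same radius.  In this encoding, the class of the empty
   ball (radius -1) is setT. *)
Definition ball_class (n : nat) (x : T) : set T := [set y | ball_eqv n x y].

Definition ball_classes (n : nat) : set (set T) := range (ball_class n).

Definition sturmian : Prop := forall n, (ball_classes n #= `I_(n + 2))%card.

(* The class of the concentric n-ball of E, for E a class of balls of radius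
   at least n. *)
Definition central (n : nat) (E : set T) : set T :=
  \bigcup_(x in E) ball_class n x.

Definition extends (n : nat) (D E : set T) : Prop :=
  ball_classes n.+1 E /\ central n E = D.

Definition special (n : nat) (D : set T) : Prop :=
  ball_classes n D /\
  exists E F, [/\ E <> F, extends n D E & extends n D F].

(* The number of balls of class Y centered at the neighbors of the center of a
   ball of class X: the value taken by the count on the members of X, which is
   the same for all of them in all the uses below. *)
Definition nbr_index (X Y : set T) : nat :=
  xget 0 [set count (fun y => y \in Y) (nbr x) | x in X].

Definition always_adjacent (D E : set T) : Prop :=
  forall x, D x -> exists2 y, y \in nbr x & E y.

(* S n is the special class and A n, B n are named as prescribed.  The color
   called a is the one of the balls in S 0. *)
Definition sturmian_naming (S A B : nat -> set T) : Prop :=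
  [/\ forall n, special n (S n),
      [/\ A 0 = S 0, ball_classes 0 (B 0) & B 0 <> A 0]
    & forall n,
        [/\ [/\ extends n (S n) (A n.+1), extends n (S n) (B n.+1)
              & A n.+1 <> B n.+1],
            always_adjacent (A n.+1) (A n),
            always_adjacent (B n.+1) (B n)
          & nbr_index (B n.+1) (A n) < nbr_index (A n.+1) (A n)]].

Definition type_set (S : nat -> set T) (v : T) : set nat :=
  [set m | ball_class m v = S m].

Definition bounded_type (S : nat -> set T) : Prop :=
  forall v, finite_set (type_set S v).

Definition Gedge (n : nat) (D E : set T) : Prop :=
  exists x y, [/\ y \in nbr x, ball_class n x = D & ball_class n y = E].

(* The graph has no multiple edges, so that cycles other than loops have
   length at least 3. *)
Definition G_has_cycle (n : nat) : Prop :=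
  exists c : seq (set T),
    2 < size c /\ ucycle (fun D E => `[< Gedge n D E >]) c.

End Balls.

(* Only the values of eg_idx on eg_vert are meaningful; the index 0 stands for
   the absence of an oriented edge, and eg_idx x x is the index of the loop. *)
Record eigraph (U : Type) := EIGraph {
  eg_vert : set U;
  eg_idx : U -> U -> nat
}.

Definition eg_iso {U U' : Type} (G : eigraph U) (H : eigraph U') : Prop :=
  exists f : U -> U',
    set_bij (eg_vert G) (eg_vert H) f /\
    forall x y, eg_vert G x -> eg_vert G y ->
      eg_idx H (f x) (f y) = eg_idx G x y.

Definition eg_eventually_stable {U : Type} (G : nat -> eigraph U) : Prop :=
  exists N, forall m n, N <= m -> N <= n -> eg_iso (G m) (G n).

Section EdgeIndexed.
Context {U : Type}.

Definition eg_reachable (G : eigraph U) (v : U) : eigraph U :=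
  EIGraph [set w | exists p,
             [/\ forall i, i < size p -> eg_vert G (nth v p i),
                 path (fun x y => 0 < eg_idx G x y) v p & last v p = w]]
          (eg_idx G).

Definition eg_adj (G : eigraph U) (x y : U) : Prop :=
  0 < eg_idx G x y \/ 0 < eg_idx G y x.

Definition eg_end (G : eigraph U) (v : U) : Prop :=
  eg_vert G v /\
  forall u w, eg_vert G u -> eg_vert G w -> u <> v -> w <> v ->
    eg_adj G v u -> eg_adj G v w -> u = w.

(* m is the index of the non-loop edge leaving the end vertex v, and 0 if
   there is none. *)
Definition eg_end_index (G : eigraph U) (v : U) (m : nat) : Prop :=
  (0 < m /\ exists u, [/\ eg_vert G u, u <> v & eg_idx G v u = m]) \/
  (m = 0 /\ forall u, eg_vert G u -> u <> v -> eg_idx G v u = 0).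

End EdgeIndexed.

Section Concatenation.
Context {U1 U2 : eqType} (G1 : eigraph U1) (G2 : eigraph U2) (v1 : U1) (v2 : U2).

(* The vertex obtained by identifying v1 and v2 is inl v1. *)
Definition concat1 (m i : nat) : eigraph (U1 + U2) :=
  EIGraph
    (inl @` eg_vert G1 `|` inr @` [set y | eg_vert G2 y /\ y <> v2])
    (fun p q => match p, q with
     | inl x, inl y => if (x == v1) && (y != v1)
                       then (if 0 < eg_idx G1 x y then i else 0)
                       else eg_idx G1 x y
     | inl x, inr y => if (x == v1) && (0 < eg_idx G2 v2 y) then m - i else 0
     | inr x, inl y => if y == v1 then eg_idx G2 x v2 else 0
     | inr x, inr y => eg_idx G2 x y
     end).

Definition concat1_ok (m i : nat) : Prop :=
  [/\ eg_end G1 v1 /\ eg_end G2 v2,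
      eg_end_index G1 v1 m /\ eg_end_index G2 v2 m,
      eg_idx G1 v1 v1 = eg_idx G2 v2 v2
    & 1 <= i < m].

Definition concat2 (i j : nat) : eigraph (U1 + U2) :=
  EIGraph
    (inl @` eg_vert G1 `|` inr @` eg_vert G2)
    (fun p q => match p, q with
     | inl x, inl y => if (x == v1) && (y == v1) then eg_idx G1 x y - i
                       else eg_idx G1 x y
     | inl x, inr y => if (x == v1) && (y == v2) then i else 0
     | inr x, inl y => if (x == v2) && (y == v1) then j else 0
     | inr x, inr y => if (x == v2) && (y == v2) then eg_idx G2 x y - j
                       else eg_idx G2 x y
     end).

Definition concat2_ok (i j : nat) : Prop :=
  [/\ eg_end G1 v1, eg_end G2 v2,
      1 <= i <= eg_idx G1 v1 v1 & 1 <= j <= eg_idx G2 v2 v2].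

End Concatenation.

Section SturmianGraphs.
Context {d : nat} {T : regular_tree d} (phi : T -> bool).

(* i_A for E := A and i_B for E := B. *)
Definition ext_index (S E : nat -> set T) (n : nat) (X Y : set T) : nat :=
  nbr_index (if X == S n then E n.+1 else X) Y.

(* G^A_n for E := A and G^B_n for E := B. *)
Definition Gext (S E : nat -> set T) (n : nat) : eigraph (set T) :=
  eg_reachable (EIGraph (ball_classes phi n) (ext_index S E n)) (S n).

Definition Cclass (S : nat -> set T) (n : nat) : set T := central phi n (S n.+1).

(* f (n - 1), with the value x0 at the index -1. *)
Definition prev {X : Type} (x0 : X) (f : nat -> X) (n : nat) : X :=
  if n is m.+1 then f m else x0.

Definition Gempty : eigraph (set T) := EIGraph [set setT] (fun _ _ => d).

Definition Gprev (S E : nat -> set T) : nat -> eigraph (set T) :=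
  prev Gempty (Gext S E).
Definition Sprev (S : nat -> set T) : nat -> set T := prev setT S.
Definition Cprev (S : nat -> set T) : nat -> set T := prev setT (Cclass S).

(* H is isomorphic to some concatenation of G^A_(n-1) and G^B_(n-1) at
   (C_(n-1), C_(n-1)). *)
Definition iso_bowtie (S A B : nat -> set T) (n : nat)
    (H : eigraph (set T)) : Prop :=
  let G1 := Gprev S A n in
  let G2 := Gprev S B n in
  let c := Cprev S n in
  (c <> Sprev S n ->
     exists m i, concat1_ok G1 G2 c c m i /\ eg_iso H (concat1 G1 G2 c c m i)) /\
  (c = Sprev S n ->
     exists i j, concat2_ok G1 G2 c c i j /\ eg_iso H (concat2 G1 G2 c c i j)).

End SturmianGraphs.

(* Main.v *)
(* Passing from n-balls to (n+1)-balls splits the class S n into A n.+1 and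
   B n.+1 and changes no other class.  The next special class S n.+1 is adjacent
   to both halves; every other class adjacent to S n has constant indices, so it
   sees A n.+1 only, B n.+1 only, or both.  If there is no cycle, S n.+1 is the
   only class seeing both (or S n.+1 is one half, and the halves are adjacent),
   and following the split through the graphs gives (1): G^A_(n+1) is a copy of
   G^A_n unless S n.+1 = B n.+1 or A n.+2 is adjacent to B n.+1, and in these
   cases every class is reachable and the two copies of the previous graphs are
   joined at S n.+1.

   A class that is never special again gains a neighboring class each time S n
   passes next to it, hence this happens at most d times.  It follows that if one
   vertex has a finite type set, then all have.  In that case one of A n, B n is
   eventually never special again and the graph of the other letter is stable.
   If no type set is finite, the same count shows that every vertex sees at most
   two classes other than its own; S n then moves along a line, and if there were
   a cycle it would end up turning around it forever, never coming back to the
   vertices it has left.  So there is no cycle, and a stable G^A would avoid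
   B n.+1 from some point on, making the vertices of B n.+1 bounded. *)
Require Import Defs.
From mathcomp Require Import all_boot.
From mathcomp Require Import boolp classical_sets functions cardinality.

Set Implicit Arguments.
Unset Strict Implicit.
Unset Printing Implicit Defensive.

(** * Balls and their classes *)

Section Classes.
Local Open Scope classical_set_scope.
Context {d : nat} {T : regular_tree d} (phi : T -> bool).
Implicit Types (x y z : T) (n : nat).

(** The names [A] and [B] are not symmetric, but apart from [S 0 = A 0] only symmetric consequences
    of them are used; so most statements concern a neutral pair [Z], [Z'] and are then applied in
    both orders. All adjacency arguments rest on one fact: an (n+1)-class determines how many
    neighbors of its centers lie in each n-class. A class that is not special is also an
    (n+1)-class, so what one member sees, all members see; only the two halves of [S n] may differ.
    The count behind finiteness is the number of classes met by a vertex and its neighbors: it is at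
    most d + 1, never decreases with the radius, and grows when the vertex meets both halves of a
    special class. Connectivity after removal of [S n] is expressed by sets of vertices of the tree,
    since these keep their meaning when the radius changes. In (1), K is the least radius at which
    every class is reachable in the graph of [A]; before it this graph is a single vertex, and
    beyond it both graphs have a non-loop edge, which prevents both from being concatenations at the
    same radius. *)

Lemma ball_center n x : ball n x x.
Proof. by exists [::]. Qed.

Lemma ball_nbr n x y z : y \in nbr x -> ball n y z -> ball n.+1 x z.
Proof. by move=> xy [p [yp <- np]]; exists (y :: p); rewrite /= xy. Qed.

Lemma ballS n x z : ball n x z -> ball n.+1 x z.
Proof. by move=> [p [xp <- np]]; exists p; split=> //; apply: leqW. Qed.

Lemma ball_iso_inv n x y f : ball_iso phi n x y f ->
  exists g, ball_iso phi n y x g /\ forall u, ball n x u -> g (f u) = u.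
Proof.
move=> [[fB fI fS] fx fA fP].
have gex w : exists v, ball n y w -> ball n x v /\ f v = w.
  have [yw|nyw] := pselect (ball n y w); last by exists x.
  by have [v xv <-] := fS _ yw; exists v.
have [g gP] := choice gex.
have gf u : ball n x u -> g (f u) = u.
  move=> xu; have [xg e] := gP _ (fB _ xu).
  by apply: fI => //; rewrite inE.
exists g; split=> //; split.
- split=> [w /gP []//|u v|u xu].
    by rewrite !inE => /gP [_ {2}<-] /gP [_ {2}<-] ->.
  by exists (f u); [apply: fB | apply: gf].
- by rewrite -fx gf //; apply: ball_center.
- by move=> u v /gP [xu {2}<-] /gP [xv {2}<-]; rewrite fA.
- by move=> u /gP [xu {2}<-]; rewrite fP.
Qed.

(** [f] preserves adjacency only inside the large ball, so a path is mapped edge by edge through its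
    prefixes, all of which end in the small ball. *)
Lemma ball_iso_sub_maps n m x y z f : ball_iso phi m x y f ->
    ball n z `<=` ball m x -> ball n z `<=` f @^-1` ball n (f z).
Proof.
move=> [_ _ fA _] zx u [p [zp <- np]].
exists (map f p); split; rewrite ?last_map ?size_map //.
have: forall q, size q <= size p -> q = take (size q) p ->
    path (grel (@nbr d T)) (f z) (map f q).
  elim/last_ind=> [//|q w IH] qp eq; rewrite map_rcons rcons_path.
  have qp' : size q <= size p by apply: leq_trans qp; rewrite size_rcons.
  have eq' : q = take (size q) p.
    move: eq; rewrite size_rcons (take_nth z); last by move: qp; rewrite size_rcons.
    by move/rcons_inj => [].
  rewrite IH //= last_map fA; last 2 first.
  - apply: zx; exists q; split=> //; last exact: leq_trans np.
    by move: zp; rewrite -(cat_take_drop (size q) p) -eq' cat_path => /andP [].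
  - apply: zx; exists (rcons q w); split; rewrite ?last_rcons //;
      last exact: leq_trans np.
    move: zp; rewrite -(cat_take_drop (size (rcons q w)) p) -eq cat_path.
    by move=> /andP [].
  move: zp; rewrite -(cat_take_drop (size (rcons q w)) p) -eq cat_path.
  by rewrite rcons_path => /andP [] /andP [].
by apply=> //; rewrite take_size.
Qed.

Lemma ball_iso_sub n m x y z f : ball_iso phi m x y f ->
    ball n z `<=` ball m x -> ball n (f z) `<=` ball m y ->
  ball_iso phi n z (f z) f.
Proof.
move=> fiso zx zy; have [g [giso gf]] := ball_iso_inv fiso.
have zb : ball m x z by apply/zx/ball_center.
have fz := ball_iso_sub_maps fiso zx.
have gz := ball_iso_sub_maps giso zy.
have [[fB fI fS] fx fA fP] := fiso.
split=> //.
- split=> // [u v|w zw].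
    rewrite !inE => /zx uz /zx vz; apply: fI; rewrite inE //.
  exists (g w); first by have := gz _ zw; rewrite /preimage /= gf.
  by have [v xv <-] := fS _ (zy _ zw); rewrite gf.
- by move=> u v /zx xu /zx xv; apply: fA.
- by move=> u /zx xu; apply: fP.
Qed.

Lemma ball_eqv_refl n x : ball_eqv phi n x x.
Proof. by exists id; split=> //; split=> // u; exists u. Qed.

Lemma ball_eqv_sym n x y : ball_eqv phi n x y -> ball_eqv phi n y x.
Proof. by move=> [f /ball_iso_inv [g [giso _]]]; exists g. Qed.

Lemma ball_eqv_trans n y x z :
  ball_eqv phi n x y -> ball_eqv phi n y z -> ball_eqv phi n x z.
Proof.
move=> [f [fbij fx fA fP]] [g [gbij gy gA gP]]; exists (g \o f).
have fB := set_bij_sub fbij.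
split; first exact: set_bij_comp gbij.
- by rewrite /= fx.
- by move=> u v xu xv /=; rewrite gA ?fA//; apply: fB; exists u + exists v.
- by move=> u xu /=; rewrite gP ?fP//; apply: fB; exists u.
Qed.

Lemma ball_eqvS n x y : ball_eqv phi n.+1 x y -> ball_eqv phi n x y.
Proof.
move=> [f fiso]; have [_ fx _ _] := fiso; exists f.
rewrite -[in ball_iso _ _ _ y]fx; apply: ball_iso_sub fiso _ _ => u.
  exact: ballS.
by rewrite fx; apply: ballS.
Qed.

Local Notation cls := (ball_class phi).
Local Notation P := (ball_classes phi).

Lemma cls_eq n x y : cls n x y -> cls n x = cls n y.
Proof.
move=> xy; apply/seteqP; split=> z; rewrite /ball_class /=.
  exact/ball_eqv_trans/ball_eqv_sym.
exact: ball_eqv_trans.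
Qed.

Lemma cls_id n x : cls n x x.
Proof. exact: ball_eqv_refl. Qed.

Lemma P_cls n x : P n (cls n x).
Proof. by exists x. Qed.

Lemma P_of n X x : P n X -> X x -> X = cls n x.
Proof. by move=> [y _ <-] /cls_eq. Qed.

Lemma P_eq n X Y x : P n X -> P n Y -> X x -> Y x -> X = Y.
Proof. by move=> PX PY Xx Yx; rewrite (P_of PX Xx) (P_of PY Yx). Qed.

Lemma P_inh n X : P n X -> exists x, X x.
Proof. by move=> [x _ <-]; exists x; apply: cls_id. Qed.

Definition cnt (E : set T) x := count (fun y => y \in E) (nbr x).

Definition near x (E : set T) := exists2 y, y \in nbr x & E y.

Definition adj (D E : set T) := exists2 x, D x & near x E.

Lemma near_cnt x E : near x E <-> 0 < cnt E x.
Proof.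
rewrite /cnt -has_count; split=> [[y xy Ey]|/hasP [y xy]].
  by apply/hasP; exists y => //; rewrite inE.
by rewrite inE; exists y.
Qed.

Lemma adj_sym D E : adj D E -> adj E D.
Proof. by move=> [x Dx [y xy Ey]]; exists y => //; exists x; rewrite // nbr_sym. Qed.

Lemma cnt0 E x : ~ near x E -> cnt E x = 0.
Proof. by move=> nE; apply/eqP; rewrite -leqn0 leqNgt; apply/negP => /near_cnt. Qed.

Lemma cntU (E F G : set T) x :
    (forall y, E y <-> F y \/ G y) -> (forall y, F y -> ~ G y) ->
  cnt E x = cnt F x + cnt G x.
Proof.
move=> EFG FG; rewrite /cnt -count_predUI -[LHS]addn0; congr addn.
  apply: eq_count => y /=; apply/idP/orP =>
    [/set_mem/EFG [Fy|Gy]|[/set_mem Fy|/set_mem Gy]].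
  - by left; apply: mem_set.
  - by right; apply: mem_set.
  - by apply/mem_set/EFG; left.
  - by apply/mem_set/EFG; right.
apply/esym/eqP; rewrite -leqn0 leqNgt -has_count; apply/hasPn => y _ /=.
by apply/negP => /andP []; rewrite !inE => /FG.
Qed.

(** An isomorphism of (n+1)-balls maps the neighbors of one center onto those of the other and
    restricts to isomorphisms of the n-balls around them. *)
Lemma cnt_const n D E x y : P n.+1 D -> P n E -> D x -> D y -> cnt E x = cnt E y.
Proof.
move=> PD [z _ <-] Dx Dy; rewrite (P_of PD Dx) in Dy.
case: Dy => f fiso; have [[fB fI _] fx fA _] := fiso.
have xb u : u \in nbr x -> ball n.+1 x u.
  by move=> xu; apply: ball_nbr xu (ball_center _ _).
have fy u : u \in nbr x -> f u \in nbr y.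
  by move=> xu; rewrite -fx fA//; [apply: ball_center | apply: xb].
have xyperm : perm_eq (map f (nbr x)) (nbr y).
  have funiq : uniq (map f (nbr x)).
    rewrite map_inj_in_uniq ?nbr_uniq // => u v xu xv; apply: fI; rewrite inE; exact: xb.
  apply: uniq_perm => //; first exact: nbr_uniq.
  have fsub : {subset map f (nbr x) <= nbr y} by move=> w /mapP [u xu ->]; apply: fy.
  by have [] := uniq_min_size funiq fsub; rewrite ?size_map ?nbr_size.
rewrite /cnt -(permP xyperm) count_map; apply: eq_in_count => u xu /=.
have uf : ball_eqv phi n u (f u).
  exists f; apply: ball_iso_sub fiso _ _ => v; first exact: ball_nbr.
  by apply: ball_nbr; apply: fy.
rewrite /in_mem /mem /= /in_set; apply: asbool_equiv_eq; rewrite /ball_class /=.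
split=> [zu|zu]; first exact: ball_eqv_trans zu uf.
exact: ball_eqv_trans zu (ball_eqv_sym uf).
Qed.

Lemma nbr_ind (W : set T) x0 : W x0 ->
  (forall x y, W x -> y \in nbr x -> W y) -> forall y, W y.
Proof.
move=> Wx Wn y; have [p] := tree_connected x0 y.
elim: p x0 Wx => [|z p IH] x Wx /=; first by move=> _ <-.
by move=> /andP [xz zp]; apply: IH zp; apply: Wn xz.
Qed.

End Classes.

(** * Splitting of the special class *)

Lemma uniq_map_inj (U V : eqType) (f : U -> V) (s : seq U) :
  uniq (map f s) -> {in s &, injective f}.
Proof.
elim: s => //= a s IH /andP [fa fs] x y; rewrite !inE.
case/orP=> [/eqP->|xs] /orP [/eqP->|ys] //.
- by move=> e; case/negP: fa; rewrite e map_f.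
- by move=> e; case/negP: fa; rewrite -e map_f.
- exact: IH.
Qed.

Section Naming.
Local Open Scope classical_set_scope.
Context {d : nat} {T : regular_tree d} (phi : T -> bool).
Implicit Types (x y z : T) (n : nat).
Local Notation cls := (ball_class phi).
Local Notation P := (ball_classes phi).

(* The conditions on (S, A, B) that are invariant under the exchange of A and
   B.  As a class is the set of its centers, a class and its unique extension
   are the same set, so that passing from radius n to n + 1 only replaces S n
   by the two sets Z n.+1 and Z' n.+1. *)
Record named (S Z Z' : nat -> set T) : Prop := Named {
  named_S : forall n, P n (S n);
  named_Z : forall n, P n (Z n);
  named_Z' : forall n, P n (Z' n);
  named_sub : forall n x, Z n.+1 x -> S n x;
  named_sub' : forall n x, Z' n.+1 x -> S n x;
  named_split : forall n x, S n x -> Z n.+1 x \/ Z' n.+1 x;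
  named_disj : forall n x, Z n.+1 x -> ~ Z' n.+1 x;
  named_0 : forall x, Z 0 x \/ Z' 0 x;
  named_S0 : S 0 = Z 0 \/ S 0 = Z' 0;
  named_disj0 : forall x, Z 0 x -> ~ Z' 0 x;
  named_nonspecial : forall n x, ~ S n x -> cls n x = cls n.+1 x;
  named_lt : forall n x y, Z n.+1 x -> Z' n.+1 y -> cnt (Z n) y < cnt (Z n) x;
  named_lt' : forall n x y, Z n.+1 x -> Z' n.+1 y -> cnt (Z' n) x < cnt (Z' n) y
}.

Lemma named_swap S Z Z' : named S Z Z' -> named S Z' Z.
Proof.
case=> *; split=> //; try by firstorder.
Qed.

Lemma classes_seq n : sturmian phi ->
  exists s, [/\ uniq s, size s = n + 2 & forall X, X \in s <-> P n X].
Proof.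
move=> /(_ n) /card_esym /card_set_bijP [f [fB fI fS]].
exists (map f (iota 0 (n + 2))); split.
- rewrite map_inj_in_uniq ?iota_uniq // => i j; rewrite !mem_iota /= => ni nj.
  by apply: fI; rewrite inE.
- by rewrite size_map size_iota.
- move=> X; split=> [/mapP [i]|/fS [i ni <-]].
    by rewrite mem_iota /= => ni ->; apply: fB.
  by apply: map_f; rewrite mem_iota.
Qed.

Lemma central_cls n x : central phi n (cls n.+1 x) = cls n x.
Proof.
apply/seteqP; split=> y; last by exists x => //; apply: cls_id.
by move=> [z /ball_eqvS /cls_eq <-].
Qed.

Lemma extends_sub n D E x : extends phi n D E -> E x -> D x.
Proof. by move=> [_ <-] Ex; exists x => //; apply: cls_id. Qed.

Section Sturmian.
Context (S A B : nat -> set T).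
Hypotheses (Hphi : sturmian phi) (HN : sturmian_naming phi S A B).

(** There are n + 3 classes of (n+1)-balls and n + 2 of n-balls. Without [A n.+1] the former still
    restrict onto the latter, because [B n.+1] restricts to [S n] as well; the sizes being equal,
    the restriction is injective. *)
Lemma special_split n x y : cls n x = cls n y ->
  cls n.+1 x <> A n.+1 -> cls n.+1 y <> A n.+1 -> cls n.+1 x = cls n.+1 y.
Proof.
case: HN => _ _ /(_ n) [[[PA cA] [PB cB] AB] _ _ _] xy xA yA.
have [s [su ss sP]] := classes_seq n.+1 Hphi.
have [t [tu ts tP]] := classes_seq n Hphi.
set l := rem (A n.+1) s.
have lP X : X \in l <-> P n.+1 X /\ X <> A n.+1.
  by rewrite mem_rem_uniq // !inE -sP; split=> [/andP [/eqP ? ?]|[? /eqP ->]].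
have tl : {subset t <= map (central phi n) l}.
  move=> X /tP [z _ <-]; rewrite -central_cls.
  have [zA|zA] := pselect (cls n.+1 z = A n.+1).
    rewrite zA cA -cB map_f//; apply/lP; split=> // /esym; exact: AB.
  by apply/map_f/lP; split=> //; apply: P_cls.
have lu : uniq (map (central phi n) l).
  apply: (leq_size_uniq tu tl); rewrite size_map size_rem ?ts ?ss//.
  exact/sP.
apply: (uniq_map_inj lu); rewrite ?central_cls//.
- by apply/lP; split=> //; apply: P_cls.
- by apply/lP; split=> //; apply: P_cls.
Qed.

Lemma sturmian_named : named S A B.
Proof.
have [sS [A0 PB0 BA0] sN] := HN.
have PA n : P n (A n) by case: n => [|n]; [rewrite A0;
  case: (sS 0) | case: (sN n) => [[[]]]].
have PB n : P n (B n) by case: n => [//|n]; case: (sN n) => [[_ []]].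
have AS n x : A n.+1 x -> S n x by case: (sN n) => [[/extends_sub sub _ _] _ _ _];
  apply: sub.
have BS n x : B n.+1 x -> S n x by case: (sN n) => [[_ /extends_sub sub _] _ _ _];
  apply: sub.
have PS n : P n (S n) by case: (sS n).
have ABd n x : A n.+1 x -> ~ B n.+1 x.
  by case: (sN n) => [[_ _ AB] _ _ _] Ax Bx; apply: AB; apply: P_eq Ax Bx.
have nonsp n x : ~ S n x -> cls n x = cls n.+1 x.
  move=> nSx; apply/seteqP; split=> y; last exact: ball_eqvS.
  move=> /cls_eq xy; rewrite (special_split xy); first exact: cls_id.
    by move=> e; apply: nSx; apply: AS; rewrite -e; apply: cls_id.
  move=> e; apply: nSx; rewrite (P_of (PS n) (AS _ y _)) -?xy; first exact: cls_id.
  by rewrite -e; apply: cls_id.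
have split_ n x : S n x -> A n.+1 x \/ B n.+1 x.
  move=> Sx; have [xA|xA] := pselect (cls n.+1 x = A n.+1); first by left; rewrite -xA;
    apply: cls_id.
  have [b Bb] := P_inh (PB n.+1); right.
  have xb : cls n x = cls n b by rewrite -(P_of (PS n) Sx) -(P_of (PS n) (BS _ _ Bb)).
  rewrite (P_of (PB n.+1) Bb) -(special_split xb) //; first exact: cls_id.
  by move=> e; apply: (ABd n b) => //; rewrite -e; apply: cls_id.
have AB0 x : A 0 x \/ B 0 x.
  have [s [su ss sP]] := classes_seq 0 Hphi.
  have us : uniq [:: A 0; B 0] by rewrite /= andbT inE; apply/eqP => /esym.
  have sub : {subset [:: A 0; B 0] <= s} by move=> X; rewrite !inE => /orP [] /eqP ->;
    apply/sP.
  have [_ es] := uniq_min_size us sub (eq_leq ss).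
  have : cls 0 x \in s by apply/sP; apply: P_cls.
  by rewrite -es !inE => /orP [] /eqP <-; [left|right]; apply: cls_id.
have lt n x y : A n.+1 x -> B n.+1 y -> cnt (A n) y < cnt (A n) x.
  case: (sN n) => _ _ _; rewrite /nbr_index => lt Ax By.
  suff e X E z : P n.+1 X -> P n E -> X z ->
    xget 0 [set count (fun y => y \in E) (nbr x) | x in X] = cnt E z.
    by rewrite (e _ _ _ _ _ By) // (e _ _ _ _ _ Ax) in lt.
  move=> PX PE Xz; apply: xget_subset1; first by exists z.
  by move=> _ _ [u Xu <-] [v Xv <-]; apply: cnt_const PX PE Xu Xv.
have cntT (U V : set T) x : (forall y, U y -> ~ V y) ->
  cnt (U `|` V) x = cnt U x + cnt V x.
  by apply: cntU.
(* The counts of [A n] and [B n] have the same sum on both halves of [S n]: it is d for n = 0, and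
   otherwise the count of their union [S (n - 1)], which is constant on the n-class [S n]. *)
have lt' n x y : A n.+1 x -> B n.+1 y -> cnt (B n) x < cnt (B n) y.
  move=> Ax By; have := lt _ _ _ Ax By.
  suff : cnt (A n) x + cnt (B n) x = cnt (A n) y + cnt (B n) y.
    by move=> e1 e2; rewrite -(ltn_add2l (cnt (A n) y)) -e1 ltn_add2r.
  case: n Ax By => [|n] Ax By.
    rewrite -!cntT; last 2 first.
    - by move=> z Az Bz; apply: BA0; apply: P_eq Bz Az.
    - by move=> z Az Bz; apply: BA0; apply: P_eq Bz Az.
    have -> : A 0 `|` B 0 = setT by apply/seteqP; split=> // z _; apply: AB0.
    by rewrite /cnt !(eq_count (a2 := predT)) ?count_predT ?nbr_size // => z;
      rewrite in_setT.
  rewrite -!cntT; [|exact: ABd..].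
  have -> : A n.+1 `|` B n.+1 = S n.
    by apply/seteqP; split=> [z [/AS|/BS]|z /split_].
  by apply: (cnt_const (PS n.+1)) (PS n) _ _; [apply: AS Ax | apply: BS By].
split=> //; first by left.
by move=> x Ax Bx; apply: BA0; apply: P_eq Bx Ax.
Qed.

End Sturmian.
End Naming.

(** * Valences and bounded vertices *)

Section Named.
Local Open Scope classical_set_scope.
Context {d : nat} {T : regular_tree d} (phi : T -> bool).
Implicit Types (x y z : T) (n k m : nat) (D E F X Y : set T).
Local Notation cls := (ball_class phi).
Local Notation P := (ball_classes phi).
Context {S Z Z' : nat -> set T} (HN : named phi S Z Z').

Let PS := named_S HN.
Let PZ := named_Z HN.
Let PZ' := named_Z' HN.

Lemma cls_le n m x y : n <= m -> cls m x y -> cls n x y.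
Proof.
by move/subnK <-; elim: (m - n) => // k IH; rewrite addSn => /ball_eqvS /IH.
Qed.

(** [Z n.+1] is a nonempty proper part of the n-class [S n]. This is the usual way to tell old
    classes from new ones. *)
Lemma P_neqZ n X : P n X -> X <> Z n.+1.
Proof.
move=> PX e; have [z Zz] := P_inh (PZ n.+1); have [z' Zz'] := P_inh (PZ' n.+1).
have XS : X = S n by apply: (P_eq PX (PS n) (x := z)); rewrite ?e //;
  exact: (named_sub HN Zz).
by apply: (named_disj HN) (Zz'); rewrite -e XS; exact: (named_sub' HN Zz').
Qed.

Lemma P_up n X : P n X -> X <> S n -> P n.+1 X.
Proof.
move=> PX XS; have [x Xx] := P_inh PX; exists x => //.
by rewrite -(named_nonspecial HN) -?(P_of PX Xx) // => Sx; apply: XS;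
  apply: (P_eq PX (PS n) Xx Sx).
Qed.

Lemma P_succ n X : P n.+1 X ->
  [\/ P n X /\ X <> S n, X = Z n.+1 | X = Z' n.+1].
Proof.
move=> PX; have [x Xx] := P_inh PX.
have [Sx|Sx] := pselect (S n x).
  by have [h|h] := named_split HN Sx; [apply: Or32;
    exact: (P_eq PX (PZ _) Xx h) | apply: Or33; exact: (P_eq PX (PZ' _) Xx h)].
apply: Or31; rewrite (P_of PX Xx) -(named_nonspecial HN Sx); split; first exact: P_cls.
by move=> e; apply: Sx; rewrite -e; apply: cls_id.
Qed.

Lemma Z_neq n : Z n <> Z' n.
Proof.
move=> e; have [z Zz] := P_inh (PZ n); have Zz' := Zz; rewrite e in Zz'.
by case: n {e} Zz Zz' => [|n] Zz Zz';
  [exact: (named_disj0 HN Zz Zz') | exact: (named_disj HN Zz Zz')].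
Qed.

Lemma near_const n D E x y :
  P n.+1 D -> P n E -> D x -> D y -> near x E -> near y E.
Proof. by move=> PD PE Dx Dy /near_cnt xE; apply/near_cnt;
  rewrite -(cnt_const PD PE Dx Dy). Qed.

(** A class that is not special is also an (n+1)-class. *)
Lemma near_ns n D E y : P n D -> D <> S n -> P n E -> adj D E -> D y -> near y E.
Proof. by move=> PD DS PE [x Dx xE] Dy; apply: near_const (P_up PD DS) PE Dx Dy xE. Qed.

(** Apart from [Z n] and [Z' n], every n-class is already an (n-1)-class, so that [cnt_const]
    applies to [S n] itself. At radius 0 there is no such [E]. *)
Lemma near_S n E y : P n E -> E <> Z n -> E <> Z' n -> adj (S n) E -> S n y -> near y E.
Proof.
case: n => [|n] PE EZ EZ' [x Sx xE] Sy.
  have [e Ee] := P_inh PE.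
  by have [h|h] := named_0 HN e; [case: EZ | case: EZ'];
    [exact: (P_eq PE (PZ _) Ee h) | exact: (P_eq PE (PZ' _) Ee h)].
have [[PE' _]|//|//] := P_succ PE.
exact: near_const (PS n.+1) PE' Sx Sy xE.
Qed.

Lemma near_Z n x : Z n.+1 x -> near x (Z n).
Proof.
move=> Zx; have [z' Zz'] := P_inh (PZ' n.+1); apply/near_cnt.
exact: leq_ltn_trans (named_lt HN Zx Zz').
Qed.

Lemma near_Z' n x : Z' n.+1 x -> near x (Z' n).
Proof.
move=> Zx; have [z' Zz'] := P_inh (PZ n.+1); apply/near_cnt.
exact: leq_ltn_trans (named_lt' HN Zz' Zx).
Qed.

Lemma nbr_near n x y : y \in nbr x -> near x (cls n y).
Proof. by exists y => //; apply: cls_id. Qed.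

Lemma near_sub x D E : D `<=` E -> near x D -> near x E.
Proof. by move=> DE [y xy Dy]; exists y => //; apply: DE. Qed.

Lemma adj_sub C D E : C `<=` D -> adj C E -> adj D E.
Proof. by move=> CD [x Cx xE]; exists x => //; apply: CD. Qed.

Lemma near_split n x : near x (S n) -> near x (Z n.+1) \/ near x (Z' n.+1).
Proof.
by move=> [y xy /(named_split HN) [Zy|Zy]]; [left|right]; exists y.
Qed.

Lemma adj_split n E : adj E (S n) -> adj E (Z n.+1) \/ adj E (Z' n.+1).
Proof. by move=> [x Ex /near_split [h|h]]; [left|right]; exists x. Qed.

Definition valence n x := size (undup (map (cls n) (x :: nbr x))).

Definition hit x D := D x \/ near x D.

Lemma hit_mem n x D : P n D -> hit x D -> D \in map (cls n) (x :: nbr x).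
Proof.
move=> PD [Dx|[y xy Dy]]; first by rewrite (P_of PD Dx) mem_head.
by rewrite (P_of PD Dy) /= inE map_f ?orbT.
Qed.

Lemma valence_ge n x (s : seq (set T)) : uniq s ->
  (forall D, D \in s -> P n D /\ hit x D) -> size s <= valence n x.
Proof.
move=> su sP; apply: uniq_leq_size => // D /sP [PD xD].
by rewrite mem_undup; apply: hit_mem.
Qed.

Lemma valence_ge4 n x D1 D2 D3 D4 :
  P n D1 -> P n D2 -> P n D3 -> P n D4 -> hit x D1 -> hit x D2 -> hit x D3 -> hit x D4 ->
  D1 <> D2 -> D1 <> D3 -> D1 <> D4 -> D2 <> D3 -> D2 <> D4 -> D3 <> D4 -> 3 < valence n x.
Proof.
move=> P1 P2 P3 P4 h1 h2 h3 h4 n12 n13 n14 n23 n24 n34.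
apply: (@valence_ge n x [:: D1; D2; D3; D4]).
  rewrite !cons_uniq !in_cons !negb_or.
  by do ![apply/andP; split]; rewrite ?in_nil //; case: pselect.
by move=> D; rewrite !in_cons in_nil orbF => /or4P [] /eqP ->.
Qed.

Lemma valence_leq n x (s : seq (set T)) :
  (forall y, y \in x :: nbr x -> cls n y \in s) -> valence n x <= size s.
Proof.
move=> xs; apply: uniq_leq_size; first exact: undup_uniq.
by move=> D; rewrite mem_undup => /mapP [y /xs ys ->].
Qed.

Lemma valence_max n x : valence n x <= d.+1.
Proof. by rewrite -(nbr_size x) -(size_map (cls n)) /= size_undup. Qed.

Lemma map_central n x :
  map (cls n) (x :: nbr x) = map (central phi n) (map (cls n.+1) (x :: nbr x)).
Proof. by rewrite -map_comp; apply: eq_map => y /=; rewrite central_cls. Qed.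

Lemma undup_central n x :
  {subset undup (map (cls n) (x :: nbr x)) <=
          map (central phi n) (undup (map (cls n.+1) (x :: nbr x)))}.
Proof.
move=> D; rewrite mem_undup map_central => /mapP [E Ex ->].
by apply: map_f; rewrite mem_undup.
Qed.

Lemma valenceS n x : valence n x <= valence n.+1 x.
Proof.
rewrite /valence -[X in _ <= X](size_map (central phi n)).
by apply: uniq_leq_size; [apply: undup_uniq | apply: undup_central].
Qed.

Lemma valence_mono x : {homo valence^~ x : n m / n <= m}.
Proof. by apply: homo_leq => [//|n m k|n]; [apply: leq_trans | apply: valenceS]. Qed.

(** Restriction to n-balls maps the (n+1)-classes around [x] onto the n-classes around [x] and
    merges the two halves. *)
Lemma valence_jump n x : hit x (Z n.+1) -> hit x (Z' n.+1) ->
  valence n x < valence n.+1 x.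
Proof.
move=> xZ xZ'; rewrite ltn_neqAle valenceS andbT; apply/eqP => e.
have /uniq_map_inj inj : uniq (map (central phi n) (undup (map (cls n.+1) (x :: nbr x)))).
  apply: leq_size_uniq (undup_uniq _) (@undup_central n x) _.
  by rewrite size_map -/(valence n.+1 x) -/(valence n x) e.
apply: (@Z_neq n.+1); apply: inj; rewrite ?mem_undup; try exact: hit_mem.
have [z Zz] := P_inh (PZ n.+1); have [z' Zz'] := P_inh (PZ' n.+1).
rewrite (P_of (PZ _) Zz) (P_of (PZ' _) Zz') !central_cls.
by rewrite -(P_of (PS n)) -?(P_of (PS n)) //;
  [apply: (named_sub' HN) Zz' | exact: (named_sub HN Zz)].
Qed.

Lemma bounded_stable (f : nat -> nat) b : {homo f : n m / n <= m} ->
  (forall n, f n <= b) ->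
  exists n0, forall n, n0 <= n -> f n = f n0.
Proof.
move=> fm fb; apply: contrapT => h.
suff : forall j, exists n, j <= f n by move/(_ b.+1) => [n]; rewrite ltnNge fb.
elim=> [|j [n jn]]; first by exists 0.
apply: contrapT => hj; apply: h; exists n => m nm.
apply/eqP; rewrite eqn_leq (fm _ _ nm) andbT leqNgt; apply/negP => lt.
by apply: hj; exists m; apply: leq_ltn_trans lt.
Qed.

Lemma valence_stable x : exists n0, forall n m, n0 <= n -> n <= m ->
  valence m x = valence n x.
Proof.
have [n0 h] := bounded_stable (@valence_mono x) (valence_max ^~ x).
by exists n0 => n m n0n nm; rewrite !h // (leq_trans n0n nm).
Qed.

Lemma P_list n : exists s : seq (set T), forall X, P n X -> X \in s.
Proof.
elim: n => [|n [s sP]].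
  exists [:: Z 0; Z' 0] => X PX; have [x Xx] := P_inh PX; rewrite !inE.
  by have [h|h] := named_0 HN x; rewrite (P_eq PX _ Xx h) ?eqxx ?orbT.
exists [:: Z n.+1, Z' n.+1 & s] => X /P_succ [[/sP Xs _]|->|->];
  rewrite !inE ?eqxx ?orbT //.
by rewrite Xs !orbT.
Qed.

Lemma seq_bound (V : eqType) (s : seq V) (Q : V -> nat -> Prop) :
  (forall v, v \in s -> exists m, forall k, m <= k -> Q v k) ->
  exists m, forall v k, v \in s -> m <= k -> Q v k.
Proof.
elim: s => [|v s IH] h; first by exists 0.
have [m mQ] := IH (fun u us => h u (mem_behead (s := v :: s) us)).
have [m' mQ'] := h v (mem_head v s); exists (maxn m m') => u k; rewrite inE geq_max.
by case/orP=> [/eqP->|us] /andP [mk mk']; [apply: mQ' | apply: mQ].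
Qed.

Lemma P_final n m F : P n F -> (forall k, n <= k -> S k <> F) -> n <= m -> P m F.
Proof.
move=> PF FS /subnK <-; elim: (m - n) => // k IH; rewrite addSn; apply: P_up IH _.
by move/esym; apply: FS; apply: leq_addl.
Qed.

(* Every special ball adjacent to a final class adds one to the number of
   classes around the latter. *)
Lemma final_far n F : P n F -> (forall k, n <= k -> S k <> F) ->
  exists k0, forall k, k0 <= k -> ~ adj (S k) F.
Proof.
move=> PF FS; have [x Fx] := P_inh PF; have [n0 h] := valence_stable x.
exists (maxn n0 n.+1) => k; rewrite geq_max => /andP [n0k nk] SF.
case: k nk n0k SF => [//|k] nk n0k SF.
have PFk m : n <= m -> P m F by apply: P_final.
have FZ : F <> Z k.+1 by apply/P_neqZ/PFk.
have FZ' : F <> Z' k.+1.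
  move=> e; have Sx : S k x by apply: (named_sub' HN); rewrite -e.
  by apply: (FS k) => //; apply: P_eq Sx Fx => //; apply: PFk.
have nF y : S k.+1 y -> near y F by apply: (near_S (PFk _ (ltnW nk))) => //; apply: PFk.
(* Both halves of [S k.+1] see [F]; as [F] is still not special, each of its members sees both
   halves in return. *)
have nx E : P k.+2 E -> E `<=` S k.+1 -> near x E.
  move=> PE ES; have [y Ey] := P_inh PE.
  have nk2 : n <= k.+2 by apply/leqW/ltnW.
  apply: (near_ns (PFk _ nk2) _ PE _ Fx); first by move/esym; apply: FS.
  by apply: adj_sym; exists y => //; apply/nF/ES.
suff : valence k.+1 x < valence k.+2 x by rewrite (h k.+1 k.+2) // ltnn.
apply: valence_jump; right; apply: nx => // y;
  [exact: (named_sub HN)|exact: (named_sub' HN)].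
Qed.

(** The bound is uniform over [D], which is more than finiteness of the type set of each vertex of
    [D]. *)
Definition bdd D := exists m, forall k v, m <= k -> D v -> ~ S k v.

Lemma bdd_sub D E : D `<=` E -> bdd E -> bdd D.
Proof. by move=> DE [m h]; exists m => k v mk /DE; apply: h. Qed.

Lemma bdd_union C D E : (forall x, C x -> D x \/ E x) -> bdd D -> bdd E -> bdd C.
Proof.
move=> CDE [m h] [m' h']; exists (maxn m m') => k v; rewrite geq_max => /andP [mk mk'].
by move=> /CDE []; [apply: h | apply: h'].
Qed.

(** At a radius beyond which no vertex of [D] is special, [D] consists of finitely many classes; by
    [final_far] the special class is eventually adjacent to none of them. *)
Lemma bdd_near n D D' : P n D -> bdd D -> (forall x, D' x -> near x D) -> bdd D'.
Proof.
move=> PD [m Dm] D'D; set m' := maxn m n; have [s sP] := P_list m'.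
have [|k0 k0P] := @seq_bound _ [seq F <- s | `[< P m' F /\ F `<=` D >]] (fun F k =>
  ~ adj (S k) F).
  move=> F; rewrite mem_filter => /andP [/asboolP [PF FD] _];
    apply: (final_far PF) => k m'k e.
  have [x Fx] := P_inh PF; apply: (Dm k x); rewrite ?e //; last exact: FD.
  exact: leq_trans (leq_maxl _ _) m'k.
exists k0 => k v k0k D'v Sv; have [y vy Dy] := D'D v D'v.
apply: (k0P (cls m' y) k) => //; last by exists v => //; apply: nbr_near.
rewrite mem_filter sP ?andbT; last exact: P_cls.
apply/asboolP; split; first exact: P_cls.
rewrite (P_of PD Dy) => u; apply: cls_le; exact: leq_maxr.
Qed.

(** From [m] on the class of [v] is never special, hence it remains the same set. *)
Lemma bdd_point v : (exists m, forall k, m <= k -> ~ S k v) ->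
  exists m, forall k, m <= k -> P k (cls m v) /\ bdd (cls m v).
Proof.
move=> [m h]; exists m => k mk.
have FS j : m <= j -> P j (cls m v) /\ S j <> cls m v.
  move=> mj; split; last by move=> e; apply: (h j mj); rewrite e; apply: cls_id.
  move/subnK: mj => <-; elim: (j - m) => [|i IH]; first exact: P_cls.
  rewrite addSn; apply: P_up IH _ => e; apply: (h (i + m)); first exact: leq_addl.
  by rewrite -e; apply: cls_id.
split; first by case: (FS k mk).
exists m => j w mj vw Sw; have [Pj Sj] := FS j mj.
by apply: Sj; apply: P_eq Sw vw.
Qed.

(** All members of the (m+1)-class of a neighbor see the bounded m-class of [v], so [bdd_near]
    carries finiteness along the edges of the tree. *)
Lemma bdd_spread v : (exists m, forall k, m <= k -> ~ S k v) ->
  forall w, exists m, forall k, m <= k -> ~ S k w.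
Proof.
move=> vm; apply: (nbr_ind vm) => {v vm} v w /bdd_point [m mP] vw.
have [PF F] := mP m (leqnn m).
have [k h] : bdd (cls m.+1 w).
  apply: (bdd_near PF F) => x wx;
    apply: (near_const (P_cls phi m.+1 w) PF (cls_id phi _ _) wx).
  by exists v; [rewrite nbr_sym | apply: cls_id].
by exists k => j kj; apply: h kj (cls_id phi _ _).
Qed.

Lemma not_all_bdd n : ~ (forall D, P n D -> bdd D).
Proof.
move=> h; have [s sP] := P_list n.
have [m mP] : exists m, forall D k, D \in [seq F <- s | `[< P n F >]] -> m <= k ->
    forall v, D v -> ~ S k v.
  apply: seq_bound => D; rewrite mem_filter => /andP [/asboolP /h [m hm] _].
  by exists m => k mk v; apply: hm mk.
have [x Sx] := P_inh (PS m); apply: (mP (cls n x) m) (cls_id phi _ _) Sx => //.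
by rewrite mem_filter sP ?andbT; [apply/asboolP|]; apply: P_cls.
Qed.

Lemma finite_nat (A : set nat) : finite_set A <-> exists m, forall k, m <= k -> ~ A k.
Proof.
split=> [/finite_seqP [s ->]|[m h]].
  exists (foldr maxn 0 s).+1 => k /= lt ks; move: lt; rewrite ltnNge => /negP; apply.
  elim: s ks => //= a s IH; rewrite inE => /orP [/eqP->|/IH le]; first exact: leq_maxl.
  exact: leq_trans le (leq_maxr _ _).
apply: sub_finite_set (finite_II m) => k Ak /=; rewrite ltnNge; apply/negP => mk;
  exact: h mk Ak.
Qed.

Lemma bounded_typeP : bounded_type phi S <-> forall v, exists m, forall k, m <= k ->
  ~ S k v.
Proof.
have tS v k : type_set phi S v k <-> S k v.
  rewrite /type_set /=; split=> [<-|Sv]; first exact: cls_id.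
  by rewrite -(P_of (PS k) Sv).
split=> h v; first by have /finite_nat [m mP] := h v; exists m => k /mP nS /tS.
by apply/finite_nat; have [m mP] := h v; exists m => k /mP nS /tS.
Qed.

End Named.
Arguments bdd {d T} S D.

(** * The graphs with one choice of extension *)

Section Isomorphisms.
Local Open Scope classical_set_scope.

Lemma eg_iso_refl U (G : eigraph U) : eg_iso G G.
Proof. by exists id; split=> //; split=> // x; exists x. Qed.

Lemma eg_iso_trans U U' U'' (G : eigraph U) (H : eigraph U') (K : eigraph U'') :
  eg_iso G H -> eg_iso H K -> eg_iso G K.
Proof.
move=> [f [fb fi]] [g [gb gi]]; have [fB _ _] := fb.
exists (g \o f); split=> [|x y Gx Gy]; first exact: set_bij_comp gb.
by rewrite /= gi ?fi//; apply: fB.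
Qed.

Lemma eg_iso_sym U U' (G : eigraph U) (H : eigraph U') :
  inhabited U -> eg_iso G H -> eg_iso H G.
Proof.
move=> [u0] [f [[fB fI fS] fi]].
have gex y : exists x, eg_vert H y -> eg_vert G x /\ f x = y.
  have [Hy|nHy] := pselect (eg_vert H y); last by exists u0.
  by have [x Gx <-] := fS _ Hy; exists x.
have [g gP] := choice gex; exists g; split; last first.
  by move=> x y /gP [Gx {2}<-] /gP [Gy {2}<-]; rewrite fi.
split=> [y /gP []//|x y|x Gx].
  by rewrite !inE => /gP [_ {2}<-] /gP [_ {2}<-] ->.
have [Gg e] := gP _ (fB _ Gx); exists (f x); first exact: fB.
by apply: fI => //; rewrite inE.
Qed.

Lemma eg_stable_succ U (G : nat -> eigraph U) n0 : inhabited U ->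
  (forall n, n0 <= n -> eg_iso (G n) (G n.+1)) -> eg_eventually_stable G.
Proof.
move=> u0 h; have up n k : n0 <= n -> eg_iso (G n) (G (k + n)).
  move=> n0n; elim: k => [|k IH]; first exact: eg_iso_refl.
  by apply: eg_iso_trans IH _; apply: h; apply: leq_trans n0n (leq_addl _ _).
exists n0 => m n n0m n0n; have [mn|/ltnW nm] := leqP m n.
  by rewrite -(subnK mn); apply: up.
by apply: eg_iso_sym => //; rewrite -(subnK nm); apply: up.
Qed.

End Isomorphisms.

Section Reach.
Local Open Scope classical_set_scope.
Context {d : nat} {T : regular_tree d} (phi : T -> bool).
Implicit Types (x y z : T) (n k m : nat) (D E F X Y : set T).
Local Notation cls := (ball_class phi).
Local Notation P := (ball_classes phi).
Context {S Z Z' : nat -> set T} (HN : named phi S Z Z').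

Let PS := named_S HN.
Let PZ := named_Z HN.
Let PZ' := named_Z' HN.

(** The (n+1)-class on which G^Z_n reads the indices leaving [X]; also the candidate for an
    isomorphism from G^Z_n to G^Z_(n+1). *)
Definition row n X := if X == S n then Z n.+1 else X.
Local Notation V n := (eg_vert (Gext phi S Z n)).
Local Notation idx := (ext_index S Z).

Lemma row_S n : row n (S n) = Z n.+1.
Proof. by rewrite /row eqxx. Qed.

Lemma row_ns n X : X <> S n -> row n X = X.
Proof. by rewrite /row; case: eqP. Qed.

Lemma P_row n X : P n X -> P n.+1 (row n X).
Proof. by rewrite /row; case: (X =P S n) => [_ _|XS PX];
  [apply: PZ | apply: (P_up HN)]. Qed.

Lemma row_sub n X : row n X `<=` X.
Proof. by rewrite /row; case: (X =P S n) => [-> x|_ x]; first exact: (named_sub HN). Qed.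

Lemma row_inj n X Y : P n X -> P n Y -> row n X = row n Y -> X = Y.
Proof.
rewrite /row; case: (X =P S n) => [->|_]; case: (Y =P S n) => [->|_] //.
  by move=> _ PY /esym /(P_neqZ HN).
by move=> PX _ /(P_neqZ HN).
Qed.

Lemma nbr_index_cnt n X E x : P n.+1 X -> P n E -> X x -> nbr_index X E = cnt E x.
Proof.
move=> PX PE Xx; apply: xget_subset1; first by exists x.
by move=> _ _ [u Xu <-] [v Xv <-]; apply: cnt_const PX PE Xu Xv.
Qed.

Lemma idx_cnt n X E x : P n X -> P n E -> row n X x -> idx n X E = cnt E x.
Proof. by move=> /P_row PX; apply: nbr_index_cnt PX. Qed.

Lemma idx_pos n X E : P n X -> P n E -> 0 < idx n X E <-> adj (row n X) E.
Proof.
move=> PX PE; have [x Xx] := P_inh (P_row PX).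
rewrite (idx_cnt PX PE Xx) -near_cnt; split=> [xE|[y Xy yE]]; first by exists x.
exact: near_const (P_row PX) PE Xy Xx yE.
Qed.

Lemma V_root n : V n (S n).
Proof. by exists [::]. Qed.

Lemma V_P n X : V n X -> P n X.
Proof.
move=> [p [pV _ <-]]; case/lastP: p pV => [_|p X' /(_ (size p))]; first exact: PS.
by rewrite size_rcons last_rcons nth_rcons ltnn eqxx; apply.
Qed.

Lemma V_step n X Y : V n X -> P n Y -> adj (row n X) Y -> V n Y.
Proof.
move=> VX PY XY; have PX := V_P VX; case: VX => p [pV pS pX].
exists (rcons p Y); split; last by rewrite last_rcons.
  move=> i; rewrite size_rcons ltnS nth_rcons leq_eqVlt.
  by case: ltngtP => //= ip _; apply: pV.
by rewrite rcons_path pS pX /=; apply/idx_pos.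
Qed.

Lemma V_ind n (Q : set T -> Prop) : Q (S n) ->
  (forall X Y, V n X -> Q X -> P n Y -> adj (row n X) Y -> Q Y) -> forall X, V n X -> Q X.
Proof.
move=> QS Qn X [p [pV pS <-]].
elim/last_ind: p pV pS => [//|p Y IH] pV; rewrite rcons_path last_rcons => /andP [pS pY].
have pV' i : i < size p -> P n (nth (S n) p i).
  by move=> ip; have := pV i; rewrite size_rcons ltnS nth_rcons ip => /(_ (ltnW ip)).
have VX : V n (last (S n) p) by exists p.
have PY : P n Y.
  by have := pV (size p); rewrite size_rcons nth_rcons ltnn eqxx; apply.
by apply: (Qn _ _ VX (IH pV' pS) PY); apply/idx_pos => //; apply: V_P.
Qed.

(* This turns out to be the case where G^Z_n is a concatenation rather than a
   copy of G^Z_(n-1). *)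
Definition full n := S n = Z' n \/ adj (Z n.+1) (Z' n).

(** Neighbors of [S n] other than [Z n] and [Z' n] are seen by both halves, and [Z n] is always seen
    by [Z n.+1]; [full] supplies [Z' n]. *)
Lemma full_V n X : full n -> P n X -> V n X.
Proof.
move=> fn PX; have [x0 Sx0] := P_inh (PS n).
have SZ : adj (Z n.+1) (Z n).
  by have [z Zz] := P_inh (PZ n.+1); exists z => //; apply: (near_Z HN).
have VZ : V n (Z n) by apply: V_step (V_root n) (PZ n) _; rewrite row_S.
have VZ' : V n (Z' n).
  case: fn => [<-|ZZ']; first exact: V_root.
  by apply: V_step (V_root n) (PZ' n) _; rewrite row_S.
have all : forall y, V n (cls n y).
  apply: (@nbr_ind _ _ (fun y => V n (cls n y)) x0).
    by rewrite -(P_of (PS n) Sx0); apply: V_root.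
  move=> x y Vx xy; have [Sx|Sx] := pselect (cls n x = S n); last first.
    apply: V_step Vx (P_cls _ _ _) _; rewrite row_ns //.
    by exists x; [apply: cls_id | apply: nbr_near].
  have [->//|yZ] := pselect (cls n y = Z n).
  have [->//|yZ'] := pselect (cls n y = Z' n).
  apply: V_step (V_root n) (P_cls _ _ _) _; rewrite row_S.
  have [z Zz] := P_inh (PZ n.+1); exists z => //.
  apply: (near_S HN) (P_cls _ _ _) yZ yZ' _ (named_sub HN Zz).
  by exists x; [rewrite -Sx; apply: cls_id | apply: nbr_near].
by have [x Xx] := P_inh PX; rewrite (P_of PX Xx); apply: all.
Qed.

(** The count of [S n] is the sum of the counts of its halves, so it equals the count of [Z n.+1]
    where [Z' n.+1] is not seen. *)
Lemma row_iso n :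
    (forall X x, V n X -> row n.+1 (row n X) x -> ~ near x (Z' n.+1)) ->
    V n.+1 = row n @` V n ->
  eg_iso (Gext phi S Z n) (Gext phi S Z n.+1).
Proof.
move=> nZ' VV; exists (row n); split.
  rewrite VV; split=> [X VX|X Y|//]; first by exists X.
  by rewrite !inE => /V_P PX /V_P PY; apply: row_inj.
move=> X Y VX VY; have [PX PY] := (V_P VX, V_P VY).
have [x xX] := P_inh (P_row (P_row PX)).
change (idx n.+1 (row n X) (row n Y) = idx n X Y).
rewrite (idx_cnt (P_row PX) (P_row PY) xX) (idx_cnt PX PY (row_sub xX)).
have [YS|YS] := pselect (Y = S n); last by rewrite row_ns.
rewrite YS row_S; apply: eq_in_count => y xy /=.
apply/idP/idP; rewrite !inE; first exact: (named_sub HN).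
by case/(named_split HN) => // Zy; case: (nZ' _ _ VX xX); exists y.
Qed.

(* The classes that are not bounded are then never adjacent to Z' n, except
   through S n: G^Z_n consists of them, and row maps G^Z_n onto G^Z_(n+1). *)
Lemma stable_of_bdd n0 :
    (forall n, n0 <= n -> bdd S (Z' n) /\ ~ bdd S (Z n)) ->
  eg_eventually_stable (Gext phi S Z).
Proof.
move=> h.
have SN n : n0 <= n -> ~ bdd S (S n).
  move=> /leqW /h [_ nZ] bS; apply: nZ; apply: (bdd_sub _ bS); exact: (named_sub HN).
have nb n D E : P n.+1 D -> ~ bdd S D -> P n E -> adj D E -> ~ bdd S E.
  move=> PD nD PE [x Dx xE] bE; apply: nD.
  by apply: (bdd_near HN PE bE) => y Dy; apply: near_const PD PE Dx Dy xE.
have nrow n X : n0 <= n -> ~ bdd S X -> ~ bdd S (row n X).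
  by move=> n0n nX; rewrite /row; case: eqP => // _; case: (h n.+1 (leqW n0n)).
(* A class that is not bounded cannot see the bounded [Z' n.+1] constantly, so it can see it only as
   [S n.+1], which sees [Z n.+1] anyway. *)
have Zadj n D : n0 <= n -> P n D -> D <> S n -> ~ bdd S D -> adj D (S n) ->
  adj (Z n.+1) D.
  move=> n0n PD DS nD /(adj_split HN) [/adj_sym //|DZ'].
  have [D1|D1] := pselect (D = S n.+1); last first.
    by case: (nb _ _ _ (P_up HN (P_up HN PD DS) D1) nD (PZ' n.+1) DZ');
      case: (h n.+1 (leqW n0n)).
  apply: adj_sym; have [x Zx] := P_inh (PZ n.+2).
  by exists x; [rewrite D1; exact: (named_sub HN Zx) | exact: (near_Z HN Zx)].
have VE n : n0 <= n -> V n = [set X | P n X /\ ~ bdd S X].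
  move=> n0n; apply/seteqP; split=> [X VX|X [PX nX]].
    split; first exact: V_P.
    apply: (@V_ind n (fun X => ~ bdd S X) _ _ X VX); first exact: SN.
    move=> D E /V_P PD nD PE; apply: (nb n) PE; [exact: P_row | exact: nrow].
  (* Being unreachable without being bounded would spread from [X] over the whole tree and reach
     [S n]. *)
  apply: contrapT => nVX; have [x0 Xx0] := P_inh PX; have [s Ss] := P_inh (PS n).
  suff : ~ V n (cls n s) by rewrite -(P_of (PS n) Ss); apply; apply: V_root.
  suff : ~ V n (cls n s) /\ ~ bdd S (cls n s) by case.
  apply: (@nbr_ind _ _ (fun y => ~ V n (cls n y) /\ ~ bdd S (cls n y)) x0).
    by rewrite -(P_of PX Xx0).
  move=> x y [nV nB] xy.
  have xS : cls n x <> S n by move=> e; apply: nV; rewrite e; apply: V_root.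
  have xyA : adj (cls n x) (cls n y) by exists x; [apply: cls_id | apply: nbr_near].
  have yB : ~ bdd S (cls n y) by apply: nb (P_up HN (P_cls _ _ _) xS) nB (P_cls _ _ _)
    xyA.
  split=> // Vy; apply: nV; have [yS|yS] := pselect (cls n y = S n).
    apply: V_step (V_root n) (P_cls _ _ _) _; rewrite row_S; apply: Zadj => //;
      first exact: P_cls.
    by rewrite -yS.
  by apply: V_step Vy (P_cls _ _ _) _; rewrite row_ns //; apply: adj_sym.
apply: (@eg_stable_succ _ _ n0) => [|n n0n]; first exact: (inhabits setT).
have n0n1 := leqW n0n; apply: row_iso.
  rewrite VE // => X x [PX nX] xX xZ'.
  apply: (nb n.+1 (row n.+1 (row n X)) (Z' n.+1)) => //; try by case: (h n.+1 n0n1).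
  - exact/P_row/P_row.
  - by apply/nrow/nrow.
  - by exists x.
rewrite !VE //; apply/seteqP; split=> [X [PX nX]|_ [X [PX nX] <-]]; last first.
  by split; [apply: P_row | apply: nrow].
have [[PX' XS]|e|e] := P_succ HN PX; first by exists X; rewrite ?row_ns.
  by exists (S n); [split; [|apply: SN] | rewrite row_S e].
by case: (h n.+1 n0n1); rewrite -e.
Qed.

End Reach.

(** * Bounded type makes one graph stable *)

Section Bounded.
Local Open Scope classical_set_scope.
Context {d : nat} {T : regular_tree d} (phi : T -> bool).
Implicit Types (x y z : T) (n k m : nat) (D E F X Y : set T).
Local Notation cls := (ball_class phi).
Local Notation P := (ball_classes phi).

(** [Z n.+1] always sees [Z n], so boundedness passes to larger radii; the other half cannot be
    bounded too, since their union [S n] is not. *)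
Lemma bdd_letter S Z Z' (HN : named phi S Z Z') n0 :
    (forall n, n0 <= n -> ~ bdd S (S n)) -> bdd S (Z n0.+1) ->
  forall n, n0 < n -> bdd S (Z n) /\ ~ bdd S (Z' n).
Proof.
move=> SN bZ n /subnK <-; elim: (n - _) => [|k [IH _]]; rewrite ?add0n ?addSn.
  split=> // bZ'; apply: (SN n0 (leqnn n0)); apply: bdd_union bZ bZ';
    exact: (named_split HN).
have bk : bdd S (Z (k + n0.+1).+1).
  apply: (bdd_near HN (named_Z HN _) IH) => x; exact: (near_Z HN).
split=> // bZ'; apply: (SN (k + n0.+1)); first exact: leq_trans (leqnSn _) (leq_addl _ _).
apply: bdd_union bk bZ'; exact: (named_split HN).
Qed.

(** At large radii an edge joins a bounded class to one that is not bounded. By constancy the latter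
    can only be [S n], and the former can only be [Z n] or [Z' n]: one letter is bounded. *)
Lemma bounded_stable_letter S Z Z' (HN : named phi S Z Z') :
  (forall v, exists m, forall k, m <= k -> ~ S k v) ->
  eg_eventually_stable (Gext phi S Z) \/ eg_eventually_stable (Gext phi S Z').
Proof.
move=> bS; have [v _] := P_inh (named_S HN 0).
have [n0 FP] := bdd_point HN (bS v).
have key n : n0 <= n -> ~ bdd S (S n) /\ exists E, [/\ P n E, bdd S E & adj (S n) E].
  move=> n0n; have [PF bF] := FP n n0n.
  have [x [y [xy bx nby]]] : exists x y, [/\ y \in nbr x,
    bdd S (cls n x) & ~ bdd S (cls n y)].
    apply: contrapT => h; apply: (@not_all_bdd _ _ _ _ _ _ HN n) => D PD.
    have [w Dw] := P_inh PD; rewrite (P_of PD Dw).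
    apply: (@nbr_ind _ _ (fun y => bdd S (cls n y)) v);
      first by rewrite -(P_of PF (cls_id phi _ _)).
    by move=> x y bx xy; apply: contrapT => nby; apply: h; exists x, y.
  have yx : adj (cls n y) (cls n x).
    by exists y; [apply: cls_id | exists x; rewrite 1?nbr_sym //; apply: cls_id].
  have [<-|yS] := pselect (cls n y = S n); first by split=> //; exists (cls n x);
    split=> //; apply: P_cls.
  case: nby; apply: (bdd_near HN (P_cls _ _ _) bx) => z yz.
  by apply: (near_ns HN) yS _ yx yz; apply: P_cls.
have SN n : n0 <= n -> ~ bdd S (S n) by move=> /key [].
have [_ [E [PE bE SE]]] := key n0.+1 (leqnSn n0).
have [EZ|EZ] := pselect (E = Z n0.+1).
  right; apply: (stable_of_bdd (named_swap HN) (n0 := n0.+1)).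
  by apply: (bdd_letter HN) SN _; rewrite -EZ.
have [EZ'|EZ'] := pselect (E = Z' n0.+1).
  left; apply: (stable_of_bdd HN (n0 := n0.+1)).
  by apply: (bdd_letter (named_swap HN)) SN _; rewrite -EZ'.
case: (SN n0.+1 (leqnSn n0)); apply: (bdd_near HN PE bE) => x Sx.
exact: (near_S HN) PE EZ EZ' SE Sx.
Qed.

End Bounded.
Arguments row {d T} S Z n X.
Arguments full {d T} S Z Z' n.

(** * Motion of the special class in the unbounded case *)

Section Unbounded.
Local Open Scope classical_set_scope.
Context {d : nat} {T : regular_tree d} (phi : T -> bool).
Implicit Types (x y z : T) (n k m : nat) (D E F X Y W : set T).
Local Notation cls := (ball_class phi).
Local Notation P := (ball_classes phi).

(* Let v be in S n, n large. A neighbor of v outside S n, Z n, Z' n and S n.+1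
   would be adjacent to both Z n.+1 and Z' n.+1, and its valence would still
   increase. The same holds for a neighbor in Z n or Z' n if all four occur. *)
Lemma unbounded_valence S Z Z' (HN : named phi S Z Z') :
    (forall v n, exists k, n <= k /\ S k v) ->
  forall v n, valence phi n v <= 3.
Proof.
move=> U v n0.
have [n1 st] : exists n1, forall w k, w \in v :: nbr v -> n1 <= k ->
    forall m, k <= m -> valence phi m w = valence phi k w.
  apply: seq_bound => w _; have [m h] := valence_stable phi w.
  by exists m => k mk j kj; apply: h.
have [n [n01 Sv]] := U v (maxn n0 n1); move: n01; rewrite geq_max => /andP [n0n n1n].
apply: leq_trans (valence_mono phi v n0n) _.
have nojump w : w \in nbr v -> near w (Z n.+1) -> near w (Z' n.+1) -> False.
  move=> vw wZ wZ'.
  have : valence phi n w < valence phi n.+1 w by apply: (valence_jump HN); right.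
  by rewrite (st w n _ n1n n.+1) ?ltnn // inE vw orbT.
have key w : w \in nbr v -> [\/ cls n w = S n, cls n w = Z n,
  cls n w = Z' n | cls n w = S n.+1].
  move=> vw; have [?|wS] := pselect (cls n w = S n); first exact: Or41.
  have [?|wZ] := pselect (cls n w = Z n); first exact: Or42.
  have [?|wZ'] := pselect (cls n w = Z' n); first exact: Or43.
  apply: Or44; apply: contrapT => wS1.
  have PW := P_cls phi n w; have PW1 := P_up HN PW wS.
  have vW : adj (S n) (cls n w) by exists v => //; apply: nbr_near.
  have nE X : P n.+1 X -> X `<=` S n -> near w X.
    move=> PX XS; apply: (near_ns HN PW1 wS1 PX) (cls_id _ _ _); apply: adj_sym.
    by have [x Xx] := P_inh PX; exists x => //; apply: (near_S HN PW wZ wZ' vW);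
      apply: XS.
  apply: (nojump w vw).
    by apply: (nE _ (named_Z HN _)) => x; exact: (named_sub HN).
  by apply: (nE _ (named_Z' HN _)) => x; exact: (named_sub' HN).
have vS : cls n v = S n by rewrite -(P_of (named_S HN n) Sv).
have le3 a b c : (forall w, w \in nbr v -> cls n w \in [:: a; b; c]) -> S n \in [:: a;
  b; c] ->
    valence phi n v <= 3.
  move=> h Sabc; apply: (@valence_leq _ _ phi n v [:: a; b; c]) => w.
  by rewrite in_cons => /orP [/eqP ->|/h //]; rewrite vS.
have [SZ|SZ] := pselect (S n = Z n).
  apply: (le3 (S n) (Z' n) (S n.+1)); last by rewrite mem_head.
  by move=> w /key []; rewrite -?SZ => ->; rewrite !in_cons eqxx ?orbT.
have [SZ'|SZ'] := pselect (S n = Z' n).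
  apply: (le3 (S n) (Z n) (S n.+1)); last by rewrite mem_head.
  by move=> w /key []; rewrite -?SZ' => ->; rewrite !in_cons eqxx ?orbT.
have [vZ|vZ] := pselect (near v (Z n)); last first.
  apply: (le3 (S n) (Z' n) (S n.+1)); last by rewrite mem_head.
  move=> w vw; have [] := key w vw => e; rewrite e; try by rewrite !in_cons eqxx ?orbT.
  by case: vZ; exists w => //; rewrite -e; apply: cls_id.
have [vZ'|vZ'] := pselect (near v (Z' n)); last first.
  apply: (le3 (S n) (Z n) (S n.+1)); last by rewrite mem_head.
  move=> w vw; have [] := key w vw => e; rewrite e; try by rewrite !in_cons eqxx ?orbT.
  by case: vZ'; exists w => //; rewrite -e; apply: cls_id.
have [S1Z|S1Z] := pselect (S n.+1 = Z n).
  apply: (le3 (S n) (Z n) (Z' n)); last by rewrite mem_head.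
  by move=> w /key []; rewrite ?S1Z => ->; rewrite !in_cons eqxx ?orbT.
have [S1Z'|S1Z'] := pselect (S n.+1 = Z' n).
  apply: (le3 (S n) (Z n) (Z' n)); last by rewrite mem_head.
  by move=> w /key []; rewrite ?S1Z' => ->; rewrite !in_cons eqxx ?orbT.
have PZ1 : P n.+1 (Z n) by apply: (P_up HN (named_Z HN n)); apply/nesym.
have PZ1' : P n.+1 (Z' n) by apply: (P_up HN (named_Z' HN n)); apply/nesym.
have [z Zz] := P_inh (named_Z HN n.+1); have [z' Zz'] := P_inh (named_Z' HN n.+1).
have [Zv|Zv] := named_split HN Sv.
  case: vZ' => w vw Zw; case: (nojump w vw); first by exists v; rewrite // nbr_sym.
  apply: (near_ns HN PZ1' (nesym S1Z') (named_Z' HN _)) Zw; apply: adj_sym.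
  by exists z' => //; apply: (near_Z' HN).
case: vZ => w vw Zw; case: (nojump w vw); last by exists v; rewrite // nbr_sym.
apply: (near_ns HN PZ1 (nesym S1Z) (named_Z HN _)) Zw; apply: adj_sym.
by exists z => //; apply: (near_Z HN).
Qed.

Definition third (S Z Z' : nat -> set T) n E :=
  [/\ P n E, E <> S n, E <> Z n, E <> Z' n & adj (S n) E].

(* At such n, the special class moves on to its third neighbor. *)
Definition running (S Z Z' : nat -> set T) n :=
  [/\ S n <> Z n, S n <> Z' n & exists E, third S Z Z' n E].

(* W is a union of classes of n-balls and of connected components of the graph
   G_n deprived of S n. *)
Definition closed_off (S : nat -> set T) n W :=
  [/\ forall x, W x -> ~ S n x, forall x y, cls n x y -> W x -> W y &
      forall x y, W x -> y \in nbr x -> W y \/ S n y].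

(* D and E are connected in G_n deprived of S n. *)
Definition link (S : nat -> set T) n D E :=
  forall W, closed_off S n W -> D `<=` W -> E `<=` W.

Definition special_nbr (S : nat -> set T) n D := [/\ P n D, D <> S n & adj (S n) D].

(* G_n has a cycle through S n. *)
Definition special_cycle (S : nat -> set T) n := exists D E,
  [/\ special_nbr S n D, special_nbr S n E, D <> E & link S n D E].

Lemma third_swap S Z Z' n E : third S Z Z' n E -> third S Z' Z n E.
Proof. by case. Qed.

Lemma running_swap S Z Z' n : running S Z Z' n -> running S Z' Z n.
Proof. by case=> ? ? [E /third_swap]; split=> //; exists E. Qed.

Lemma closed_class S n W D x : closed_off S n W -> P n D -> D x -> W x -> D `<=` W.
Proof. by move=> [_ sat _] PD Dx Wx y; rewrite (P_of PD Dx) => xy; apply: sat xy Wx. Qed.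

Lemma class_sat n D x y : P n D -> cls n x y -> D x -> D y.
Proof. by move=> PD xy Dx; rewrite (P_of PD Dx). Qed.

Lemma class_sat' n D x y : P n D -> cls n x y -> D y -> D x.
Proof. by move=> PD /cls_eq xy Dy; rewrite (P_of PD Dy) -xy; apply: cls_id. Qed.

(** The vertices outside [W] and [S n] form a closed-off set as well. *)
Lemma link_sym S n D E : P n (S n) -> P n D -> P n E -> E <> S n -> D <> S n ->
  link S n D E -> link S n E D.
Proof.
move=> PS PD PE ES DS DE W Wc EW x Dx; apply: contrapT => nWx.
have [Wd Ws Wn] := Wc.
have [e Ee] := P_inh PE.
have Cc : closed_off S n [set y | ~ W y /\ ~ S n y].
  split=> [y [] //|y z yz [nW nS]|y z [nW nS] yz].
    split=> [Wz|Sz]; last by apply: nS; exact: (class_sat' PS yz Sz).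
    by apply: nW; apply: Ws Wz; rewrite -(cls_eq yz); apply: cls_id.
  have [Sz|nSz] := pselect (S n z); [by right | left; split=> // Wz].
  by have [] := Wn z y Wz; rewrite // nbr_sym.
have DC : D `<=` [set y | ~ W y /\ ~ S n y].
  move=> y Dy; split=> [Wy|Sy]; first by apply: nWx; exact: (closed_class Wc PD Dy Wy).
  by apply: DS; exact: (P_eq PD PS Dy Sy).
by have [/(_ (EW e Ee))] := DE _ Cc DC e Ee.
Qed.

Section Valence3.
Context {S Z Z' : nat -> set T} (HN : named phi S Z Z').
Hypothesis v3 : forall v n, valence phi n v <= 3.

Let PS := named_S HN.
Let PZ := named_Z HN.
Let PZ' := named_Z' HN.

Lemma no4 n x D1 D2 D3 D4 :
  P n D1 -> P n D2 -> P n D3 -> P n D4 -> hit x D1 -> hit x D2 -> hit x D3 -> hit x D4 ->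
  D1 <> D2 -> D1 <> D3 -> D1 <> D4 -> D2 <> D3 -> D2 <> D4 -> D3 <> D4 -> False.
Proof.
move=> *; have : 3 < valence phi n x by apply: (@valence_ge4 _ _ phi n x D1 D2 D3 D4).
by rewrite ltnNge v3.
Qed.

Lemma hit_in x D : D x -> hit x D. Proof. by left. Qed.
Lemma hit_near x D : near x D -> hit x D. Proof. by right. Qed.

Lemma P_neqZ' n X : P n X -> X <> Z' n.+1.
Proof. exact: (P_neqZ (named_swap HN)). Qed.

Lemma third_near n E x : third S Z Z' n E -> S n x -> near x E.
Proof. by case=> PE _ EZ EZ' SE; apply: (near_S HN). Qed.

Lemma adj_S_Z n : adj (S n.+1) (Z n.+1).
Proof.
have [x Zx] := P_inh (PZ n.+2); exists x;
  [exact: (named_sub HN Zx) | exact: (near_Z HN Zx)].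
Qed.

Lemma adj_S_Z' n : adj (S n.+1) (Z' n.+1).
Proof.
have [x Zx] := P_inh (PZ' n.+2); exists x;
  [exact: (named_sub' HN Zx) | exact: (near_Z' HN Zx)].
Qed.

Lemma S_move n : S n.+1 <> Z n.+1 -> S n.+1 <> Z' n.+1 -> special_nbr S n (S n.+1).
Proof.
move=> SZ SZ'; have [[PS1 S1S]|//|//] := P_succ HN (PS n.+1); split=> //.
by apply: adj_sub (adj_sym (adj_S_Z n)); exact: (named_sub HN).
Qed.

(** Both halves of [S n] see every third class. One half also meets [S n] and a class among [Z n],
    [Z' n] different from [S n], which leaves room for one more. *)
Lemma third_uniq n E1 E2 : third S Z Z' n E1 -> third S Z Z' n E2 -> E1 = E2.
Proof.
move=> t1 t2; apply: contrapT => E12.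
have [P1 E1S E1Z E1Z' _] := t1; have [P2 E2S E2Z E2Z' _] := t2.
have [SZ|SZ] := pselect (S n = Z n).
  have [x Zx] := P_inh (PZ' n.+1); have Sx := named_sub' HN Zx.
  have SZ' : S n <> Z' n by rewrite SZ; apply: (Z_neq HN).
  apply: (@no4 n x (S n) (Z' n) E1 E2) => //; try exact/nesym.
  - exact/hit_in.
  - exact/hit_near/(near_Z' HN).
  - exact: hit_near (third_near t1 Sx).
  - exact: hit_near (third_near t2 Sx).
have [x Zx] := P_inh (PZ n.+1); have Sx := named_sub HN Zx.
apply: (@no4 n x (S n) (Z n) E1 E2) => //; try exact/nesym.
- exact/hit_in.
- exact/hit_near/(near_Z HN).
- exact: hit_near (third_near t1 Sx).
- exact: hit_near (third_near t2 Sx).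
Qed.

Lemma running_sides n : running S Z Z' n -> ~ adj (Z n.+1) (Z' n).
Proof.
move=> [SZ SZ' [E tE]] [x Zx xZ']; have [PE ES EZ EZ' _] := tE;
  have Sx := named_sub HN Zx.
apply: (@no4 n x (S n) (Z n) (Z' n) E) => //; try exact/nesym.
- exact/hit_in.
- exact/hit_near/(near_Z HN).
- exact/hit_near.
- exact: hit_near (third_near tE Sx).
- exact: (Z_neq HN).
Qed.

Lemma running_split n : running S Z Z' n -> ~ adj (Z n.+1) (Z' n.+1).
Proof.
move=> [SZ SZ' [E tE]] [x Zx xZ']; have [PE ES EZ EZ' _] := tE;
  have Sx := named_sub HN Zx.
apply: (@no4 n.+1 x (Z n.+1) (Z' n.+1) (Z n) E) => //; try exact/nesym.
- by apply: (P_up HN) => //; apply/nesym.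
- exact: (P_up HN).
- exact/hit_in.
- exact/hit_near.
- exact/hit_near/(near_Z HN).
- exact: hit_near (third_near tE Sx).
- exact: (Z_neq HN).
- exact/nesym/(P_neqZ HN).
- exact/nesym/(P_neqZ HN).
- exact/nesym/P_neqZ'.
- exact/nesym/P_neqZ'.
Qed.

End Valence3.

(** * A run of the special class cannot last forever *)

Section Running.
Hypothesis v3 : forall v n, valence phi n v <= 3.

Lemma running_sides' S Z Z' (HN : named phi S Z Z') n :
  running S Z Z' n -> ~ adj (Z' n.+1) (Z n).
Proof. by move=> /running_swap; apply: (running_sides (named_swap HN)). Qed.

(** [S n.+1] sees both halves of [S n]. In a run the halves do not see each other, and [Z n] and
    [Z' n] see at most their own half. *)
Lemma running_third S Z Z' (HN : named phi S Z Z') n :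
  running S Z Z' n -> third S Z Z' n (S n.+1).
Proof.
move=> Rn; have S1Z : S n.+1 <> Z n.+1.
  move=> e; apply: (running_split HN v3 Rn); rewrite -e; exact: adj_S_Z' HN n.
have S1Z' : S n.+1 <> Z' n.+1.
  move=> e; apply: (running_split HN v3 Rn); apply: adj_sym; rewrite -e;
    exact: adj_S_Z HN n.
have [PS1 S1S SS1] := S_move HN S1Z S1Z'; split=> // e.
  by apply: (running_sides' HN Rn); apply: adj_sym; rewrite -e; apply: (adj_S_Z' HN).
by apply: (running_sides HN v3 Rn); apply: adj_sym; rewrite -e; apply: (adj_S_Z HN).
Qed.

Lemma running_nbr S Z Z' (HN : named phi S Z Z') n D :
  running S Z Z' n -> P n D -> adj (S n) D ->
  [\/ D = S n, D = Z n, D = Z' n | D = S n.+1].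
Proof.
move=> Rn PD SD; have [?|DS] := pselect (D = S n); first exact: Or41.
have [?|DZ] := pselect (D = Z n); first exact: Or42.
have [?|DZ'] := pselect (D = Z' n); first exact: Or43.
by apply: Or44; apply: (third_uniq HN v3) (running_third HN Rn).
Qed.

Lemma nbr_cls n D x y : D y -> y \in nbr x -> adj D (cls n x).
Proof. by move=> Dy xy; exists y => //; apply: nbr_near; rewrite nbr_sym. Qed.

(* Z n lies on the side of S n that S has left behind: S never comes back. *)
Definition trap S Z Z' n W :=
  [/\ running S Z Z' n, closed_off S n W, S n.+1 `<=` W & forall x, Z n x -> ~ W x].

(** When the special class moves on, [S n] stays behind in two parts: [Z n.+1] remains outside with
    [Z n], and [Z' n.+1] joins the new trap exactly when [Z' n] lies in the old one. *)
Lemma trap_step S Z Z' (HN : named phi S Z Z') n W :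
    trap S Z Z' n W -> running S Z Z' n.+1 ->
  exists W', trap S Z Z' n.+1 W' /\ forall x, W' x -> W x \/ Z' n.+1 x.
Proof.
move=> [Rn Wc SW ZW] Rn1; have [Wd Ws Wn] := Wc.
have PS := named_S HN; have PZ := named_Z HN; have PZ' := named_Z' HN.
have [PS1 S1S S1Z S1Z' _] := running_third HN Rn.
have [PS2 S2S S2Z S2Z' [s1 Ss1 [s2 s12 Ss2]]] := running_third HN Rn1.
have dS x : S n.+1 x -> ~ S n x by move=> S1x Sx; apply: S1S;
  exact: (P_eq PS1 (PS n) S1x Sx).
exists (fun x => (W x /\ ~ S n.+1 x) \/ (Z' n.+1 x /\ Z' n `<=` W)); split; last first.
  by move=> x [[? _]|[? _]]; [left|right].
split=> //.
- split=> [x [[//]|[Zx _] S1x]|x y xy [[Wx Sx]|[Zx ZW']]|x y [[Wx S1x]|[Zx ZW']] xy].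
  + by apply: (dS x S1x); exact: (named_sub' HN Zx).
  + left; split; first by apply: Ws Wx; apply: cls_le xy.
    by move=> Sy; apply: Sx; exact: (class_sat' (PS n.+1) xy Sy).
  + by right; split=> //; exact: (class_sat (PZ' n.+1) xy Zx).
  + have [S1y|S1y] := pselect (S n.+1 y); first by right.
    left; have [Wy|Sy] := Wn _ _ Wx xy; first by left.
    have Sx := nbr_cls n Sy xy.
    have [e|e|e|e] := running_nbr HN Rn (P_cls _ _ _) Sx.
    * by case: (Wd x Wx); rewrite -e; apply: cls_id.
    * by case: (ZW x _ Wx); rewrite -e; apply: cls_id.
    * have Zx : Z' n x by rewrite -e; apply: cls_id.
      have [Zy|Zy] := named_split HN Sy.
        by case: (running_sides HN v3 Rn); rewrite -e; exact: (nbr_cls n Zy xy).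
      by right; split=> //; exact: (closed_class Wc (PZ' n) Zx Wx).
    * by case: S1x; rewrite -e; apply: cls_id.
  + have [S1y|S1y] := pselect (S n.+1 y); first by right.
    left; have Sxy : adj (S n) (cls n y).
      by exists x; [exact: (named_sub' HN Zx) | apply: nbr_near].
    have [e|e|e|e] := running_nbr HN Rn (P_cls _ _ _) Sxy.
    * have Sy : S n y by rewrite -e; apply: cls_id.
      have [Zy|Zy] := named_split HN Sy; last by right.
      by case: (running_split HN v3 Rn); exists y => //; exists x; rewrite // nbr_sym.
    * by case: (running_sides' HN Rn); rewrite -e; exists x => //; apply: nbr_near.
    * by left; split=> //; apply: ZW'; rewrite -e; apply: cls_id.
    * by case: S1y; rewrite -e; apply: cls_id.
- have [[PS2' S2n]|//|//] := P_succ HN PS2.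
  have Ws2 : W s2.
    by have [//|Ss] := Wn _ _ (SW _ Ss1) s12; case: S2n; exact: (P_eq PS2' (PS n) Ss2 Ss).
  move=> x S2x; left; split; first exact: (closed_class Wc PS2' Ss2 Ws2).
  by move=> S1x; apply: S2S; exact: (P_eq PS2 (PS n.+1) S2x S1x).
- move=> x Zx [[Wx _]|[Zx' _]]; last exact: (named_disj HN Zx).
  by apply: (Wd x Wx); exact: (named_sub HN Zx).
Qed.

(** A vertex of [Z n] never enters a trap: traps gain only vertices of the special class being left,
    and the next special class lies inside the present trap. So this vertex would never be special
    again. *)
Lemma trap_escape S Z Z' (HN : named phi S Z Z') n W :
    (forall v n, exists k, n <= k /\ S k v) ->
    trap S Z Z' n W -> ~ forall m, n <= m -> running S Z Z' m.
Proof.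
move=> U tW Rm; have [v Zv] := P_inh (named_Z HN n).
have key k : exists W', [/\ trap S Z Z' (k + n) W', ~ W' v & ~ S (k + n) v].
  elim: k => [|k [W' [tW' nW nS]]].
    have [[SZ _ _] _ _ ZW] := tW; exists W; split=> //; first exact: ZW.
    by move=> Sv; apply: SZ; exact: (P_eq (named_S HN n) (named_Z HN n) Sv Zv).
  have [|W'' [tW'' sW]] := trap_step HN tW'; first exact/Rm/leqW/leq_addl.
  exists W''; split=> // [/sW [//|Zv']|Sv].
    by apply: nS; exact: (named_sub' HN Zv').
  by have [_ _ SW _] := tW'; apply: nW; apply: SW.
have [k [nk Sk]] := U v n; have [W' [_ _]] := key (k - n); rewrite subnK //.
Qed.

(** The candidates are [Z n], [Z' n] and the unique third class; outside a run, one of them is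
    missing or is [S n] itself. *)
Lemma few_special_nbr S Z Z' (HN : named phi S Z Z') n D1 D2 D3 : ~ running S Z Z' n ->
  special_nbr S n D1 -> special_nbr S n D2 -> special_nbr S n D3 ->
  [\/ D1 = D2, D1 = D3 | D2 = D3].
Proof.
move=> nR.
have c D : special_nbr S n D -> [\/ D = Z n, D = Z' n | third S Z Z' n D].
  move=> [PD DS SD]; have [?|?] := pselect (D = Z n); first exact: Or31.
  by have [?|?] := pselect (D = Z' n); [apply: Or32 | apply: Or33].
have nt E : third S Z Z' n E -> S n = Z n \/ S n = Z' n.
  move=> tE; apply: contrapT => h; apply: nR; split; last by exists E.
    by move=> e; apply: h; left.
  by move=> e; apply: h; right.
move=> n1 n2 n3; have [_ d1 _] := n1; have [_ d2 _] := n2; have [_ d3 _] := n3.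
have u := third_uniq HN v3 (n := n).
case: (c _ n1) (c _ n2) (c _ n3) => [e1|e1|t1] [e2|e2|t2] [e3|e3|t3];
  try (by constructor; congruence); try (by apply: Or31; congruence);
  try (by apply: Or32; congruence); try (by apply: Or33; congruence);
  try (by apply: Or31; apply: u); try (by apply: Or32; apply: u); try (by apply: Or33;
    apply: u).
all: try (by have [e|e] := nt _ t1; congruence).
all: try (by have [e|e] := nt _ t2; congruence).
all: try (by have [e|e] := nt _ t3; congruence).
Qed.


(* The other neighbor D of S n is only adjacent to Z' n.+1: then Z n.+1 is a
   dead end behind S n.+1. *)
Lemma trap_start1 S Z Z' (HN : named phi S Z Z') n D : ~ running S Z Z' n ->
    running S Z Z' n.+1 -> special_nbr S n D -> D <> S n.+1 ->
    ~ adj D (Z n.+1) -> adj D (Z' n.+1) ->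
  exists W, trap S Z Z' n.+1 W.
Proof.
move=> nR Rn1 nbD DS1 DZ DZ'.
have PS := named_S HN; have PZ := named_Z HN; have PZ' := named_Z' HN.
have [S1Z S1Z' _] := Rn1; have nbS1 := S_move HN S1Z S1Z'.
have [PS1 S1S SS1] := nbS1; have [PD DS SD] := nbD.
have [PS2 S2S1 S2Z S2Z' _] := running_third HN Rn1.
have nZZ : ~ adj (Z' n.+1) (Z n.+1).
  move=> [x Zx xZ]; have PD1 := P_up HN PD DS.
  apply: (@no4 v3 n.+1 x (Z' n.+1) (Z n.+1) (S n.+1) D) => //; try exact/nesym.
  - exact/hit_in.
  - exact/hit_near.
  - apply/hit_near; apply: (near_ns HN (PZ' n.+1) (nesym S1Z') (PS n.+1)) Zx.
    exact/adj_sym/(adj_S_Z' HN).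
  - apply/hit_near.
    by apply: (near_ns HN (PZ' n.+1) (nesym S1Z') PD1) Zx; apply: adj_sym.
  - exact/nesym/(Z_neq HN).
  - exact/nesym/(P_neqZ' HN).
  - exact/nesym/(P_neqZ HN).
exists [set x | ~ S n.+1 x /\ ~ Z n.+1 x]; split=> //.
- split=> [x []//|x y xy [Sx Zx]|x y [Sx Zx] xy].
    by split=> [Sy|Zy]; [apply: Sx; exact: (class_sat' (PS n.+1) xy Sy)
                        | apply: Zx; exact: (class_sat' (PZ n.+1) xy Zy)].
  have [Sy|Sy] := pselect (S n.+1 y); [by right | left; split=> // Zy].
  have Sy' := named_sub HN Zy; have Sx' := nbr_cls n Sy' xy.
  have xcl := cls_id phi n x; have PX := P_cls phi n x.
  have [e|e] := pselect (cls n x = S n).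
    rewrite e in xcl; have [//|Zx'] := named_split HN xcl.
    by apply: nZZ; exists x => //; exists y.
  have [e1|e1|//] := few_special_nbr HN nR nbS1 nbD (And3 PX e Sx').
    by apply: DS1.
  by apply: Sx; rewrite e1.
  by move=> e2; apply: DZ; rewrite e2; exists x => //; exists y.
- move=> x S2x; split=> [S1x|Zx].
    by apply: S2S1; exact: (P_eq PS2 (PS n.+1) S2x S1x).
  by apply: S2Z; exact: (P_eq PS2 (PZ n.+1) S2x Zx).
- by move=> x Zx [].
Qed.

(** Besides [S n.+1], the class [S n] has at most one neighbor [D]. The part cut off behind [S n.+1]
    is [S n] if there is no [D], one half of it if [D] sees only the other, and [S n] together with
    [D] if [D] sees both, since [D] then sees no further class. *)
Lemma trap_start S Z Z' (HN : named phi S Z Z') n : ~ running S Z Z' n ->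
    running S Z Z' n.+1 ->
  (exists W, trap S Z Z' n.+1 W) \/ (exists W, trap S Z' Z n.+1 W).
Proof.
move=> nR Rn1.
have PS := named_S HN; have PZ := named_Z HN; have PZ' := named_Z' HN.
have [S1Z S1Z' _] := Rn1; have nbS1 := S_move HN S1Z S1Z'.
have [PS1 S1S SS1] := nbS1.
have [PS2 S2S1 S2Z S2Z' S12] := running_third HN Rn1.
have [[PS2' S2S]|//|//] := P_succ HN PS2.
have [[D [nbD DS1]]|noD] := pselect (exists D, special_nbr S n D /\ D <> S n.+1);
  last first.
  left; exists [set x | ~ S n x /\ ~ S n.+1 x]; split=> //.
  - split=> [x []//|x y xy [Sx S1x]|x y [Sx S1x] xy].
      split=> Sy; first by apply: Sx; apply: (class_sat' (PS n)) Sy; apply: cls_le xy.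
      by apply: S1x; exact: (class_sat' (PS n.+1) xy Sy).
    have [Sy|Sy] := pselect (S n.+1 y); [by right | left; split=> // Sy'].
    apply: noD; exists (cls n x); have xcl := cls_id phi n x.
    split; last by move=> e; apply: S1x; rewrite -e.
    split; [exact: P_cls | by move=> e; apply: Sx; rewrite -e | exact: nbr_cls Sy' xy].
  - move=> x S2x; split=> [Sx|S1x]; first by apply: S2S; exact: (P_eq PS2' (PS n) S2x Sx).
    by apply: S2S1; exact: (P_eq PS2 (PS n.+1) S2x S1x).
  - by move=> x Zx [Sx _]; apply: Sx; exact: (named_sub HN Zx).
have [PD DS SD] := nbD; have PD1 := P_up HN PD DS.
have [DZ|DZ] := pselect (adj D (Z n.+1)); last first.
  by left; apply: (trap_start1 HN nR Rn1 nbD DS1 DZ); case: (adj_split HN (adj_sym SD)).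
have [DZ'|DZ'] := pselect (adj D (Z' n.+1)); last first.
  right; apply: (trap_start1 (named_swap HN) _ _ nbD DS1 DZ') => //.
    by move=> /running_swap.
  exact: running_swap.
have no E x : P n.+1 E -> D x -> near x E -> E <> D -> E <> Z n.+1 -> E <> Z' n.+1 ->
  False.
  move=> PE Dx xE ED EZ EZ'.
  apply: (@no4 v3 n.+1 x D (Z n.+1) (Z' n.+1) E) => //; try exact/nesym.
  - exact/hit_in.
  - exact/hit_near/(near_ns HN PD1 DS1 (PZ n.+1)).
  - exact/hit_near/(near_ns HN PD1 DS1 (PZ' n.+1)).
  - exact/hit_near.
  - exact: (P_neqZ HN).
  - exact: (P_neqZ' HN).
  - exact: (Z_neq HN).
have S2D : S n.+2 <> D.
  move=> e; have [x Dx xS] : adj D (S n.+1) by rewrite -e; apply: adj_sym.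
  by apply: (no (S n.+1) x); rewrite // => ?; apply: DS1.
left; exists [set x | [/\ ~ S n x, ~ S n.+1 x & ~ D x]]; split=> //.
- split=> [x []//|x y xy [Sx S1x Dx]|x y [Sx S1x Dx] xy].
    split=> Sy; first by apply: Sx; apply: (class_sat' (PS n)) Sy; apply: cls_le xy.
      by apply: S1x; exact: (class_sat' (PS n.+1) xy Sy).
    by apply: Dx; exact: (class_sat' PD1 xy Sy).
  have [Sy|Sy] := pselect (S n.+1 y); [by right | left].
  have xcl := cls_id phi n x; have xcl1 := cls_id phi n.+1 x.
  split=> // [Sy'|Dy].
    have e : cls n x <> S n by move=> e; apply: Sx; rewrite -e.
    have [e1|e1|e1] := few_special_nbr HN nR nbS1 nbD (And3 (P_cls _ _ _) e (nbr_cls n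
      Sy' xy)).
    + by apply: DS1.
    + by apply: S1x; rewrite e1.
    + by apply: Dx; rewrite e1.
  apply: (no (cls n.+1 x) y (P_cls _ _ _) Dy); first by exists x; rewrite // nbr_sym.
  + by move=> e; apply: Dx; rewrite -e.
  + by move=> e; apply: Sx; apply: (named_sub HN); rewrite -e.
  + by move=> e; apply: Sx; apply: (named_sub' HN); rewrite -e.
- move=> x S2x; split=> [Sx|S1x|Dx]; first by apply: S2S;
    exact: (P_eq PS2' (PS n) S2x Sx).
    by apply: S2S1; exact: (P_eq PS2 (PS n.+1) S2x S1x).
  by apply: S2D; exact: (P_eq PS2 PD1 S2x Dx).
- by move=> x Zx [Sx _ _]; apply: Sx; exact: (named_sub HN Zx).
Qed.

(** A run has a starting radius, which is not 0 because [S 0] is [Z 0] or [Z' 0]; a trap is found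
    there. *)
Lemma running_stops S Z Z' (HN : named phi S Z Z') n :
    (forall v n, exists k, n <= k /\ S k v) -> ~ forall m, n <= m -> running S Z Z' m.
Proof.
move=> U; elim: n => [|n IH] Rm.
  by have [SZ SZ' _] := Rm 0 isT; case: (named_S0 HN).
have [Rn|nR] := pselect (running S Z Z' n).
  by apply: IH => m; rewrite leq_eqVlt => /orP [/eqP <-//|]; apply: Rm.
have [[W tW]|[W tW]] := trap_start HN nR (Rm _ (leqnn _)).
  exact: trap_escape HN _ _ U tW Rm.
by apply: (trap_escape (named_swap HN) U tW) => m /Rm /running_swap.
Qed.

(* The component of the cycle cannot consist of a single class. *)
Lemma link_exit S Z Z' (HN : named phi S Z Z') n D E :
    special_nbr S n D -> special_nbr S n E -> D <> E -> link S n D E ->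
  exists F, [/\ P n F, F <> S n, F <> D & adj D F].
Proof.
move=> [PD DS SD] [PE ES SE] DE ln; have PS := named_S HN.
apply: contrapT => h; apply: DE; have [z Ez] := P_inh PE.
apply: (P_eq PD PE _ Ez); apply: ln Ez => //; split=> [x Dx Sx|x y|x y Dx xy].
- by apply: DS; exact: (P_eq PD (PS n) Dx Sx).
- exact: class_sat.
- have ycl := cls_id phi n y.
  have [e|e] := pselect (cls n y = S n); first by right; rewrite -e.
  have [e'|e'] := pselect (cls n y = D); first by left; rewrite -e'.
  case: h; exists (cls n y); split=> //; first exact: P_cls.
  by exists x => //; apply: nbr_near.
Qed.

(** At the smaller radius [S n.+1] is an ordinary class attached to [W] and [S n] is the removed
    one. This carries [link] from radius n to n + 1. *)
Lemma closed_back S Z Z' (HN : named phi S Z Z') n W :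
    P n (S n.+1) -> running S Z Z' n.+1 -> closed_off S n.+1 W -> S n.+2 `<=` W ->
  closed_off S n [set x | (W x \/ S n.+1 x) /\ ~ S n x].
Proof.
move=> PS1 Rn1 [Wd Ws Wn] SW; have PS := named_S HN.
split=> [x []//|x x' xx [Wx Sx]|x x' [Wx Sx] xx].
  split; last by move=> Sx'; apply: Sx; exact: (class_sat' (PS n) xx Sx').
  case: Wx => [Wx|S1x]; last by right; exact: (class_sat PS1 xx S1x).
  by left; apply: (Ws x) => //; have := xx; rewrite (named_nonspecial HN).
have [Sx'|Sx'] := pselect (S n x'); [by right | left; split=> //].
case: Wx => [Wx|S1x]; first exact: Wn Wx xx.
have x'cl := cls_id phi n.+1 x'.
have Sc : adj (S n.+1) (cls n.+1 x') by exists x => //; apply: nbr_near.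
have [e|e|e|e] := running_nbr HN Rn1 (P_cls _ _ _) Sc.
- by right; rewrite -e.
- by case: Sx'; apply: (named_sub HN); rewrite -e.
- by case: Sx'; apply: (named_sub' HN); rewrite -e.
- by left; apply: SW; rewrite -e.
Qed.

(* S n.+1 lies on a cycle through S n and Z' n: S then runs along this cycle
   forever. *)
Lemma run_cycle_step S Z Z' (HN : named phi S Z Z') n :
    running S Z Z' n -> link S n (S n.+1) (Z' n) ->
  running S Z Z' n.+1 /\ link S n.+1 (S n.+2) (Z' n.+1).
Proof.
move=> Rn ln.
have PS := named_S HN; have PZ := named_Z HN; have PZ' := named_Z' HN.
have [PS1 S1S S1Z S1Z' SS1] := running_third HN Rn.
have [_ SZ' _] := Rn.
have nbZ : special_nbr S n (Z' n).
  split=> //; first exact/nesym.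
  by have [x Zx] := P_inh (PZ' n.+1); exists x;
    [exact: (named_sub' HN Zx) | exact: (near_Z' HN Zx)].
have [E [PE ES ES1 SE]] := link_exit HN (And3 PS1 S1S SS1) nbZ S1Z' ln.
have tE : third S Z Z' n.+1 E.
  by split=> //; [apply: (P_up HN) | apply: (P_neqZ HN) | apply: (P_neqZ' HN)].
have Rn1 : running S Z Z' n.+1.
  by split; [apply: (P_neqZ HN) | apply: (P_neqZ' HN) | exists E].
split=> // W Wc SW; have [_ _ Wn] := Wc.
have [z Zz] := P_inh (PZ' n.+1); have [y zy Zy] := near_Z' HN Zz.
have Wc' := closed_back HN PS1 Rn1 Wc SW.
have S1W : S n.+1 `<=` [set x | (W x \/ S n.+1 x) /\ ~ S n x].
  by move=> x S1x; split; [right | move=> Sx; apply: S1S;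
    exact: (P_eq PS1 (PS n) S1x Sx)].
have [[Wy|S1y] _] := ln _ Wc' S1W y Zy; last by case: S1Z';
  exact: (P_eq PS1 (PZ' n) S1y Zy).
have yz : z \in nbr y by rewrite nbr_sym.
have [Wz|S1z] := Wn y z Wy yz; first exact: (closed_class Wc (PZ' n.+1) Zz Wz).
by case: Rn1 => _ /(_ (P_eq (PS n.+1) (PZ' n.+1) S1z Zz)).
Qed.

Lemma run_cycle S Z Z' (HN : named phi S Z Z') n :
    (forall v n, exists k, n <= k /\ S k v) ->
  running S Z Z' n -> ~ link S n (S n.+1) (Z' n).
Proof.
move=> U Rn ln; apply: (running_stops HN U (n := n)) => m /subnK <-.
suff [] : running S Z Z' (m - n + n) /\
  link S (m - n + n) (S (m - n + n).+1) (Z' (m - n + n)) by [].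
by elim: (m - n) => // k [Rk lk]; rewrite !addSn; apply: run_cycle_step.
Qed.

End Running.
End Unbounded.

(** * Cycles exclude unbounded type *)

Section Cycles.
Local Open Scope classical_set_scope.
Context {d : nat} {T : regular_tree d} (phi : T -> bool).
Implicit Types (x y z : T) (n k m : nat) (D E F X Y W : set T).
Local Notation cls := (ball_class phi).
Local Notation P := (ball_classes phi).

Section NoCycle.
Hypothesis v3 : forall v n, valence phi n v <= 3.

(** Otherwise a run would start at radius n + 1, and the rest of the cycle would link [S n.+2] to
    [Z' n.+1] by way of [D], against [run_cycle]. *)
Lemma run_of_cycle S Z Z' (HN : named phi S Z Z') n D :
    (forall v n, exists k, n <= k /\ S k v) ->
    S n.+1 <> Z n.+1 -> S n.+1 <> Z' n.+1 ->
    special_nbr phi S n D -> D <> S n.+1 -> link phi S n (S n.+1) D ->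
  ~ adj D (Z' n.+1).
Proof.
move=> U S1Z S1Z' nbD DS1 ln [y Dy [z yz Zz]].
have PS := named_S HN; have PZ := named_Z HN; have PZ' := named_Z' HN.
have nbS1 := S_move HN S1Z S1Z'; have [PS1 S1S SS1] := nbS1; have [PD DS SD] := nbD.
have [E [PE ES ES1 SE]] := link_exit HN nbS1 nbD (nesym DS1) ln.
have tE : third phi S Z Z' n.+1 E.
  by split=> //; [apply: (P_up HN) | apply: (P_neqZ HN) | apply: (P_neqZ' HN)].
have Rn1 : running phi S Z Z' n.+1 by split; [| | exists E].
apply: (run_cycle v3 HN U Rn1).
move=> W Wc EW; have [Wd Ws Wn] := Wc.
have Wc' := closed_back v3 HN PS1 Rn1 Wc EW.
have S1W : S n.+1 `<=` [set x | (W x \/ S n.+1 x) /\ ~ S n x].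
  by move=> x S1x; split; [right | move=> Sx; apply: S1S;
    exact: (P_eq PS1 (PS n) S1x Sx)].
have [[Wy|S1y] _] := ln _ Wc' S1W y Dy; last by case: DS1; exact: (P_eq PD PS1 Dy S1y).
have [Wz|S1z] := Wn y z Wy yz; first exact: (closed_class Wc (PZ' n.+1) Zz Wz).
by case: S1Z'; exact: (P_eq (PS n.+1) (PZ' n.+1) S1z Zz).
Qed.

(** By [run_cycle] the cycle leaves [S n] through [Z n] and [Z' n]. After the splitting it runs
    through [Z n.+1], [S n.+1] and [Z' n.+1] in place of [S n]. *)
Lemma cycle_running S Z Z' (HN : named phi S Z Z') n :
    (forall v n, exists k, n <= k /\ S k v) -> running phi S Z Z' n ->
  special_cycle phi S n -> special_cycle phi S n.+1.
Proof.
move=> U Rn [D [E [nbD nbE DE ln]]].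
have PS := named_S HN; have PZ := named_Z HN; have PZ' := named_Z' HN.
have [SZ SZ' _] := Rn; have [PD DS SD] := nbD; have [PE ES SE] := nbE.
have [PS1 S1S S1Z S1Z' SS1] := running_third v3 HN Rn.
have nl : ~ link phi S n (S n.+1) (Z n) by apply: (run_cycle v3 (named_swap HN) U);
  apply: running_swap.
have nl' : ~ link phi S n (S n.+1) (Z' n) by apply: (run_cycle v3 HN U).
have ls X Y : P n X -> P n Y -> X <> S n -> Y <> S n -> link phi S n X Y ->
  link phi S n Y X.
  by move=> PX PY XS YS; apply: link_sym.
have lZ : link phi S n (Z n) (Z' n).
  have ln' := ls _ _ PD PE DS ES ln.
  have [eD|eD|eD|eD] := running_nbr v3 HN Rn PD SD; rewrite eD in DE DS ln ln' PD;
    first by [];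
  have [eE|eE|eE|eE] := running_nbr v3 HN Rn PE SE; rewrite eE in DE ES ln ln' PE => //.
(* [W0] contains the component of [S n.+1] but not [Z n]; leaving it out of [W] makes the connection
   from [Z n] to [Z' n] avoid [S n.+1]. *)
have [W0 [[W0c SW0] nW0]] : exists W0,
  (closed_off phi S n W0 /\ S n.+1 `<=` W0) /\ ~ Z n `<=` W0.
  apply: contrapT => h; apply: nl => W Wc SW; apply: contrapT => nW; apply: h;
    by exists W.
have ZW0 x : Z n x -> ~ W0 x by move=> Zx Wx; apply: nW0;
  exact: (closed_class W0c (PZ n) Zx Wx).
have Z1S1 : Z n.+1 <> S n.+1 by apply/nesym; exact: (P_neqZ HN).
have Z1S1' : Z' n.+1 <> S n.+1 by apply/nesym; exact: (P_neqZ' HN).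
exists (Z n.+1), (Z' n.+1); split.
- by split=> //; apply: (adj_S_Z HN).
- by split=> //; apply: (adj_S_Z' HN).
- exact: (Z_neq HN).
move=> W Wc ZW; have [Wd Ws Wn] := Wc; have [W0d W0s W0n] := W0c.
have Wc' : closed_off phi S n [set x | [/\ W x, ~ S n x & ~ W0 x]].
  split=> [x []//|x x' xx [Wx Sx W0x]|x x' [Wx Sx W0x] xx].
    have Sx' : ~ S n x' by move=> Sx'; apply: Sx; exact: (class_sat' (PS n) xx Sx').
    split=> //; first by apply: (Ws x) => //; have := xx; rewrite (named_nonspecial HN).
    by move=> W0x'; apply: W0x; apply: W0s W0x'; rewrite -(cls_eq xx); apply: cls_id.
  have [Sx'|Sx'] := pselect (S n x'); [by right | left].
  have nW0x' : ~ W0 x'.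
    by move=> W0x'; have x'x : x \in nbr x' by [rewrite nbr_sym];
      have [] := W0n _ _ W0x' x'x.
  by split=> //; have [//|/SW0] := Wn _ _ Wx xx.
have ZW' : Z n `<=` [set x | [/\ W x, ~ S n x & ~ W0 x]].
  have [z Zz] := P_inh (PZ n.+1); have [y zy Zy] := near_Z HN Zz.
  have [Wy|S1y] := Wn _ _ (ZW _ Zz) zy; last by case: S1Z;
    exact: (P_eq PS1 (PZ n) S1y Zy).
  have PZ1 : P n.+1 (Z n) by apply: (P_up HN) => //; apply/nesym.
  move=> x Zx; split; [exact: (closed_class Wc PZ1 Zy Wy) | | exact: ZW0].
  by move=> Sx; apply: SZ; exact: (P_eq (PS n) (PZ n) Sx Zx).
have [z Zz] := P_inh (PZ' n.+1); have [y zy Zy] := near_Z' HN Zz.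
have [Wy _ _] := lZ _ Wc' ZW' y Zy; have yz : z \in nbr y by rewrite nbr_sym.
have [Wz|S1z] := Wn _ _ Wy yz; first exact: (closed_class Wc (PZ' n.+1) Zz Wz).
by case: Z1S1'; exact: (P_eq (PZ' n.+1) (PS n.+1) Zz S1z).
Qed.

(** [S n] has at most two neighbors here, so the cycle uses [S n.+1] and one other class, which sees
    one of the halves. *)
Lemma no_cycle_moving S Z Z' (HN : named phi S Z Z') n :
    (forall v n, exists k, n <= k /\ S k v) -> ~ running phi S Z Z' n ->
    S n.+1 <> Z n.+1 -> S n.+1 <> Z' n.+1 ->
  ~ special_cycle phi S n.
Proof.
move=> U nR S1Z S1Z' [D [E [nbD nbE DE ln]]].
have PS := named_S HN; have nbS1 := S_move HN S1Z S1Z'.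
suff no X : special_nbr phi S n X -> X <> S n.+1 -> ~ link phi S n (S n.+1) X.
  have [PD DS SD] := nbD; have [PE ES SE] := nbE.
  have [e|e|//] := few_special_nbr v3 HN nR nbS1 nbD nbE.
    by rewrite -e in ln DE; apply: no ln => //; apply/nesym.
  by apply: (no D) => //; rewrite e //; apply: link_sym.
move=> nbX XS1 lX; have [_ _ SX] := nbX.
have [XZ|XZ] := adj_split HN (adj_sym SX).
  exact: (run_of_cycle (named_swap HN) U S1Z' S1Z nbX XS1 lX XZ).
exact: (run_of_cycle HN U S1Z S1Z' nbX XS1 lX XZ).
Qed.

(** In the cycle [S n] is replaced by its two adjacent halves, one of which is [S n.+1]. At radius n
    + 1 there is no run, and [S n.+2] is not a half because the halves of [S n.+1] are not adjacent;
    so [no_cycle_moving] applies there. *)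
Lemma no_cycle_static1 S Z Z' (HN : named phi S Z Z') n D E :
    (forall v n, exists k, n <= k /\ S k v) ->
    S n.+1 = Z n.+1 -> special_nbr phi S n D -> special_nbr phi S n E ->
    adj D (Z n.+1) -> adj E (Z' n.+1) -> link phi S n D E ->
  False.
Proof.
move=> U S1 [PD DS SD] [PE ES SE] DZ EZ ln.
have PS := named_S HN; have PZ := named_Z HN; have PZ' := named_Z' HN.
have PD1 := P_up HN PD DS.
have DS1 : D <> S n.+1 by rewrite S1; exact: (P_neqZ HN).
have S1D : adj (S n.+1) D by rewrite S1; apply: adj_sym.
have DZ1 : D <> Z n.+1 := P_neqZ HN PD.
have DZ1' : D <> Z' n.+1 := P_neqZ' HN PD.
have Z1' : Z' n.+1 <> S n.+1 by rewrite S1; apply/nesym/(Z_neq HN).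
have nZZ : ~ adj (Z' n.+2) (Z n.+2).
  move=> [x Zx xZ].
  apply: (@no4 _ _ phi v3 n.+2 x (Z' n.+2) (Z n.+2) (Z' n.+1) D) => //.
  - exact: (P_up HN).
  - exact: (P_up HN).
  - exact: hit_in.
  - exact: hit_near.
  - exact/hit_near/(near_Z' HN).
  - by apply/hit_near/(near_S HN PD1) => //; apply: (named_sub' HN).
  - exact/nesym/(Z_neq HN).
  - exact/nesym/(P_neqZ' HN).
  - exact/nesym/(P_neqZ' HN).
  - exact/nesym/(P_neqZ HN).
  - exact/nesym/(P_neqZ HN).
  - exact/nesym.
apply: (@no_cycle_moving S Z Z' HN n.+1) => //.
- by case.
- by move=> e; apply: nZZ; apply: adj_sym; rewrite -e; apply: (adj_S_Z' HN).
- by move=> e; apply: nZZ; rewrite -e; apply: (adj_S_Z HN).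
exists D, (Z' n.+1); split=> //.
  by split=> //; apply: (adj_S_Z' HN).
move=> W Wc DW; have [Wd Ws Wn] := Wc.
have Wc' : closed_off phi S n [set x | W x /\ ~ S n x].
  split=> [x []//|x x' xx [Wx Sx]|x x' [Wx Sx] xx].
    split; last by move=> Sx'; apply: Sx; exact: (class_sat' (PS n) xx Sx').
    by apply: (Ws x) => //; have := xx; rewrite (named_nonspecial HN).
  have [Sx'|Sx'] := pselect (S n x'); [by right | left; split=> //].
  by have [//|] := Wn _ _ Wx xx; rewrite S1 => /(named_sub HN).
have DW' : D `<=` [set x | W x /\ ~ S n x].
  by move=> x Dx; split; [apply: DW | move=> Sx; apply: DS;
    exact: (P_eq PD (PS n) Dx Sx)].
have [y Ey [z yz Zz]] := EZ; have [Wy _] := ln _ Wc' DW' y Ey.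
have [Wz|S1z] := Wn _ _ Wy yz; first exact: (closed_class Wc (PZ' n.+1) Zz Wz).
by case: Z1'; exact: (P_eq (PZ' n.+1) (PS n.+1) Zz S1z).
Qed.

(** A neighbor of [S n] on the cycle also sees a further class there, so it sees only one half. If
    both neighbors saw the same half, a vertex of this half would meet four classes. *)
Lemma no_cycle_static S Z Z' (HN : named phi S Z Z') n :
    (forall v n, exists k, n <= k /\ S k v) ->
    S n.+1 = Z n.+1 -> ~ special_cycle phi S n.
Proof.
move=> U S1 [D [E [nbD nbE DE ln]]].
have PS := named_S HN; have PZ := named_Z HN; have PZ' := named_Z' HN.
have [PD DS SD] := nbD; have [PE ES SE] := nbE.
have ln' : link phi S n E D by apply: link_sym.
have one X Y : special_nbr phi S n X -> special_nbr phi S n Y -> X <> Y ->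
  link phi S n X Y ->
    adj X (Z n.+1) -> adj X (Z' n.+1) -> False.
  move=> nbX nbY XY lXY XZ XZ'; have [PX XS _] := nbX; have [x Xx] := P_inh PX.
  have XS1 : X <> S n.+1 by rewrite S1; exact: (P_neqZ HN).
  have [F [PF FS FX XF]] := link_exit HN nbX nbY XY lXY; have PX1 := P_up HN PX XS.
  apply: (@no4 _ _ phi v3 n.+1 x X (Z n.+1) (Z' n.+1) F) => //.
  - exact: (P_up HN).
  - exact: hit_in.
  - by apply/hit_near/(near_ns HN PX1).
  - by apply/hit_near/(near_ns HN PX1).
  - by apply/hit_near/(near_ns HN PX).
  - exact: (P_neqZ HN).
  - exact: (P_neqZ' HN).
  - exact/nesym.
  - exact: (Z_neq HN).
  - exact/nesym/(P_neqZ HN).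
  - exact/nesym/(P_neqZ' HN).
have PD1 := P_up HN PD DS; have PE1 := P_up HN PE ES.
have nS X : P n X -> X <> S n.+1 by rewrite S1 => PX; exact: (P_neqZ HN PX).
have nZ X : P n X -> adj X (Z n.+1) -> adj (S n.+1) X by rewrite S1 => _; apply: adj_sym.
have [DZ|DZ] := adj_split HN (adj_sym SD); have [EZ|EZ] := adj_split HN (adj_sym SE).
- have [x Zx] := P_inh (PZ' n.+2); have S1x := named_sub' HN Zx.
  apply: (@no4 _ _ phi v3 n.+1 x (Z n.+1) (Z' n.+1) D E) => //.
  + by apply: hit_in; rewrite -S1.
  + exact/hit_near/(near_Z' HN).
  + by apply/hit_near/(near_S HN PD1) => //;
      [apply: (P_neqZ HN) | apply: (P_neqZ' HN) | apply: nZ].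
  + by apply/hit_near/(near_S HN PE1) => //;
      [apply: (P_neqZ HN) | apply: (P_neqZ' HN) | apply: nZ].
  + exact: (Z_neq HN).
  + exact/nesym/(P_neqZ HN).
  + exact/nesym/(P_neqZ HN).
  + exact/nesym/(P_neqZ' HN).
  + exact/nesym/(P_neqZ' HN).
- exact: (no_cycle_static1 HN U S1 nbD nbE DZ EZ ln).
- exact: (no_cycle_static1 HN U S1 nbE nbD EZ DZ ln').
- have [x Zx] := P_inh (PZ' n.+1).
  have ZS1 : Z' n.+1 <> S n.+1 by rewrite S1; apply/nesym/(Z_neq HN).
  have nr Y : P n.+1 Y -> adj (Z' n.+1) Y -> near x Y by move=> PY ZY;
    apply: (near_ns HN (PZ' _) ZS1).
  apply: (@no4 _ _ phi v3 n.+1 x (Z' n.+1) (Z n.+1) D E) => //.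
  + exact: hit_in.
  + by apply/hit_near/nr => //; rewrite -S1; apply: adj_sym; apply: (adj_S_Z' HN).
  + by apply/hit_near/nr => //; apply: adj_sym.
  + by apply/hit_near/nr => //; apply: adj_sym.
  + exact/nesym/(Z_neq HN).
  + exact/nesym/(P_neqZ' HN).
  + exact/nesym/(P_neqZ' HN).
  + exact/nesym/(P_neqZ HN).
  + exact/nesym/(P_neqZ HN).
Qed.

(** A cycle through [S n] forces a run, and a run keeps the cycle, so it would never stop. *)
Lemma no_special_cycle S Z Z' (HN : named phi S Z Z') n :
  (forall v n, exists k, n <= k /\ S k v) -> ~ special_cycle phi S n.
Proof.
move=> U cn; have run m : special_cycle phi S m -> running phi S Z Z' m.
  move=> cm; apply: contrapT => nR.
  have [e|e] := pselect (S m.+1 = Z m.+1); first exact: (no_cycle_static HN U e cm).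
  have [e'|e'] := pselect (S m.+1 = Z' m.+1);
    first exact: (no_cycle_static (named_swap HN) U e' cm).
  exact: (no_cycle_moving HN U nR e e' cm).
apply: (running_stops v3 HN U (n := n)) => m /subnK <-; apply: (run).
by elim: (m - n) => // k ck; rewrite addSn; apply: (cycle_running HN U (run _ ck)).
Qed.

End NoCycle.

Lemma Gedge_adj n D E : `[< Gedge phi n D E >] -> [/\ P n D, P n E & adj D E].
Proof.
move=> /asboolP [x [y [xy <- <-]]]; split; try exact: P_cls.
by exists x; [apply: cls_id | apply: nbr_near].
Qed.

Lemma Gedge_of n x y : y \in nbr x -> `[< Gedge phi n (cls n x) (cls n y) >].
Proof. by move=> xy; apply/asboolP; exists x, y. Qed.

Lemma adj_Gedge n D E : P n D -> P n E -> adj D E -> `[< Gedge phi n D E >].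
Proof.
move=> PD PE [x Dx [y xy Ey]]; apply/asboolP; exists x, y.
by rewrite -(P_of PD Dx) -(P_of PE Ey).
Qed.

Lemma path_closed S n W p D : closed_off phi S n W -> D `<=` W -> S n \notin p ->
  P n (S n) ->
  path (fun D E => `[< Gedge phi n D E >]) D p -> last D p `<=` W.
Proof.
move=> Wc + + PS; elim: p D => [//|E p IH] D DW /=; rewrite in_cons => /norP [SE Sp].
move=> /andP [/Gedge_adj [PD PE [x Dx [y xy Ey]]] Ep]; apply: IH Ep => //.
have [_ _ Wn] := Wc; have [Wy|Sy] := Wn _ _ (DW _ Dx) xy;
  first exact: (closed_class Wc PE Ey Wy).
by case/eqP: SE; exact: (P_eq PS PE Sy Ey).
Qed.

(** On a cycle avoiding [S n], each class meets itself and its two neighbors on the cycle, hence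
    nothing else; the cycle would then contain the class of every vertex. *)
Lemma special_cycle_of S Z Z' (HN : named phi S Z Z') n :
    (forall v n, valence phi n v <= 3) ->
  G_has_cycle phi n -> special_cycle phi S n.
Proof.
move=> v3 [c [c3 /andP [cc cu]]]; have PS := named_S HN.
have rotE D : D \in c -> exists p, [/\ size p = (size c).-1, uniq (D :: p),
    path (fun D E => `[< Gedge phi n D E >]) D (rcons p D) & D :: p =i c].
  move=> Dc; have [i p e] := rot_to Dc; exists p; split.
  - by rewrite -(size_rot i c) e.
  - by rewrite -e rot_uniq.
  - by move: cc; rewrite -(rot_cycle i) e.
  - by rewrite -e; apply: mem_rot.
have Sc : S n \in c.
  apply: contrapT => Sc; have [x0 x0c] : exists x, cls n x \in c.
    have [D Dc] : exists D, D \in c by case: (c) c3 => // D c' _; exists D;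
      apply: mem_head.
    have PD : P n D.
      by have [p [_ _ pp _]] := rotE D Dc; case: p pp => [|E p] /= /andP [/Gedge_adj []].
    by have [x Dx] := P_inh PD; exists x; rewrite -(P_of PD Dx).
  suff all y : cls n y \in c.
    by have [s Ss] := P_inh (PS n); apply: Sc; rewrite (P_of (PS n) Ss).
  apply: (@nbr_ind _ _ (fun y => cls n y \in c) x0 x0c) => x {}y xc xy.
  apply: contrapT => yc; have [p [ps pu pp pc]] := rotE _ xc.
  have DS : cls n x <> S n by move=> e; apply: Sc; rewrite -e.
  case: p ps pu pp pc => [|a p] ps pu pp pc; first by move: ps c3;
    case: (size c) => // [[]].
  case/lastP: p ps pu pp pc => [|p b] ps pu pp pc.
    by move: ps c3; case: (size c) => // [[|[]]].
  move: pp; rewrite /= rcons_path last_rcons =>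
    /andP [/Gedge_adj [_ Pa xa] /andP [_ /Gedge_adj [Pb _ bx]]].
  have xna : cls n x <> a by move=> e; move: pu; rewrite e cons_uniq in_cons eqxx.
  have xnb : cls n x <> b.
    by move=> e; move: pu; rewrite e cons_uniq in_cons mem_rcons in_cons eqxx !orbT.
  have anb : a <> b by move=> e; move: pu;
    rewrite e !cons_uniq mem_rcons in_cons eqxx andbF.
  have ny E : E \in [:: cls n x, a & rcons p b] -> E <> cls n y by rewrite pc => Ec e;
    apply: yc; rewrite -e.
  apply: (@no4 _ _ phi v3 n x (cls n x) a b (cls n y)) => //; try exact: P_cls.
  - by apply: hit_in; apply: cls_id.
  - by apply/hit_near/(near_ns HN (P_cls _ _ _) DS Pa xa)/cls_id.
  - by apply/hit_near/(near_ns HN (P_cls _ _ _) DS Pb (adj_sym bx))/cls_id.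
  - exact/hit_near/nbr_near.
  - by apply: ny; rewrite mem_head.
  - by apply: ny; rewrite !in_cons eqxx orbT.
  - by apply: ny; rewrite !in_cons mem_rcons in_cons eqxx !orbT.
have [p [ps pu pp pc]] := rotE _ Sc.
case: p ps pu pp {pc} => [|a p] ps pu pp; first by move: ps c3; case: (size c) => // [[]].
case/lastP: p ps pu pp => [|p b] ps pu pp; first by move: ps c3;
  case: (size c) => // [[|[]]].
move: pp; rewrite rcons_cons /= rcons_path last_rcons =>
  /andP [/Gedge_adj [_ Pa Sa] /andP [ap /Gedge_adj [Pb _ bS]]].
have Sna : S n <> a by move=> e; move: pu; rewrite e cons_uniq in_cons eqxx.
have Snb : S n <> b.
  by move=> e; move: pu; rewrite e cons_uniq in_cons mem_rcons in_cons eqxx !orbT.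
have anb : a <> b by move=> e; move: pu;
  rewrite e !cons_uniq mem_rcons in_cons eqxx andbF.
have Snp : S n \notin rcons p b.
  by move: pu; rewrite cons_uniq in_cons negb_or => /andP [/andP []].
exists a, b; split=> //.
- by split=> //; apply/nesym.
- by split=> //; [apply/nesym | apply: adj_sym].
move=> W Wc aW; rewrite -(last_rcons a p b); exact: (path_closed Wc aW Snp (PS n) ap).
Qed.

(** The vertices whose class is joined to [D] by a path avoiding [S n] form a closed-off set, so
    [link] yields such a path to [E]. *)
Lemma cycle_of_special S Z Z' (HN : named phi S Z Z') n :
  special_cycle phi S n -> G_has_cycle phi n.
Proof.
move=> [D [E [[PD DS SD] [PE ES SE] DE ln]]]; have PS := named_S HN.
pose e := fun D E => `[< Gedge phi n D E >].
pose W := [set x | exists p, [/\ path e D p, last D p = cls n x & S n \notin D :: p]].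
have SnD : S n \notin [:: D] by rewrite mem_seq1; apply/eqP/nesym.
have Wc : closed_off phi S n W.
  split=> [x [p [_ px /negP Sp]] Sx|x y /cls_eq xy [p [pD px Sp]]|x y [p [pD px Sp]] xy].
  - by apply: Sp; rewrite (P_of (PS n) Sx) -px mem_last.
  - by exists p; rewrite -xy.
  - have [Sy|nSy] := pselect (S n y); [by right | left].
    exists (rcons p (cls n y)); split; last 1 first.
    + rewrite -rcons_cons mem_rcons in_cons negb_or Sp andbT; apply/eqP => eS.
      by apply: nSy; rewrite eS; apply: cls_id.
    + by rewrite rcons_path pD px; apply: Gedge_of.
    + by rewrite last_rcons.
have DW : D `<=` W by move=> x Dx; exists [::]; rewrite -(P_of PD Dx).
have [z Ez] := P_inh PE; have [p [pD pz Sp]] := ln W Wc DW z Ez.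
rewrite -(P_of PE Ez) in pz; move: pz; case/shortenP: pD => q qD qu qp qE.
exists (S n :: D :: q); split.
  by case: q qD qu qp qE => //= _ _ _ /DE.
apply/andP; split.
  rewrite /= rcons_path qD qE; apply/and3P; split=> //; first exact: adj_Gedge.
  exact: adj_Gedge (adj_sym _).
rewrite cons_uniq qu andbT; apply: contra Sp; rewrite !in_cons.
by case/orP=> [->//|/qp ->]; rewrite orbT.
Qed.

End Cycles.

(** * Acyclic graphs *)

Section Acyclic.
Local Open Scope classical_set_scope.
Context {d : nat} {T : regular_tree d} (phi : T -> bool).
Implicit Types (x y z : T) (n k m : nat) (D E F X Y W : set T).
Local Notation cls := (ball_class phi).
Local Notation P := (ball_classes phi).
Hypothesis acyclic : forall n, ~ G_has_cycle phi n.

Lemma no_triangle n D1 D2 D3 : P n D1 -> P n D2 -> P n D3 ->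
  D1 <> D2 -> D1 <> D3 -> D2 <> D3 -> adj D1 D2 -> adj D2 D3 -> adj D3 D1 -> False.
Proof.
move=> P1 P2 P3 n12 n13 n23 a12 a23 a31; apply: (@acyclic n).
exists [:: D1; D2; D3]; split=> //; apply/andP; split.
  by rewrite /= !(adj_Gedge (n := n)).
rewrite !cons_uniq !in_cons !negb_or.
by do ![apply/andP; split]; rewrite ?in_nil //; case: pselect.
Qed.

Lemma no_square n D1 D2 D3 D4 : P n D1 -> P n D2 -> P n D3 -> P n D4 ->
  D1 <> D2 -> D1 <> D3 -> D1 <> D4 -> D2 <> D3 -> D2 <> D4 -> D3 <> D4 ->
  adj D1 D2 -> adj D2 D3 -> adj D3 D4 -> adj D4 D1 -> False.
Proof.
move=> P1 P2 P3 P4 n12 n13 n14 n23 n24 n34 a12 a23 a34 a41; apply: (@acyclic n).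
exists [:: D1; D2; D3; D4]; split=> //; apply/andP; split.
  by rewrite /= !(adj_Gedge (n := n)).
rewrite !cons_uniq !in_cons !negb_or.
by do ![apply/andP; split]; rewrite ?in_nil //; case: pselect.
Qed.

(** Otherwise [D], the two halves and [S n.+1] form a square, or a triangle if [S n.+1] is a
    half. *)
Lemma adj_both S Z Z' (HN : named phi S Z Z') n D : P n D -> D <> S n ->
  adj D (Z n.+1) -> adj D (Z' n.+1) -> D = S n.+1.
Proof.
move=> PD DS DZ DZ'; apply: contrapT => DS1.
have PS := named_S HN; have PZ := named_Z HN; have PZ' := named_Z' HN.
have PD1 := P_up HN PD DS; have d1 := P_neqZ HN PD; have d2 := P_neqZ' HN PD.
have ZZ := Z_neq HN (n := n.+1).
have SZ := adj_S_Z HN n; have SZ' := adj_S_Z' HN n.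
have [e|e] := pselect (S n.+1 = Z n.+1).
  apply: (no_triangle (PZ n.+1) (PZ' n.+1) PD1) => //; try exact/nesym.
    by rewrite -e.
  exact: adj_sym.
have [e'|e'] := pselect (S n.+1 = Z' n.+1).
  apply: (no_triangle (PZ n.+1) (PZ' n.+1) PD1) => //; try exact/nesym.
    by rewrite -e'; apply: adj_sym.
  exact: adj_sym.
apply: (no_square (PZ n.+1) PD1 (PZ' n.+1) (PS n.+1)) => //; try exact/nesym.
  exact: adj_sym.
exact: adj_sym.
Qed.

Lemma adj_split_special S Z Z' (HN : named phi S Z Z') n : adj (Z n.+1) (Z' n.+1) ->
  S n.+1 = Z n.+1 \/ S n.+1 = Z' n.+1.
Proof.
move=> ZZ'; apply: contrapT => h.
apply: (no_triangle (named_Z HN n.+1) (named_Z' HN n.+1) (named_S HN n.+1)) => //.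
- exact: (Z_neq HN).
- by move=> e; apply: h; left.
- by move=> e; apply: h; right.
- exact/adj_sym/(adj_S_Z' HN).
- exact: (adj_S_Z HN).
Qed.

Lemma link_eq S Z Z' (HN : named phi S Z Z') n D E :
  special_nbr phi S n D -> special_nbr phi S n E -> link phi S n D E -> D = E.
Proof.
move=> nbD nbE ln; apply: contrapT => DE; apply: (@acyclic n).
by apply: (cycle_of_special HN); exists D, E.
Qed.

Lemma link_trans S n D E F : link phi S n D E -> link phi S n E F -> link phi S n D F.
Proof. by move=> DE EF W Wc /(DE _ Wc) /(EF _ Wc). Qed.

Local Notation V S Z n := (eg_vert (Gext phi S Z n)).

(** After its last visit to [S n], a path of G^Z_n enters a class seen by [Z n.+1] and remains in
    its component. *)
Lemma V_link S Z Z' (HN : named phi S Z Z') n X : V S Z n X -> X <> S n ->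
  exists D, [/\ special_nbr phi S n D, adj D (Z n.+1) & link phi S n D X].
Proof.
move=> VX XS.
suff [//|//] : X = S n \/ exists D, [/\ special_nbr phi S n D,
  adj D (Z n.+1) & link phi S n D X].
move: X VX {XS}; apply: (V_ind HN) => [|X Y VX IH PY XY]; first by left.
have [YS|YS] := pselect (Y = S n); [by left | right].
have [XS|XS] := pselect (X = S n).
  rewrite XS row_S in XY; exists Y; split=> //; last exact: adj_sym.
  by split=> //; apply: adj_sub XY => x; exact: (named_sub HN).
case: IH => [//|[D [nbD DZ ln]]]; exists D; split=> //; apply: link_trans ln _ => W Wc XW.
rewrite row_ns // in XY; have [x Xx [y xy Yy]] := XY; have [_ _ Wn] := Wc.
have [Wy|Sy] := Wn _ _ (XW _ Xx) xy; first exact: (closed_class Wc PY Yy Wy).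
by case: YS; exact: (P_eq PY (named_S HN n) Yy Sy).
Qed.

Section Letter.
Context {S Z Z' : nat -> set T} (HN : named phi S Z Z').
Let PS := named_S HN.
Let PZ := named_Z HN.
Let PZ' := named_Z' HN.

Lemma V_adj n X : V S Z n X -> X <> S n -> adj X (S n) -> adj X (Z n.+1).
Proof.
move=> VX XS /adj_sym SX; have [D [nbD DZ ln]] := V_link HN VX XS.
by rewrite -(link_eq HN nbD _ ln) //; split=> //; apply: (V_P HN VX).
Qed.

(** A class of G^Z_n next to [S n] sees [Z n.+1], and only [S n.+1] sees both halves. For [X = S n],
    adjacent halves would force [S n.+1] to be one of them. *)
Lemma V_no_cross n X x : V S Z n X -> row S Z n X x -> X <> S n.+1 ->
    (X = S n -> S n.+1 <> Z n.+1 /\ S n.+1 <> Z' n.+1) ->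
  ~ near x (Z' n.+1).
Proof.
move=> VX Xx XS1 XS xZ'; have [e|XnS] := pselect (X = S n).
  have [h1 h2] := XS e; rewrite e row_S in Xx.
  by have [|] := adj_split_special HN (ex_intro2 _ _ x Xx xZ').
rewrite row_ns // in Xx; apply: XS1.
have XZ' : adj X (Z' n.+1) by exists x.
apply: (adj_both HN) => //; first exact: (V_P HN VX).
apply: (V_adj VX XnS); exists x => //; apply: near_sub xZ' => y; exact: (named_sub' HN).
Qed.

Lemma V_meet n X : V S Z n X -> V S Z' n X -> X = S n \/
  (exists D, [/\ special_nbr phi S n D, D = S n.+1 & link phi S n D X]).
Proof.
move=> VX VX'; have [?|XS] := pselect (X = S n); [by left | right].
have [D [nbD DZ ln]] := V_link HN VX XS.
have [E [nbE EZ' ln']] := V_link (named_swap HN) VX' XS.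
have [PD DS _] := nbD; have [PE ES _] := nbE; have PX := V_P HN VX.
have DE : D = E.
  by apply: (link_eq HN nbD nbE); apply: link_trans ln _; apply: link_sym.
by exists D; split=> //; apply: (adj_both HN) => //; rewrite DE.
Qed.

Lemma V_cross_row n X x : ~ full S Z Z' n.+1 -> V S Z n X ->
  row S Z n.+1 (row S Z n X) x -> ~ near x (Z' n.+1).
Proof.
move=> nf VX xX; have [e|e] := pselect (row S Z n X = S n.+1).
  by rewrite e row_S in xX => xZ'; apply: nf; right; exists x.
rewrite row_ns // in xX; apply: (V_no_cross VX) => //.
  move=> e1; apply: e; rewrite row_ns // => e2.
  have [[_ h]|h|h] := P_succ HN (PS n.+1); first by apply: h; rewrite -e1.
    by apply: (P_neqZ HN (PS n)); rewrite -[LHS]e2 e1.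
  by apply: (P_neqZ' HN (PS n)); rewrite -[LHS]e2 e1.
by move=> eX; split=> h; [apply: e; rewrite eX row_S | apply: nf; left].
Qed.

(** Without [full] no path of G^Z_(n+1) crosses over to [Z' n.+1], so [row] carries paths in both
    directions. *)
Lemma V_row n : ~ full S Z Z' n.+1 -> V S Z n.+1 = row S Z n @` V S Z n.
Proof.
move=> nf.
have SU : (row S Z n @` V S Z n) (S n.+1).
  have [e|e] := pselect (S n.+1 = Z n.+1).
    by exists (S n); [apply: V_root | rewrite row_S].
  have e' : S n.+1 <> Z' n.+1 by move=> e'; apply: nf; left.
  have [PS1 S1S _] := S_move HN e e'.
  exists (S n.+1); last by rewrite row_ns.
  by apply: (V_step HN (V_root phi n) PS1); rewrite row_S; exact/adj_sym/(adj_S_Z HN).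
apply/seteqP; split=> [X' VX'|_ [X VX <-]].
  move: X' VX'; apply: (V_ind HN) => // X1 Y _ [X VX <-] PY [x xX xY].
  have [[PY' YS]|->|eY] := P_succ HN PY; last by rewrite eY in xY;
    case: (V_cross_row nf VX xX).
    exists Y; last by rewrite row_ns.
    by apply: (V_step HN VX PY'); exists x => //; exact: (row_sub HN xX).
  by exists (S n); [apply: V_root | rewrite row_S].
have VZ : V S Z n.+1 (Z n.+1).
  apply: (V_step HN (V_root phi _) (PZ _)); rewrite row_S.
  by have [z Zz] := P_inh (PZ n.+2); exists z => //; apply: (near_Z HN).
move: X VX; apply: (V_ind HN) => [|X1 Y VX1 IH PY XY]; first by rewrite row_S.
have [->|YS] := pselect (Y = S n); first by rewrite row_S.
rewrite [row S Z n Y]row_ns //.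
have PX1 := V_P HN VX1; have [x xX] := P_inh (P_row HN (P_row HN PX1)).
apply: (V_step HN IH (P_up HN PY YS)); exists x => //.
have [u Xu uY] := XY; exact: near_const (P_row HN PX1) PY Xu (row_sub HN xX) uY.
Qed.

Lemma iso_prev n : ~ full S Z Z' n.+1 -> eg_iso (Gext phi S Z n.+1) (Gext phi S Z n).
Proof.
move=> nf; apply: eg_iso_sym; first exact: (inhabits setT).
apply: (row_iso HN); last exact: V_row.
by move=> X x VX xX; apply: V_cross_row nf VX xX.
Qed.

(** That is, G^Z_n has a vertex other than [S n]. *)
Definition nontriv (S Z : nat -> set T) n :=
  exists D, [/\ P n D, D <> S n & adj (Z n.+1) D].

Lemma full_nontriv n : full S Z Z' n -> nontriv S Z n.
Proof.
move=> fn; have [e|e] := pselect (S n = Z' n).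
  exists (Z n); split=> //; first by rewrite e; apply: (Z_neq HN).
  by have [z Zz] := P_inh (PZ n.+1); exists z => //; apply: (near_Z HN).
by case: fn => // ZZ'; exists (Z' n); split=> //; apply/nesym.
Qed.

Lemma nontriv_up n D y : P n D -> D <> S n -> adj (Z n.+1) D -> S n.+1 = Z n.+1 ->
  S n.+1 y -> near y D.
Proof.
move=> PD DS ZD e; apply: (near_S HN (P_up HN PD DS)); last by rewrite e.
  exact: (P_neqZ HN).
exact: (P_neqZ' HN).
Qed.

Lemma nontriv_succ n : nontriv S Z n -> nontriv S Z n.+1.
Proof.
move=> [D [PD DS ZD]]; have [z Zz] := P_inh (PZ n.+2).
have [e|e] := pselect (S n.+1 = Z n.+1); last first.
  by exists (Z n.+1); split=> //; [apply/nesym | exists z => //; apply: (near_Z HN)].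
exists D; split; [exact: (P_up HN) | by rewrite e; apply: (P_neqZ HN) |].
by exists z => //; apply: (nontriv_up PD DS ZD e); exact: (named_sub HN Zz).
Qed.

Lemma trivial_special n : nontriv S Z n \/ S n.+1 = Z n.+1 \/ S n.+1 = Z' n.+1.
Proof.
have [e|e] := pselect (S n.+1 = Z n.+1); first by right; left.
have [e'|e'] := pselect (S n.+1 = Z' n.+1); first by right; right.
left; have [PS1 S1S _] := S_move HN e e'; exists (S n.+1); split=> //.
exact/adj_sym/(adj_S_Z HN).
Qed.

(** [D] sees both halves of [S n.+1], hence is [S n.+2]. Under [full], [Z' n.+1] would see both and
    be [S n.+2] too, but unlike [D] it is not an n-class. *)
Lemma full_not_both1 n : nontriv S Z n -> S n.+1 = Z n.+1 -> ~ full S Z Z' n.+1.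
Proof.
move=> [D [PD DS ZD]] e [e'|ZZ']; first by apply: (Z_neq HN (n := n.+1)); rewrite -e.
have Z'S : Z' n.+1 <> S n.+1 by rewrite e; apply/nesym/(Z_neq HN).
have [z Zz] := P_inh (PZ n.+2); have [z' Zz'] := P_inh (PZ' n.+2).
have eZ' : Z' n.+1 = S n.+2.
  apply: (adj_both HN (PZ' _) Z'S); first exact: adj_sym.
  by apply: adj_sym; exists z' => //; apply: (near_Z' HN).
apply: (P_neqZ' HN PD); rewrite eZ'; apply: (adj_both HN (P_up HN PD DS)).
- by rewrite e; apply: (P_neqZ HN).
- by apply: adj_sym; exists z => //; apply: (nontriv_up PD DS ZD e);
    exact: (named_sub HN Zz).
- by apply: adj_sym; exists z' => //; apply: (nontriv_up PD DS ZD e);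
    exact: (named_sub' HN Zz').
Qed.

Lemma full_moving n : S n.+1 <> Z n.+1 -> S n.+1 <> Z' n.+1 -> full S Z Z' n.+1 ->
  Z' n.+1 = S n.+2.
Proof.
move=> e e' [//|ZZ']; have [z' Zz'] := P_inh (PZ' n.+2).
apply: (adj_both HN (PZ' _)); [exact/nesym | exact: adj_sym |].
by apply: adj_sym; exists z' => //; apply: (near_Z' HN).
Qed.

(** Any other [E] would see both halves of [S n.+1] and be [S n.+2], which is [Z' n.+1] and not an
    n-class. This makes [S n.+1] an end vertex of the graphs at radius n. *)
Lemma full_moving_nbr n E : S n.+1 <> Z n.+1 -> S n.+1 <> Z' n.+1 -> full S Z Z' n.+1 ->
  P n E -> adj (S n.+1) E -> E = S n \/ E = S n.+1.
Proof.
move=> e e' fn PE SE; apply: contrapT => h.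
have ES : E <> S n by move=> ?; apply: h; left.
have ES1 : E <> S n.+1 by move=> ?; apply: h; right.
have PE1 := P_up HN PE ES; have EZ := P_neqZ HN PE.
apply: (P_neqZ' HN PE); rewrite (full_moving e e' fn).
have [z Zz] := P_inh (PZ n.+2); have [z' Zz'] := P_inh (PZ' n.+2).
have EZ' := P_neqZ' HN PE.
apply: (adj_both HN PE1 ES1); apply: adj_sym.
  by exists z => //; apply: (near_S HN PE1 EZ EZ' SE); exact: (named_sub HN Zz).
by exists z' => //; apply: (near_S HN PE1 EZ EZ' SE); exact: (named_sub' HN Zz').
Qed.

Lemma static_nbr n E : S n.+1 = Z n.+1 \/ S n.+1 = Z' n.+1 -> P n E -> adj (S n) E ->
  [\/ E = S n, E = Z n | E = Z' n].
Proof.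
move=> e PE SE; have [?|ES] := pselect (E = S n); first exact: Or31.
have [?|EZ] := pselect (E = Z n); first exact: Or32.
have [?|EZ'] := pselect (E = Z' n); first exact: Or33.
have [z Zz] := P_inh (PZ n.+1); have [z' Zz'] := P_inh (PZ' n.+1).
have : E = S n.+1.
  apply: (adj_both HN PE ES); apply: adj_sym.
    by exists z => //; apply: (near_S HN PE EZ EZ' SE); exact: (named_sub HN Zz).
  by exists z' => //; apply: (near_S HN PE EZ EZ' SE); exact: (named_sub' HN Zz').
by case: e => -> e1; [case: (P_neqZ HN PE e1) | case: (P_neqZ' HN PE e1)].
Qed.

End Letter.

Lemma full_not_both S Z Z' (HN : named phi S Z Z') n : nontriv S Z n -> nontriv S Z' n ->
  full S Z Z' n.+1 -> full S Z' Z n.+1 -> False.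
Proof.
move=> nt nt' f f'; have HN' := named_swap HN.
have [e|e] := pselect (S n.+1 = Z n.+1); first exact: (full_not_both1 HN nt e f).
have [e'|e'] := pselect (S n.+1 = Z' n.+1); first exact: (full_not_both1 HN' nt' e' f').
apply: (Z_neq HN (n := n.+1)).
by rewrite (full_moving HN e e' f) (full_moving HN' e' e f').
Qed.

(** While G^Z_n is a single vertex, [S n.+1] is a half; being [Z' n.+1] would mean [full]. The only
    new class that [Z n.+2] could then see is [Z' n.+1], again excluded. *)
Lemma not_full_mono S Z Z' (HN : named phi S Z Z') n : S 0 = Z 0 ->
  (forall k, k <= n -> ~ full S Z Z' k) -> S n = Z n /\ ~ nontriv S Z n.
Proof.
move=> S0; elim: n => [|n IH] nf.
  split=> // [[D [PD DS ZD]]]; apply: (nf 0) => //; right; suff <- : D = Z' 0 by [].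
  have [x Dx] := P_inh PD; have [Zx|Zx] := named_0 HN x.
    by case: DS; rewrite S0; exact: (P_eq PD (named_Z HN 0) Dx Zx).
  exact: (P_eq PD (named_Z' HN 0) Dx Zx).
have [_ nt] : S n = Z n /\ ~ nontriv S Z n by apply: IH => k kn; apply: nf; apply: leqW.
have eS : S n.+1 = Z n.+1.
  by have [//|[//|e]] := trivial_special HN n; case: (nf n.+1 (leqnn _)); left.
split=> // [[D [PD DS ZD]]]; have [[PD' DS']|e|e] := P_succ HN PD.
- apply: nt; exists D; split=> //; rewrite -eS; apply: adj_sub ZD => x;
    exact: (named_sub HN).
- by apply: DS; rewrite e.
- by apply: (nf n.+1 (leqnn _)); right; rewrite -e.
Qed.

End Acyclic.

(** * Concatenations of the two graphs *)

Section Bowtie.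
Local Open Scope classical_set_scope.
Context {d : nat} {T : regular_tree d} (phi : T -> bool).
Implicit Types (x y z : T) (n k m : nat) (D E F X Y W : set T).
Local Notation cls := (ball_class phi).
Local Notation P := (ball_classes phi).
Local Notation V S Z n := (eg_vert (Gext phi S Z n)).

Section Letter.
Context {S Z Z' : nat -> set T} (HN : named phi S Z Z').
Let PS := named_S HN.
Let PZ := named_Z HN.
Let PZ' := named_Z' HN.

Lemma cnt_split n x : cnt (S n) x = cnt (Z n.+1) x + cnt (Z' n.+1) x.
Proof.
apply: cntU => y; last exact: (named_disj HN).
by split=> [/(named_split HN)|[/(named_sub HN)|/(named_sub' HN)]].
Qed.

Lemma idx_row n X X' x : P n X -> P n X' -> X' <> S n -> row S Z n X x ->
  cnt (row S Z n X') x = ext_index S Z n X X'.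
Proof. by move=> PX PX' XS xX; rewrite row_ns // (idx_cnt HN PX PX' xX). Qed.

Lemma idx_S n X x : P n X -> row S Z n X x ->
  ext_index S Z n X (S n) = cnt (Z n.+1) x + cnt (Z' n.+1) x.
Proof. by move=> PX xX; rewrite (idx_cnt HN PX (PS n) xX) cnt_split. Qed.

Lemma cnt_out n X X' x : V S Z n X -> row S Z n X x -> P n X' -> ~ V S Z n X' ->
  cnt X' x = 0.
Proof. by move=> VX xX PX' nV; apply: cnt0 => xX'; apply: nV;
  apply: (V_step HN VX PX'); exists x. Qed.

Lemma V_cover n X : P n X -> V S Z n X \/ V S Z' n X.
Proof.
move=> PX; have [s Ss] := P_inh (PS n); have [x Xx] := P_inh PX; rewrite (P_of PX Xx).
apply: (@nbr_ind _ _ (fun y => V S Z n (cls n y) \/ V S Z' n (cls n y)) s).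
  by left; rewrite -(P_of (PS n) Ss); apply: V_root.
move=> {Xx} {}x y Vx xy.
have [Sx|nSx] := pselect (S n x).
  have [Zx|Zx] := named_split HN Sx; [left|right].
    by apply: (V_step HN (V_root phi n) (P_cls _ _ _)); rewrite row_S; exists x => //;
      apply: nbr_near.
  apply: (V_step (named_swap HN) (V_root phi n) (P_cls _ _ _)); rewrite row_S.
  by exists x => //; apply: nbr_near.
have xS : cls n x <> S n by move=> e; apply: nSx; rewrite -e; apply: cls_id.
have xyA : adj (cls n x) (cls n y) by exists x; [apply: cls_id | apply: nbr_near].
case: Vx => Vx; [left|right].
  by apply: (V_step HN Vx (P_cls _ _ _)); rewrite row_ns.
by apply: (V_step (named_swap HN) Vx (P_cls _ _ _)); rewrite row_ns.
Qed.

Lemma full_adj n : full S Z Z' n -> S n = Z n \/ S n = Z' n ->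
  0 < ext_index S Z n (Z n) (Z' n) /\ 0 < ext_index S Z n (Z' n) (Z n).
Proof.
move=> fn SZ; have ZZ := Z_neq HN (n := n).
have [z Zz] := P_inh (PZ n.+1); have [z' Zz'] := P_inh (PZ' n.+1).
have aZ : adj (Z n.+1) (Z n) by exists z => //; apply: (near_Z HN).
have [e|e] := pselect (S n = Z n).
  have aZ' : adj (Z n) (Z' n) by exists z'; [rewrite -e;
    apply: (named_sub' HN) | apply: (near_Z' HN)].
  split; apply/(idx_pos HN) => //.
    by case: fn => [e'|]; [case: ZZ; rewrite -e | rewrite -e row_S].
  by rewrite row_ns; [apply: adj_sym | rewrite e; apply/nesym].
have e' : S n = Z' n by case: SZ.
have aZ' : adj (Z' n) (Z n) by exists z; [rewrite -e';
  apply: (named_sub HN) | apply: (near_Z HN)].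
split; apply/(idx_pos HN) => //; last by rewrite -e' row_S.
by rewrite row_ns; [apply: adj_sym | apply/nesym].
Qed.

Hypothesis acyclic : forall n, ~ G_has_cycle phi n.

(** The only possible neighbor is [Z n]: as a neighbor in G^Z_n, [Z' n] would see both halves and be
    [S n.+1], which is a half. *)
Lemma static_end n : S n.+1 = Z n.+1 \/ S n.+1 = Z' n.+1 ->
  eg_end (Gext phi S Z n) (S n).
Proof.
move=> e; split; first exact: V_root.
suff h u : V S Z n u -> u <> S n -> eg_adj (Gext phi S Z n) (S n) u -> u = Z n.
  by move=> u w Vu Vw uS wS au aw; rewrite (h u) // (h w).
move=> Vu uS au; have Pu := V_P HN Vu.
have uZ : adj u (Z n.+1).
  case: au => [/(idx_pos HN (PS n) Pu)|/(idx_pos HN Pu (PS n))].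
    by rewrite row_S => /adj_sym.
  by rewrite row_ns //; apply: (V_adj acyclic HN Vu uS).
have Su : adj (S n) u by apply: adj_sub (adj_sym uZ) => x; exact: (named_sub HN).
have [//|//|eu] := static_nbr acyclic HN e Pu Su.
have [z' Zz'] := P_inh (PZ' n.+1).
have : u = S n.+1.
  by apply: (adj_both acyclic HN Pu uS uZ); apply: adj_sym; rewrite eu;
    exists z' => //; apply: (near_Z' HN).
by case: e => -> e1; [case: (P_neqZ HN Pu e1) | case: (P_neqZ' HN Pu e1)].
Qed.

Lemma static_meet n X : S n.+1 = Z n.+1 \/ S n.+1 = Z' n.+1 ->
  V S Z n X -> V S Z' n X -> X = S n.
Proof.
move=> e VX VX'; have [//|[D [[PD _ _] eD _]]] := V_meet acyclic HN VX VX'.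
by case: e => e1; [case: (P_neqZ HN PD) | case: (P_neqZ' HN PD)]; rewrite eD e1.
Qed.

Lemma static_no_cross n X x : S n.+1 = Z n.+1 \/ S n.+1 = Z' n.+1 ->
  V S Z n X -> X <> S n -> row S Z n X x -> cnt (Z' n.+1) x = 0.
Proof.
move=> e VX XS xX; apply/cnt0/(V_no_cross acyclic HN VX xX) => // e1.
have PX := V_P HN VX.
by case: e => e2; [case: (P_neqZ HN PX) | case: (P_neqZ' HN PX)]; rewrite e1 e2.
Qed.

Lemma static_same n X X' x : S n.+1 = Z n.+1 \/ S n.+1 = Z' n.+1 ->
    V S Z n X -> V S Z n X' -> row S Z n X x ->
  cnt (row S Z n X') x =
    if (X == S n) && (X' == S n) then ext_index S Z n X X' - cnt (Z' n.+1) x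
    else ext_index S Z n X X'.
Proof.
move=> e VX VX' xX; have [PX PX'] := (V_P HN VX, V_P HN VX').
have [XS'|XS'] := X' =P S n; last by rewrite andbF; apply: idx_row.
rewrite andbT XS' row_S (idx_S PX xX); case: (X =P S n) => [_|XS]; first by rewrite addnK.
by rewrite (static_no_cross e VX XS xX) addn0.
Qed.

Lemma static_other n X X' x : S n.+1 = Z n.+1 \/ S n.+1 = Z' n.+1 ->
    V S Z n X -> V S Z' n X' -> row S Z n X x ->
  cnt (row S Z' n X') x = if (X == S n) && (X' == S n) then cnt (Z' n.+1) x else 0.
Proof.
move=> e VX VX' xX; have PX' := V_P (named_swap HN) VX'.
have [XS'|XS'] := X' =P S n.
  rewrite andbT XS' row_S; case: (X =P S n) => [//|XS].
  exact: (static_no_cross e VX XS xX).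
rewrite andbF row_ns //; apply: (cnt_out VX xX PX') => VX'2.
by apply: XS'; apply: static_meet e _ _.
Qed.

End Letter.

Hypothesis acyclic : forall n, ~ G_has_cycle phi n.

(** The isomorphism from the concatenation: each copy of [S n] goes to its own half. *)
Definition row2 (S A B : nat -> set T) n (p : set T + set T) :=
  match p with inl X => row S A n X | inr X => row S B n X end.

(** The two graphs share only [S n], whose copies become [A n.+1] and [B n.+1]. The indices [i] and
    [j] are those of the edge between the halves, and the loops at [S n] lose them because its count
    is the sum of the counts of the halves. *)
Lemma bowtie_static S A B (HN : named phi S A B) (Y Y' : nat ->
  set T) (HY : named phi S Y Y') n :
    (Y = A /\ Y' = B) \/ (Y = B /\ Y' = A) ->
    S n.+1 = A n.+1 \/ S n.+1 = B n.+1 -> full S Y Y' n.+1 ->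
  exists i j, concat2_ok (Gext phi S A n) (Gext phi S B n) (S n) (S n) i j /\
    eg_iso (Gext phi S Y n.+1) (concat2 (Gext phi S A n) (Gext phi S B n) (S n) (S n) i
      j).
Proof.
move=> YAB e fY; have PS := named_S HN; have PA := named_Z HN; have PB := named_Z' HN.
have HN' := named_swap HN.
have e' : S n.+1 = B n.+1 \/ S n.+1 = A n.+1 by case: e; [right|left].
pose i := ext_index S Y n.+1 (A n.+1) (B n.+1).
pose j := ext_index S Y n.+1 (B n.+1) (A n.+1).
have [i0 j0] : 0 < i /\ 0 < j.
  have eY : S n.+1 = Y n.+1 \/ S n.+1 = Y' n.+1 by case: YAB => [[-> ->]|[-> ->]].
  by have := full_adj HY fY eY; rewrite /i /j; case: YAB => [[-> ->]|[-> ->]] [].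
have iE x : row S Y n.+1 (A n.+1) x -> cnt (B n.+1) x = i.
  by move=> xA; rewrite /i (idx_cnt HY (PA _) (PB _) xA).
have jE x : row S Y n.+1 (B n.+1) x -> cnt (A n.+1) x = j.
  by move=> xA; rewrite /j (idx_cnt HY (PB _) (PA _) xA).
have rA : row S A n (S n) = A n.+1 by rewrite row_S.
have rB : row S B n (S n) = B n.+1 by rewrite row_S.
exists i, j; split.
  split; [exact: (static_end HN) | exact: (static_end HN') | |].
    have [x xA] := P_inh (P_row HY (PA n.+1)).
    apply/andP; split=> //; rewrite -(iE x xA).
    change (cnt (B n.+1) x <= ext_index S A n (S n) (S n)).
    by rewrite (idx_S HN (PS n) (x := x)) ?leq_addl // rA; exact: (row_sub HY xA).
  have [x xB] := P_inh (P_row HY (PB n.+1)).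
  apply/andP; split=> //; rewrite -(jE x xB).
  change (cnt (A n.+1) x <= ext_index S B n (S n) (S n)).
  by rewrite (idx_S HN' (PS n) (x := x)) ?leq_addl // rB; exact: (row_sub HY xB).
apply: eg_iso_sym; first exact: (inhabits (inl setT)).
have YP X : V S Y n.+1 X <-> P n.+1 X by split; [apply: (V_P HY) | apply: (full_V HY)].
exists (row2 S A B n); split.
  split=> [p|p q|X].
  - case=> [[X VX <-]|[X VX <-]]; apply/YP; [apply: (P_row HN) | apply: (P_row HN')].
      exact: (V_P HN).
    exact: (V_P HN').
  - have cross X X' : V S A n X -> V S B n X' -> row S A n X = row S B n X' -> False.
      move=> VX VX'; have [PX PX'] := (V_P HN VX, V_P HN' VX').
      have [->|XS] := pselect (X = S n); have [->|XS'] := pselect (X' = S n).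
      + by rewrite rA rB; apply: (Z_neq HN).
      + by rewrite rA (row_ns XS') => /esym; apply: (P_neqZ HN).
      + by rewrite rB (row_ns XS); apply: (P_neqZ' HN).
      + rewrite !row_ns // => XX; apply: XS; apply: (static_meet HN acyclic e VX).
        by rewrite XX.
    rewrite !inE /=; case=> [[X VX <-]|[X VX <-]] [[X' VX' <-]|[X' VX' <-]] /=.
    + by move/(row_inj HN (V_P HN VX) (V_P HN VX')) ->.
    + by move/(cross _ _ VX VX').
    + by move/esym/(cross _ _ VX' VX).
    + by move/(row_inj HN' (V_P HN' VX) (V_P HN' VX')) ->.
  - move/YP => /(P_succ HN) [[PX XS]|->|->].
    + have [VX|VX] := V_cover HN PX.
        by exists (inl X); [left; exists X | rewrite /= row_ns].
      by exists (inr X); [right; exists X | rewrite /= row_ns].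
    + by exists (inl (S n)); [left; exists (S n) => //; apply: V_root | rewrite /= rA].
    + by exists (inr (S n)); [right; exists (S n) => //; apply: V_root | rewrite /= rB].
move=> p q Vp Vq.
change (ext_index S Y n.+1 (row2 S A B n p) (row2 S A B n q) =
  eg_idx (concat2 (Gext phi S A n) (Gext phi S B n) (S n) (S n) i j) p q).
case: Vp Vq => [[X VX <-]|[X VX <-]] [[X' VX' <-]|[X' VX' <-]] /=.
- have [PX PX'] := (P_row HN (V_P HN VX), P_row HN (V_P HN VX')).
  have [x xX] := P_inh (P_row HY PX); rewrite (idx_cnt HY PX PX' xX).
  rewrite (static_same HN acyclic e VX VX' (row_sub HY xX)).
  by case: eqP => //= eX; rewrite -(iE x) // -rA -eX.
- have [PX PX'] := (P_row HN (V_P HN VX), P_row HN' (V_P HN' VX')).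
  have [x xX] := P_inh (P_row HY PX); rewrite (idx_cnt HY PX PX' xX).
  rewrite (static_other HN acyclic e VX VX' (row_sub HY xX)).
  by case: eqP => //= eX; rewrite -(iE x) // -rA -eX.
- have [PX PX'] := (P_row HN' (V_P HN' VX), P_row HN (V_P HN VX')).
  have [x xX] := P_inh (P_row HY PX); rewrite (idx_cnt HY PX PX' xX).
  rewrite (static_other HN' acyclic e' VX VX' (row_sub HY xX)).
  by case: eqP => //= eX; rewrite -(jE x) // -rB -eX.
- have [PX PX'] := (P_row HN' (V_P HN' VX), P_row HN' (V_P HN' VX')).
  have [x xX] := P_inh (P_row HY PX); rewrite (idx_cnt HY PX PX' xX).
  rewrite (static_same HN' acyclic e' VX VX' (row_sub HY xX)).
  by case: eqP => //= eX; rewrite -(jE x) // -rB -eX.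
Qed.


Section Moving.
Context {S Z Z' : nat -> set T} (HN : named phi S Z Z') (n : nat).
Hypotheses (eZ : S n.+1 <> Z n.+1) (eZ' : S n.+1 <> Z' n.+1).
Hypothesis exit : forall E, P n E -> adj (S n.+1) E -> E = S n \/ E = S n.+1.
Let PS := named_S HN.
Let PZ := named_Z HN.
Let PZ' := named_Z' HN.
Let nbS1 := S_move HN eZ eZ'.
Let PS1 : P n (S n.+1). Proof. by case: nbS1. Qed.
Let S1S : S n.+1 <> S n. Proof. by case: nbS1. Qed.

Lemma moving_V : V S Z n (S n.+1).
Proof.
by apply: (V_step HN (V_root phi n) PS1); rewrite row_S; exact/adj_sym/(adj_S_Z HN).
Qed.

Lemma moving_end : eg_end (Gext phi S Z n) (S n.+1).
Proof.
split; first exact: moving_V.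
suff h u : V S Z n u -> u <> S n.+1 -> eg_adj (Gext phi S Z n) (S n.+1) u -> u = S n.
  by move=> u w Vu Vw uS wS au aw; rewrite (h u) // (h w).
move=> Vu uS au; have Pu := V_P HN Vu; suff /(exit Pu) [] : adj (S n.+1) u by [].
case: au => [/(idx_pos HN PS1 Pu)|/(idx_pos HN Pu PS1) h]; first by rewrite row_ns.
by apply: adj_sym; apply: adj_sub h; exact: (row_sub HN).
Qed.

Lemma moving_pos : 0 < ext_index S Z n (S n.+1) (S n).
Proof. by apply/(idx_pos HN) => //; rewrite row_ns //; apply: adj_sym; case: nbS1. Qed.

Lemma moving_end_index :
  eg_end_index (Gext phi S Z n) (S n.+1) (ext_index S Z n (S n.+1) (S n)).
Proof.
left; split; first exact: moving_pos.
by exists (S n); split; [exact: V_root | apply/nesym |].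
Qed.

(** By [exit], [S n.+1] alone is a component of G_n deprived of [S n]. *)
Lemma moving_meet X : V S Z n X -> V S Z' n X -> X = S n \/ X = S n.+1.
Proof.
move=> VX VX'; have [?|[D [_ -> ln]]] := V_meet acyclic HN VX VX'; [by left | right].
have PX := V_P HN VX; have [x Xx] := P_inh PX; apply: (P_eq PX PS1 Xx).
apply: ln Xx => //; split=> [y S1y Sy|y y'|y y' Sy yy'].
- by apply: S1S; exact: (P_eq PS1 (PS n) S1y Sy).
- exact: class_sat.
- have ycl := cls_id phi n y'.
  have [|e|e] := exit (P_cls phi n y'); first by exists y => //; apply: nbr_near.
    by right; rewrite -e.
  by left; rewrite -e.
Qed.

Lemma moving_no_cross X x : V S Z n X -> X <> S n.+1 -> row S Z n X x ->
  cnt (Z' n.+1) x = 0.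
Proof. by move=> VX XS1 xX; apply/cnt0/(V_no_cross acyclic HN VX xX). Qed.

Lemma moving_same X X' x : V S Z n X -> V S Z n X' -> X <> S n.+1 -> row S Z n X x ->
  cnt (row S Z n X') x = ext_index S Z n X X'.
Proof.
move=> VX VX' XS1 xX; have [PX PX'] := (V_P HN VX, V_P HN VX').
have [XS'|XS'] := pselect (X' = S n); last exact: (idx_row HN).
by rewrite XS' row_S (idx_S HN PX xX) (moving_no_cross VX XS1 xX) addn0.
Qed.

Lemma moving_other X X' x : V S Z n X -> V S Z' n X' -> X <> S n.+1 -> X' <> S n.+1 ->
  row S Z n X x -> cnt (row S Z' n X') x = 0.
Proof.
move=> VX VX' XS1 XS1' xX; have PX' := V_P (named_swap HN) VX'.
have [->|XS'] := pselect (X' = S n); first by rewrite row_S (moving_no_cross VX XS1 xX).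
by rewrite row_ns //; apply: (cnt_out HN VX xX PX') => VX2; case: (moving_meet VX2 VX').
Qed.

Lemma moving_S X x : P n X -> X <> S n -> S n.+1 x -> 
  cnt X x = ext_index S Z n (S n.+1) X.
Proof. by move=> PX XS Sx; rewrite (idx_cnt HN PS1 PX (x := x)) // row_ns. Qed.

Lemma moving_out X x : P n X -> X <> S n -> X <> S n.+1 -> S n.+1 x -> cnt X x = 0.
Proof. by move=> PX XS XS1 Sx; apply: cnt0 => xX;
  have [] := exit PX (ex_intro2 _ _ x Sx xX). Qed.

End Moving.

(** The copies of [S n] become the two halves and [S n.+1] is the identified vertex. It is not
    special at radius n, so both graphs give the same index [m] from it to [S n]; this divides into
    [i] towards [A n.+1] and [m - i] towards [B n.+1]. *)
Lemma bowtie_moving S A B (HN : named phi S A B) (Y Y' : nat ->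
  set T) (HY : named phi S Y Y') n :
    (Y = A /\ Y' = B) \/ (Y = B /\ Y' = A) ->
    S n.+1 <> A n.+1 -> S n.+1 <> B n.+1 -> full S Y Y' n.+1 ->
  exists m i, concat1_ok (Gext phi S A n) (Gext phi S B n) (S n.+1) (S n.+1) m i /\
    eg_iso (Gext phi S Y n.+1)
      (concat1 (Gext phi S A n) (Gext phi S B n) (S n.+1) (S n.+1) m i).
Proof.
move=> YAB eA eB fY; have PS := named_S HN; have PA := named_Z HN; have PB := named_Z' HN.
have HN' := named_swap HN.
have [eY eY'] : S n.+1 <> Y n.+1 /\ S n.+1 <> Y' n.+1 by case: YAB => [[-> ->]|[-> ->]].
have exit E : P n E -> adj (S n.+1) E -> E = S n \/ E = S n.+1.
  exact: (full_moving_nbr acyclic HY eY eY' fY).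
have [PS1 S1S _] := S_move HN eA eB.
pose m := ext_index S A n (S n.+1) (S n); pose i := ext_index S Y n.+1 (S n.+1) (A n.+1).
have mB : ext_index S B n (S n.+1) (S n) = m by rewrite /m /ext_index; case: eqP.
have rA : row S A n (S n) = A n.+1 by rewrite row_S.
have rB : row S B n (S n) = B n.+1 by rewrite row_S.
have iE x : row S Y n.+1 (S n.+1) x -> cnt (A n.+1) x = i.
  by move=> xS; rewrite /i (idx_cnt HY (PS _) (PA _) xS).
have miE x : row S Y n.+1 (S n.+1) x -> cnt (B n.+1) x = m - i.
  move=> xS; rewrite -(iE x xS) /m (idx_S HN PS1 (x := x)) ?addKn //.
  by rewrite row_ns //; exact: (row_sub HY xS).
have [i0 mi0] : 0 < i /\ 0 < m - i.
  have [x Yx] := P_inh (named_Z HY n.+2).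
  have xS : row S Y n.+1 (S n.+1) x by rewrite row_S.
  rewrite -(miE x xS) -(iE x xS) -!near_cnt.
  have xY : near x (Y n.+1) by apply: (near_Z HY).
  have xY' : near x (Y' n.+1).
    case: fY => [//|[u Yu uY']].
    exact: near_const (named_Z HY _) (named_Z' HY _) Yu Yx uY'.
  by case: YAB => [[<- <-]|[<- <-]].
have VA1 := moving_V HN eA eB; have VB1 := moving_V HN' eB eA.
exists m, i; split.
  split.
  - by split; [apply: (moving_end HN) | apply: (moving_end HN')].
  - split; first exact: (moving_end_index HN eA eB).
    by rewrite -mB; exact: (moving_end_index HN' eB eA).
  - change (ext_index S A n (S n.+1) (S n.+1) = ext_index S B n (S n.+1) (S n.+1)).
    by rewrite /ext_index; case: eqP.
  - by rewrite i0 -subn_gt0.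
apply: eg_iso_sym; first exact: (inhabits (inl setT)).
have YP X : V S Y n.+1 X <-> P n.+1 X by split; [apply: (V_P HY) | apply: (full_V HY)].
exists (row2 S A B n); split.
  split=> [p|p q|X].
  - case=> [[X VX <-]|[X [VX _] <-]]; apply/YP; [apply: (P_row HN) | apply: (P_row HN')].
      exact: (V_P HN).
    exact: (V_P HN').
  - have cross X X' : V S A n X -> V S B n X' -> X' <> S n.+1 ->
      row S A n X = row S B n X' -> False.
      move=> VX VX' XS1; have [PX PX'] := (V_P HN VX, V_P HN' VX').
      have [->|XS] := pselect (X = S n); have [->|XS'] := pselect (X' = S n).
      + by rewrite rA rB; apply: (Z_neq HN).
      + by rewrite rA (row_ns XS') => /esym; apply: (P_neqZ HN).
      + by rewrite rB (row_ns XS); apply: (P_neqZ' HN).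
      + rewrite !row_ns // => XX; have [//|//] : X = S n \/ X = S n.+1.
          by apply: (moving_meet HN eA eB exit VX); rewrite XX.
        by move=> e; apply: XS1; rewrite -XX.
    rewrite !inE /=; case=> [[X VX <-]|[X [VX X1] <-]] [[X' VX' <-]|[X' [VX' X1'] <-]] /=.
    + by move/(row_inj HN (V_P HN VX) (V_P HN VX')) ->.
    + by move/(cross _ _ VX VX' X1').
    + by move/esym/(cross _ _ VX' VX X1).
    + by move/(row_inj HN' (V_P HN' VX) (V_P HN' VX')) ->.
  - move/YP => /(P_succ HN) [[PX XS]|->|->].
    + have [VX|VX] := pselect (V S A n X).
        by exists (inl X); [left; exists X | rewrite /= row_ns].
      have [//|VX'] := V_cover HN PX.
      exists (inr X); [right; exists X => // | by rewrite /= row_ns].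
      by split=> // e; apply: VX; rewrite e.
    + by exists (inl (S n)); [left; exists (S n) => //; apply: V_root | rewrite /= rA].
    + exists (inr (S n)); [right; exists (S n) => // | by rewrite /= rB].
      by split; [apply: V_root | apply/nesym].
have sub1 x : row S Y n.+1 (S n.+1) x -> S n.+1 x by move=> xS; exact: (row_sub HY xS).
move=> p q Vp Vq.
change (ext_index S Y n.+1 (row2 S A B n p) (row2 S A B n q) =
  eg_idx (concat1 (Gext phi S A n) (Gext phi S B n) (S n.+1) (S n.+1) m i) p q).
case: Vp Vq => [[X VX <-]|[X [VX X1] <-]] [[X' VX' <-]|[X' [VX' X1'] <-]] /=.
- have [PX PX'] := (P_row HN (V_P HN VX), P_row HN (V_P HN VX')).
  have [x xX] := P_inh (P_row HY PX); rewrite (idx_cnt HY PX PX' xX).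
  have [eX|X1] := X =P S n.+1; last exact: (moving_same HN eA eB VX VX' X1 (row_sub HY
    xX)).
  rewrite eX (row_ns S1S) in xX; have Sx := sub1 x xX; rewrite eX.
  have [eX'|X1'] := X' =P S n.+1.
    by rewrite eX' /= (row_ns S1S) (moving_S HN eA eB).
  have [eX'|XS'] := pselect (X' = S n).
    by rewrite eX' /= rA (moving_pos HN eA eB) iE.
  rewrite /= (row_ns XS') -(moving_S HN eA eB (V_P HN VX') XS' Sx).
  by rewrite (moving_out exit (V_P HN VX') XS' X1' Sx).
- have [PX PX'] := (P_row HN (V_P HN VX), P_row HN' (V_P HN' VX')).
  have [x xX] := P_inh (P_row HY PX); rewrite (idx_cnt HY PX PX' xX).
  have [eX|X1] := X =P S n.+1; last exact: (moving_other HN eA eB exit VX VX' X1 X1'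
    (row_sub HY xX)).
  rewrite eX (row_ns S1S) in xX; have Sx := sub1 x xX.
  have [eX'|XS'] := pselect (X' = S n).
    by rewrite eX' /= rB (moving_pos HN' eB eA) miE.
  rewrite /= (row_ns XS') -(moving_S HN' eB eA (V_P HN' VX') XS' Sx).
  by rewrite (moving_out exit (V_P HN' VX') XS' X1' Sx).
- have [PX PX'] := (P_row HN' (V_P HN' VX), P_row HN (V_P HN VX')).
  have [x xX] := P_inh (P_row HY PX); rewrite (idx_cnt HY PX PX' xX).
  have xX' := row_sub HY xX; have [eX'|X1'] := X' =P S n.+1.
    have eB0 := moving_same HN' eB eA VX VB1 X1 xX'; rewrite (row_ns S1S) in eB0.
    by rewrite eX' (row_ns S1S) eB0.
  exact: (moving_other HN' eB eA (exit) VX VX' X1 X1' xX').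
- have [PX PX'] := (P_row HN' (V_P HN' VX), P_row HN' (V_P HN' VX')).
  have [x xX] := P_inh (P_row HY PX); rewrite (idx_cnt HY PX PX' xX).
  exact: (moving_same HN' eB eA VX VX' X1 (row_sub HY xX)).
Qed.

Lemma idx0 S Z Z' (HN : named phi S Z Z') X x : P 0 X -> row S Z 0 X x ->
  ext_index S Z 0 X (Z 0) + ext_index S Z 0 X (Z' 0) = d.
Proof.
move=> PX xX; rewrite (idx_cnt HN PX (named_Z HN 0) xX) (idx_cnt HN PX (named_Z' HN 0)
  xX).
rewrite -(cntU (E := setT)) => [|y|y]; last exact: (named_disj0 HN).
  by rewrite /cnt (eq_count (a2 := predT)) ?count_predT ?nbr_size // => z;
    rewrite in_setT.
by split=> // _; exact: (named_0 HN).
Qed.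

Lemma P0 S Z Z' (HN : named phi S Z Z') X : P 0 X -> X = Z 0 \/ X = Z' 0.
Proof.
move=> PX; have [x Xx] := P_inh PX; have [h|h] := named_0 HN x; [left|right].
  exact: (P_eq PX (named_Z HN 0) Xx h).
exact: (P_eq PX (named_Z' HN 0) Xx h).
Qed.

Lemma bowtie0 S A B (HN : named phi S A B) (Y Y' : nat -> set T) (HY : named phi S Y Y') :
    (Y = A /\ Y' = B) \/ (Y = B /\ Y' = A) -> full S Y Y' 0 ->
  exists i j, concat2_ok (@Gempty d T) (@Gempty d T) setT setT i j /\
    eg_iso (Gext phi S Y 0) (concat2 (@Gempty d T) (@Gempty d T) setT setT i j).
Proof.
move=> YAB fY; have PA := named_Z HN 0; have PB := named_Z' HN 0.
pose i := ext_index S Y 0 (A 0) (B 0); pose j := ext_index S Y 0 (B 0) (A 0).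
have [i0 j0] : 0 < i /\ 0 < j.
  have eY : S 0 = Y 0 \/ S 0 = Y' 0 by exact: (named_S0 HY).
  by have := full_adj HY fY eY; rewrite /i /j; case: YAB => [[-> ->]|[-> ->]] [].
have dE X : P 0 X -> ext_index S Y 0 X (A 0) + ext_index S Y 0 X (B 0) = d.
  move=> PX; have [x xX] := P_inh (P_row HY PX); have := idx0 HY PX xX.
  by case: YAB => [[-> ->]|[-> ->]] //; rewrite addnC.
have subl a b c : a + b = c -> a = c - b by move=> <-; rewrite addnK.
have subr a b c : a + b = c -> b = c - a by move=> <-; rewrite addKn.
exists i, j; split.
  split.
  - by split=> // u w -> ->.
  - by split=> // u w -> ->.
  - by rewrite i0 /= -(dE _ PA) leq_addl.
  - by rewrite j0 /= -(dE _ PB) leq_addr.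
apply: eg_iso_sym; first exact: (inhabits (inl setT)).
have YP X : V S Y 0 X <-> P 0 X by split; [apply: (V_P HY) | apply: (full_V HY)].
exists (fun p => match p with inl _ => A 0 | inr _ => B 0 end); split.
  split=> [p|p q|X].
  - by case=> [[X _ <-]|[X _ <-]]; apply/YP.
  - have AB := Z_neq HN (n := 0); rewrite !inE /=.
    by case=> [[X -> <-]|[X -> <-]] [[X' -> <-]|[X' -> <-]] //= => /esym.
  - by move/YP/(P0 HN) => [->|->]; [exists (inl setT); [left; exists setT|]
      | exists (inr setT); [right; exists setT|]].
move=> p q; case=> [[X -> <-]|[X -> <-]] [[X' -> <-]|[X' -> <-]] /=; rewrite ?eqxx /=.
- by change (ext_index S Y 0 (A 0) (A 0) = d - i); have := subl _ _ _ (dE _ PA).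
- by [].
- by [].
- by change (ext_index S Y 0 (B 0) (B 0) = d - j); have := subr _ _ _ (dE _ PB).
Qed.

Lemma iso0 S Z Z' (HN : named phi S Z Z') : S 0 = Z 0 -> ~ full S Z Z' 0 ->
  eg_iso (Gext phi S Z 0) (@Gempty d T).
Proof.
move=> S0 nf; have PS := named_S HN 0.
have nZ x : Z 1 x -> ~ near x (Z' 0) by move=> Zx xZ; apply: nf; right; exists x.
have VS X : V S Z 0 X -> X = S 0.
  move: X; apply: (V_ind HN) => // X Y _ -> /(P0 HN) [->//|->];
    rewrite row_S => -[x Zx xZ].
  by case: (nZ x Zx).
exists (fun=> setT); split.
  split=> [X _//|X Y|X /= ->]; first by rewrite !inE => /VS -> /VS ->.
  by exists (S 0) => //; apply: V_root.
move=> X Y /VS -> /VS ->; change (d = ext_index S Z 0 (S 0) (S 0)).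
have [x xX] := P_inh (P_row HN PS).
have := idx0 HN PS xX; rewrite (idx_cnt HN PS (named_Z' HN 0) xX) -S0.
by rewrite cnt0 ?addn0 //; apply: nZ; rewrite -(row_S (S := S)).
Qed.

Lemma central_class n X : P n X -> central phi n X = X.
Proof.
move=> PX; apply/seteqP; split=> [y [x Xx]|x Xx]; first by rewrite -(P_of PX Xx).
by exists x => //; apply: cls_id.
Qed.

Lemma central_sub n X Y : P n X -> P n.+1 Y -> Y `<=` X -> central phi n Y = X.
Proof.
move=> PX [y _ <-] YX; rewrite central_cls; apply/esym/P_of => //.
exact/YX/cls_id.
Qed.

(** At positive radius, the central class of [S n.+1] is [S n] if [S n.+1] is a half and [S n.+1]
    itself otherwise, which selects the kind of concatenation. *)
Lemma bowtie S A B (HN : named phi S A B) (Y Y' : nat ->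
  set T) (HY : named phi S Y Y') n :
    (Y = A /\ Y' = B) \/ (Y = B /\ Y' = A) -> full S Y Y' n ->
  iso_bowtie phi S A B n (Gext phi S Y n).
Proof.
case: n => [|n] YAB fY.
  by split=> // _; exact: (bowtie0 HN HY).
have PS := named_S HN.
have C1 : S n.+1 = A n.+1 \/ S n.+1 = B n.+1 -> Cclass phi S n = S n.
  by case=> e; apply: (central_sub (PS n) (PS n.+1)) => x; rewrite e;
    [apply: (named_sub HN) | apply: (named_sub' HN)].
have [e|e] := pselect (S n.+1 = A n.+1 \/ S n.+1 = B n.+1).
  split; rewrite /Cprev /Sprev /= (C1 e) // => _.
  exact: (bowtie_static HN HY).
have eA : S n.+1 <> A n.+1 by move=> h; apply: e; left.
have eB : S n.+1 <> B n.+1 by move=> h; apply: e; right.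
have [PS1 S1S _] := S_move HN eA eB.
have C2 : Cclass phi S n = S n.+1 by apply: central_class.
split; rewrite /Cprev /Sprev /= C2 // => _.
exact: (bowtie_moving HN HY).
Qed.

End Bowtie.

(** * Stability implies bounded type *)

Section Stable.
Local Open Scope classical_set_scope.
Context {d : nat} {T : regular_tree d} (phi : T -> bool).

(** At a full radius n the graph has n + 2 vertices, so a stable sequence has at most one full
    radius. Later graphs are images of earlier ones under [row], and a vertex of the tree left out
    by one of them is never special again. *)
Lemma stable_bounded S Z Z' (HN : named phi S Z Z') : sturmian phi ->
    (forall n, ~ G_has_cycle phi n) -> (forall v n, exists k, n <= k /\ S k v) ->
  ~ eg_eventually_stable (Gext phi S Z).
Proof.
move=> Hphi acyclic U [N iso].
have uniq m n : N <= m -> N <= n -> full S Z Z' m -> full S Z Z' n -> m = n.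
  move=> Nm Nn fm fn; have [f [fb _]] := iso m n Nm Nn.
  have VP k : full S Z Z' k -> eg_vert (Gext phi S Z k) = ball_classes phi k.
    by move=> fk; apply/seteqP; split=> X; [apply: (V_P HN) | apply: (full_V HN)].
  rewrite !VP // in fb; apply/eqP; rewrite -(eqn_add2r 2); apply/eqP/card_eq_II.
  apply: card_eq_trans (Hphi n); apply: card_eq_trans (card_esym (Hphi m)) _.
  by apply/card_set_bijP; exists f.
have [M nfull] : exists M, forall n, M <= n -> ~ full S Z Z' n.
  have [[m [Nm fm]]|no] := pselect (exists m, N <= m /\ full S Z Z' m).
    exists (maxn N m.+1) => n; rewrite geq_max => /andP [Nn mn] fn.
    by move: mn; rewrite (uniq m n) // ltnn.
  by exists N => n Nn fn; apply: no; exists n.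
have [v Zv] := P_inh (named_Z' HN M.+1).
have VM k X : eg_vert (Gext phi S Z (k + M.+1)) X -> ~ X v.
  elim: k X => [|k IH] X.
    rewrite add0n (V_row acyclic HN) => [[X0 VX0 <-] Xv|]; last exact: nfull (leqnSn _).
    have e := P_eq (P_row HN (V_P HN VX0)) (named_Z' HN _) Xv Zv.
    have [XS|XS] := pselect (X0 = S M).
      by rewrite XS row_S in e; apply: (Z_neq HN e).
    by rewrite row_ns // in e; apply: (P_neqZ' HN (V_P HN VX0) e).
  rewrite addSn (V_row acyclic HN); last by apply/nfull/leqW/ltnW/leq_addl.
  by move=> [X0 VX0 <-] /(row_sub HN); apply: IH VX0.
have [k [Mk Sk]] := U v M.+1.
by have := VM (k - M.+1) (S k); rewrite subnK // => /(_ (V_root phi k)).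
Qed.

End Stable.

(** * Construction of K and of the sequence n_k *)

Section Induction.
Context {d : nat} {T : regular_tree d} (phi : T -> bool).

Lemma acyclic_induction (S A B : nat -> set T) (HN : named phi S A B) : S 0 = A 0 ->
    (forall n, ~ G_has_cycle phi n) ->
  exists (K : option nat) (nk : nat -> nat),
    (forall k, (if K is Some K0 then k <= K0 else true) -> nk k = k) /\
    (forall n, (if K is Some K0 then n < K0 else true) ->
       eg_iso (Gext phi S A n) (Gprev phi S A n) /\
       iso_bowtie phi S A B n (Gext phi S B n)) /\
    (forall n, K = Some n ->
       (iso_bowtie phi S A B n (Gext phi S A n) /\
        iso_bowtie phi S A B n (Gext phi S B n)) \/
       (iso_bowtie phi S A B n (Gext phi S A n) /\
        eg_iso (Gext phi S B n) (Gprev phi S B n))) /\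
    (forall K0 n, K = Some K0 -> K0 < n -> (forall k, n <> nk k) ->
       eg_iso (Gext phi S A n) (Gprev phi S A n) /\
       eg_iso (Gext phi S B n) (Gprev phi S B n)) /\
    (forall K0 n, K = Some K0 -> K0 < n -> (exists k, n = nk k) ->
       (iso_bowtie phi S A B n (Gext phi S A n) /\
        eg_iso (Gext phi S B n) (Gprev phi S B n)) \/
       (eg_iso (Gext phi S A n) (Gprev phi S A n) /\
        iso_bowtie phi S A B n (Gext phi S B n))).
Proof.
move=> S0 acyclic; have HN' := named_swap HN.
pose fA := full S A B; pose fB := full S B A.
have bA n : fA n -> iso_bowtie phi S A B n (Gext phi S A n).
  by apply: (bowtie acyclic HN HN); left.
have bB n : fB n -> iso_bowtie phi S A B n (Gext phi S B n).
  by apply: (bowtie acyclic HN HN'); right.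
have iA n : ~ fA n -> eg_iso (Gext phi S A n) (Gprev phi S A n).
  by case: n => [|n]; [apply: (iso0 HN) | apply: (iso_prev acyclic HN)].
have fB0 : fB 0 by left.
have iB n : ~ fB n -> eg_iso (Gext phi S B n) (Gprev phi S B n).
  by case: n => [//|n]; apply: (iso_prev acyclic HN').
(* Until [fA] holds, [S n = A n], which is one of the two alternatives in [fB n]. *)
have before n : (forall k, k <= n -> ~ fA k) -> fB n.
  by move=> nf; left; case: (not_full_mono HN S0 nf).
have [[K0 fK minK]|noK] :
    (exists2 K0, fA K0 & forall k, k < K0 -> ~ fA k) \/ forall n, ~ fA n; last first.
- exists None, id; split=> //; split=> [n _|]; last by split.
  by split; [apply: iA | apply/bB/before => k _].
- have ntB n : nontriv phi S B n.
    by elim: n => [|n]; [apply: (full_nontriv HN') | apply: (nontriv_succ HN')].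
  have ntA n : K0 <= n -> nontriv phi S A n.
    move/subnK <-; elim: (n - K0) => [|k IH]; first exact: (full_nontriv HN).
    by rewrite addSn; apply: (nontriv_succ HN).
  have excl n : K0 < n -> fA n -> fB n -> False.
    by case: n => // n Kn; apply: (full_not_both acyclic HN) => //; apply: ntA.
  (* The value [K0] is a default for the remaining [k]; the condition [K0 < n] keeps it out of the
     last two clauses. *)
  exists (Some K0), (fun k => if (k <= K0) || `[< fA k \/ fB k >] then k else K0).
  split=> [k ->//|]; split=> [n nK|].
    by split; [apply/iA/minK | apply: bB; apply: before => k kn; apply: minK;
      apply: leq_ltn_trans nK].
  split=> [n [<-]|].
    by have [/bB ?|/iB ?] := pselect (fB K0); [left|right]; split=> //; apply: bA.
  split=> [_ n [<-] Kn h|_ n [<-] Kn [k]].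
    have nf : ~ (fA n \/ fB n).
      by move=> f; apply: (h n); rewrite (asboolT f) orbT.
    by split; [apply: iA | apply: iB] => f; apply: nf; [left|right].
  case: ifP => [|_ e]; last by rewrite e ltnn in Kn.
  case/orP=> [kK e|/asboolP f e]; first by rewrite e ltnNge kK in Kn.
  subst k; case: f => f; [left|right]; split; try by [apply: bA | apply: bB].
    by apply: iB => f'; apply: (excl n).
  by apply: iA => f'; apply: (excl n).
have [[n fn]|no] := pselect (exists n, fA n); last by right=> n fn; apply: no; exists n.
left; have ex : exists n, `[< fA n >] by exists n; apply/asboolP.
exists (ex_minn ex); case: ex_minnP => m /asboolP fm mm //.
by move=> k km /asboolP /mm; rewrite leqNgt km.
Qed.

End Induction.

(* K = None stands for K = infinity. *)
Theorem theorem1p2 (d : nat) (T : regular_tree d) (phi : T -> bool)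
    (S A B : nat -> set T) (Hphi : sturmian phi)
    (Hnames : sturmian_naming phi S A B) :
  ((forall n, ~ G_has_cycle phi n) ->
   exists (K : option nat) (nk : nat -> nat),
     (forall k, (if K is Some K0 then k <= K0 else true) -> nk k = k) /\
     (forall n, (if K is Some K0 then n < K0 else true) ->
        eg_iso (Gext phi S A n) (Gprev phi S A n) /\
        iso_bowtie phi S A B n (Gext phi S B n)) /\
     (forall n, K = Some n ->
        (iso_bowtie phi S A B n (Gext phi S A n) /\
         iso_bowtie phi S A B n (Gext phi S B n)) \/
        (iso_bowtie phi S A B n (Gext phi S A n) /\
         eg_iso (Gext phi S B n) (Gprev phi S B n))) /\
     (forall K0 n, K = Some K0 -> K0 < n -> (forall k, n <> nk k) ->
        eg_iso (Gext phi S A n) (Gprev phi S A n) /\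
        eg_iso (Gext phi S B n) (Gprev phi S B n)) /\
     (forall K0 n, K = Some K0 -> K0 < n -> (exists k, n = nk k) ->
        (iso_bowtie phi S A B n (Gext phi S A n) /\
         eg_iso (Gext phi S B n) (Gprev phi S B n)) \/
        (eg_iso (Gext phi S A n) (Gprev phi S A n) /\
         iso_bowtie phi S A B n (Gext phi S B n)))) /\
  ((exists n, G_has_cycle phi n) -> bounded_type phi S) /\
  (bounded_type phi S <->
     eg_eventually_stable (Gext phi S A) \/ eg_eventually_stable (Gext phi S B)).
Proof.
have HN := sturmian_named Hphi Hnames; have bP := bounded_typeP HN.
have S0 : S 0 = A 0 by case: Hnames => _ [].
have unb : ~ bounded_type phi S -> forall v n, exists k, n <= k /\ S k v.
  move=> nb v n; apply: contrapT => h; apply/nb/bP; apply: (bdd_spread HN (v := v)).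
  by exists n => k nk Sv; apply: h; exists k.
have cycb : (exists n, G_has_cycle phi n) -> bounded_type phi S.
  move=> [n cn]; apply: contrapT => /unb U; have v3 := unbounded_valence HN U.
  exact: (no_special_cycle v3 HN U (special_cycle_of HN v3 cn)).
split; [exact: acyclic_induction HN S0 | split=> //; split].
  by move/bP; apply: bounded_stable_letter.
move=> st; apply: contrapT => nb; have U := unb nb.
have acyclic n : ~ G_has_cycle phi n by move=> cn; apply: nb; apply: cycb; exists n.
case: st; first exact: (stable_bounded HN Hphi acyclic U).
exact: (stable_bounded (named_swap HN) Hphi acyclic U).
Qed.
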